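(* Let $\lambda=\sum_{i=1}^n m_i\omega_i$ be a dominant integral weight of $\mathfrak{sp}_{2n}$. The set of elements $f^{\mathbf s}v_\lambda$, $\mathbf s\in S(\lambda)$, forms a basis of $\mathrm{gr}\,V(\lambda)$.
   Context: Work over $\mathbb C$. Let $\mathfrak g=\mathfrak{sp}_{2n}=\mathfrak n^+\oplus\mathfrak h\oplus\mathfrak n^-$ be a Cartan decomposition, with simple roots $\alpha_1,\dots,\alpha_n$ (standard labelling, $\alpha_n$ the long simple root) and fundamental weights $\omega_1,\dots,\omega_n$. The positive roots are $$\alpha_{i,j}=\alpha_i+\alpha_{i+1}+\dots+\alpha_j,\quad \alpha_{i,\overline{j}}=\alpha_i+\alpha_{i+1}+\dots+\alpha_n+\alpha_{n-1}+\dots+\alpha_j,\qquad 1\le i\le j\le n,$$ where $\alpha_{i,n}=\alpha_{i,\overline n}$; there are $n^2$ of them. Write $\alpha_{\overline i}=\alpha_{i,\overline i}$ (and note $\alpha_i=\alpha_{i,i}$). For each positive root $\alpha$ fix a nonzero $f_\alpha\in\mathfrak n^-_{-\alpha}$. PBW filtration: $U(\mathfrak n^-)_s=\mathrm{span}\{x_1\cdots x_l: x_i\in\mathfrak n^-,\ l\le s\}$. $V(\lambda)$ is the irreducible $\mathfrak g$-module with highest weight $\lambda$ and highest weight vector $v_\lambda$; $V(\lambda)_s=U(\mathfrak n^-)_sv_\lambda$, and $\mathrm{gr}\,V(\lambda)=\bigoplus_{s\ge0}V(\lambda)_s/V(\lambda)_{s-1}$ (with $V(\lambda)_{-1}=0$),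 a cyclic module over the symmetric algebra $S(\mathfrak n^-)=\mathrm{gr}\,U(\mathfrak n^-)$ generated by $v_\lambda$. For a multi-exponent $\mathbf s=(s_\alpha)_{\alpha>0}$, $s_\alpha\in\mathbb Z_{\ge0}$, put $f^{\mathbf s}=\prod_{\alpha>0}f_\alpha^{s_\alpha}\in S(\mathfrak n^-)$. Symplectic Dyck paths: let $J=\{1<2<\dots<n<\overline{n-1}<\dots<\overline1\}$, and for $x\in J$ let $x+1$ be the smallest element of $J$ bigger than $x$. A (symplectic) Dyck path is a sequence $\mathbf p=(p(0),\dots,p(k))$, $k\ge0$, of positive roots such that: (a) $p(0)=\alpha_i$ for some $1\le i\le n$; (b) $p(k)=\alpha_j$ or $p(k)=\alpha_{\overline j}$ for some $i\le j\le n$; (c) if $p(s)=\alpha_{r,q}$ with $r,q\in J$, then $p(s+1)=\alpha_{r,q+1}$ or $p(s+1)=\alpha_{r+1,q}$. Let $\mathbb D$ be the set of Dyck paths. $P(\lambda)\subset\mathbb R_{\ge0}^{n^2}$ is the polytope of all $(s_\alpha)_{\alpha>0}$ with $s_\alpha\ge 0$ such that for every $\mathbf p=(p(0),\dots,p(k))\in\mathbb D$: if $p(0)=\alpha_i$ and $p(k)=\alpha_j$, then $s_{p(0)}+\dots+s_{p(k)}\le m_i+\dots+m_j$; if $p(0)=\alpha_i$ and $p(k)=\alpha_{\overline j}$, then $s_{p(0)}+\dots+s_{p(k)}\le m_i+\dots+m_n$. $S(\lambda)$ is the set of integral points of $P(\lambda)$. *)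

(* Defs.v *)
From HB Require Import structures.
From mathcomp Require Import all_boot all_order all_algebra.
From mathcomp Require Import generic_quotient ring_quotient.
From mathcomp Require Import boolp classical_sets reals.
From mathcomp Require Export complex.
From mathcomp Require Import zify.

Set Implicit Arguments.
Unset Strict Implicit.
Unset Printing Implicit Defensive.

Import GRing.Theory Num.Theory.

Local Open Scope ring_scope.
Local Open Scope quotient_scope.

Section Span.
Variables (K : pzRingType) (V : lmodType K).

Definition lspan (A : set V) : {pred V} := fun u =>
  `[< exists (k : nat) (c : 'I_k -> K) (a : 'I_k -> V),
        (forall i, A (a i)) /\ u = \sum_(i < k) c i *: a i >].

Lemma lspan_submod A : submod_closed (lspan A).
Proof.
split=> [|a u w].
  by apply/asboolP; exists 0, (fun=> 0), (fun=> 0); split=> [[]|] //; rewrite big_ord0.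
move=> /asboolP[k [c [b [Ab ->]]]] /asboolP[l [d [e [Ae ->]]]]; apply/asboolP.
exists (k + l)%N, (fun i => match split i with inl j => a * c j | inr j => d j end),
  (fun i => match split i with inl j => b j | inr j => e j end).
split=> [i|]; first by case: (split i).
rewrite big_split_ord /= scaler_sumr; congr (_ + _); apply: eq_bigr => i _.
  by rewrite -[lshift _ _]/(unsplit (inl i)) unsplitK scalerA.
by rewrite -[rshift _ _]/(unsplit (inr i)) unsplitK.
Qed.

HB.instance Definition _ A :=
  GRing.isSubmodClosed.Build K V (lspan A) (lspan_submod A).

End Span.

Section Submodule.
Variables (K : pzRingType) (V : lmodType K) (S : submodClosed V).

Record submod : predArgType := Submod { submod_val : V; _ : submod_val \in S }.
HB.instance Definition _ := [isSub of submod for submod_val].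
HB.instance Definition _ := [Choice of submod by <:].

Lemma submod_inj : injective submod_val. Proof. exact: val_inj. Qed.

Lemma submod_closed_mem : submod_closed (fun u => u \in S).
Proof. by split=> [|a u w uS wS]; rewrite unfold_in /= ?rpred0 // rpredD ?rpredZ. Qed.

HB.instance Definition _ :=
  GRing.SubChoice_isSubLmodule.Build K V (fun u => u \in S) submod submod_closed_mem.

End Submodule.

Section QuotientModule.
Variables (K : pzRingType) (W : lmodType K) (S : submodClosed W).

Definition quot_mem : {pred W} := fun u => u \in S.

Lemma quot_mem_zmod : zmod_closed quot_mem.
Proof.
split=> [|u w uS wS]; rewrite unfold_in /= ?rpred0 //.
by rewrite -scaleN1r rpredD ?rpredZ.
Qed.

HB.instance Definition _ := GRing.isZmodClosed.Build W quot_mem quot_mem_zmod.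

Definition quotmod := Quotient.quot quot_mem.
HB.instance Definition _ := GRing.Zmodule.on quotmod.
HB.instance Definition _ := EqQuotient.on quotmod.

Definition qclass (x : W) : quotmod := \pi_quotmod x.

Definition qscale (c : K) (q : quotmod) : quotmod := qclass (c *: repr q).

Lemma qclassK (q : quotmod) : qclass (repr q) = q.
Proof. exact: reprK. Qed.

Lemma qclass_eq (x y : W) : (qclass x = qclass y) <-> x - y \in S.
Proof.
have E : (x - y \in quot_mem) = (qclass x == qclass y) by exact: Quotient.idealrBE.
by split=> [/eqP|H]; [rewrite -E|apply/eqP; rewrite -E].
Qed.

Lemma repr_qclass (x : W) : repr (qclass x) - x \in S.
Proof. by apply/qclass_eq; rewrite qclassK. Qed.

Lemma qclassD (x y : W) : qclass (x + y) = qclass x + qclass y.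
Proof. exact: (Quotient.pi_add quot_mem). Qed.

Lemma qclass0 : qclass 0 = 0.
Proof. by rewrite /qclass; exact: raddf0. Qed.

Lemma qscale_class c (x : W) : qscale c (qclass x) = qclass (c *: x).
Proof. by apply/qclass_eq; rewrite -scalerBr rpredZ // repr_qclass. Qed.

Let scaleqA a b q : qscale a (qscale b q) = qscale (a * b) q.
Proof. by rewrite -[q]qclassK !qscale_class scalerA. Qed.

Let scale1q : left_id 1 qscale.
Proof. by move=> q; rewrite -[q]qclassK qscale_class scale1r. Qed.

Let scaleqDr : right_distributive qscale +%R.
Proof.
move=> a p q; rewrite -[p]qclassK -[q]qclassK.
by rewrite -qclassD !qscale_class scalerDr qclassD.
Qed.

Let scaleqDl q : {morph qscale^~ q : a b / a + b}.
Proof. by move=> a b; rewrite -[q]qclassK !qscale_class scalerDl qclassD. Qed.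

HB.instance Definition _ := GRing.Zmodule_isLmodule.Build K quotmod
  scaleqA scale1q scaleqDr scaleqDl.

End QuotientModule.

Section DirectSum.
Variables (K : pzRingType) (Q : nat -> lmodType K).

Record dsum := DSum {
  dsum_val :> forall d, Q d;
  dsum_fin : exists N, forall d, (N <= d)%N -> dsum_val d = 0 }.

HB.instance Definition _ := gen_eqMixin dsum.
HB.instance Definition _ := gen_choiceMixin dsum.

Lemma dsumP (g h : dsum) : (forall d, g d = h d) -> g = h.
Proof.
case: g h => [g g0] [h h0] /= gh.
have {}gh : g = h by apply: functional_extensionality_dep.
by case: h / gh h0 => h0; rewrite (Prop_irrelevance g0 h0).
Qed.

Lemma dsum_fin0 : exists N, forall d, (N <= d)%N -> (0 : Q d) = 0.
Proof. by exists 0. Qed.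

Lemma dsum_finD (g h : dsum) :
  exists N, forall d, (N <= d)%N -> g d + h d = 0.
Proof.
have [[M gM] [N hN]] := (dsum_fin g, dsum_fin h).
by exists (M + N)%N => d led; rewrite gM ?hN ?addr0 //; lia.
Qed.

Lemma dsum_finN (g : dsum) : exists N, forall d, (N <= d)%N -> - g d = 0.
Proof. by have [N gN] := dsum_fin g; exists N => d /gN ->; rewrite oppr0. Qed.

Lemma dsum_finZ c (g : dsum) : exists N, forall d, (N <= d)%N -> c *: g d = 0.
Proof. by have [N gN] := dsum_fin g; exists N => d /gN ->; rewrite scaler0. Qed.

Definition dsum0 := DSum dsum_fin0.
Definition dsum_add g h := DSum (dsum_finD g h).
Definition dsum_opp g := DSum (dsum_finN g).
Definition dsum_scale c g := DSum (dsum_finZ c g).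

Let dsum_addA : associative dsum_add.
Proof. by move=> *; apply: dsumP => d /=; rewrite addrA. Qed.
Let dsum_addC : commutative dsum_add.
Proof. by move=> *; apply: dsumP => d /=; rewrite addrC. Qed.
Let dsum_add0 : left_id dsum0 dsum_add.
Proof. by move=> *; apply: dsumP => d /=; rewrite add0r. Qed.
Let dsum_addN : left_inverse dsum0 dsum_opp dsum_add.
Proof. by move=> *; apply: dsumP => d /=; rewrite addNr. Qed.

HB.instance Definition _ := GRing.isZmodule.Build dsum
  dsum_addA dsum_addC dsum_add0 dsum_addN.

Let dsum_scaleA a b g : dsum_scale a (dsum_scale b g) = dsum_scale (a * b) g.
Proof. by apply: dsumP => d /=; rewrite scalerA. Qed.
Let dsum_scale1 : left_id 1 dsum_scale.
Proof. by move=> *; apply: dsumP => d /=; rewrite scale1r. Qed.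
Let dsum_scaleDr : right_distributive dsum_scale +%R.
Proof. by move=> *; apply: dsumP => d /=; rewrite scalerDr. Qed.
Let dsum_scaleDl g : {morph dsum_scale^~ g : a b / a + b}.
Proof. by move=> *; apply: dsumP => d /=; rewrite scalerDl. Qed.

HB.instance Definition _ := GRing.Zmodule_isLmodule.Build K dsum
  dsum_scaleA dsum_scale1 dsum_scaleDr dsum_scaleDl.

(* [q] placed in degree [e]. *)
Definition dsum_single_val e (q : Q e) : forall d, Q d := fun d =>
  if @eqP _ e d is ReflectT ed then ecast d (Q d) ed q else 0.

Lemma dsum_single_fin e (q : Q e) :
  exists N, forall d, (N <= d)%N -> dsum_single_val q d = 0.
Proof.
by exists e.+1 => d; rewrite /dsum_single_val; case: eqP => // ed led; exfalso; lia.
Qed.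

Definition dsum_single e (q : Q e) : dsum := DSum (dsum_single_fin q).

End DirectSum.

(** The family [e], restricted to [S], is a basis of [W]; in particular [e] is
    injective on [S] as soon as [K] is nontrivial. *)
Definition is_basis (K : pzRingType) (W : lmodType K) (I : eqType)
    (S : set I) (e : I -> W) : Prop :=
  (forall (l : seq I) (c : I -> K), uniq l -> (forall s, s \in l -> S s) ->
     \sum_(s <- l) c s *: e s = 0 -> forall s, s \in l -> c s = 0) /\
  (forall w : W, exists (l : seq I) (c : I -> K),
     (forall s, s \in l -> S s) /\ w = \sum_(s <- l) c s *: e s).

Section Graded.
Variables (K : pzRingType) (V : lmodType K) (F : nat -> submodClosed V).

(* [F_(d-1)], with [F_(-1) = 0]. *)
Definition fil_pred (d : nat) : submodClosed V :=
  if d is d'.+1 then F d' else lspan (@set0 V).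

Definition fil_lower (d : nat) : {pred submod (F d)} :=
  fun u => submod_val u \in fil_pred d.

Lemma fil_lower_submod d : submod_closed (@fil_lower d).
Proof.
split=> [|a u w]; rewrite /fil_lower unfold_in ?rpred0 //.
by move=> uF wF; rewrite unfold_in /= rpredD // rpredZ.
Qed.

HB.instance Definition _ d :=
  GRing.isSubmodClosed.Build K (submod (F d)) (@fil_lower d) (@fil_lower_submod d).

Definition gr_piece (d : nat) : lmodType K := quotmod (@fil_lower d).

Definition gr : lmodType K := dsum gr_piece.

Definition gr_class (d : nat) (u : V) (uF : u \in F d) : gr :=
  @dsum_single K gr_piece d (qclass _ (Submod uF)).

Variables (g : V -> V) (gF : forall d u, u \in F d -> g u \in F d.+1).

Definition gr_shift_piece (d : nat) (q : gr_piece d) : gr_piece d.+1 :=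
  qclass _ (Submod (gF (valP (repr q)))).

Definition gr_shift_val (w : gr) : forall d, gr_piece d := fun d =>
  if d is d'.+1 then gr_shift_piece (w d') else 0.

Hypothesis g_lin : linear g.

Let gB u w : g (u - w) = g u - g w.
Proof. by rewrite addrC -scaleN1r g_lin scaleN1r addrC. Qed.

Lemma gr_shift_pieceE d (u : submod (F d)) :
  gr_shift_piece (qclass _ u) = qclass _ (Submod (gF (valP u))).
Proof.
have gFd w : w \in @fil_lower d -> g (submod_val w) \in F d.
  rewrite unfold_in; case: d u w => [|d] _ w /=; last exact: gF.
  move=> /asboolP[k [c [a [a0 ->]]]].
  case: k c a a0 => [|k] c a a0; last by case: (a0 ord0).
  by rewrite big_ord0 -(subrr (0 : V)) gB subrr rpred0.
apply/qclass_eq; rewrite unfold_in /= -gB.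
exact: gFd (repr_qclass (@fil_lower d) u).
Qed.

Lemma gr_shift_piece0 d : gr_shift_piece (0 : gr_piece d) = 0.
Proof.
rewrite -(qclass0 (@fil_lower d)) gr_shift_pieceE -(qclass0 (@fil_lower d.+1)).
congr (qclass _ _); apply: submod_inj => /=.
by rewrite -[LHS]/(g 0) -(subrr (0 : V)) gB !subrr.
Qed.

Lemma gr_shift_fin w :
  exists N, forall d, (N <= d)%N -> gr_shift_val w d = 0.
Proof.
by have [N wN] := dsum_fin w; exists N.+1 => -[|d] //= /wN ->; exact: gr_shift_piece0.
Qed.

(* The degree 1 endomorphism of [gr] induced by [g]. *)
Definition gr_shift (w : gr) : gr := @DSum K gr_piece (gr_shift_val w) (gr_shift_fin w).

End Graded.

Section Symplectic.
Variables (n : nat) (K : fieldType).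

Definition symp_form : 'M[K]_(n + n) := block_mx 0 1%:M (- 1%:M) 0.

Definition sp_pred : {pred 'M[K]_(n + n)} :=
  fun x => x^T *m symp_form + symp_form *m x == 0.

Lemma sp_submod : submod_closed sp_pred.
Proof.
split=> [|a x y]; rewrite !unfold_in.
  by rewrite trmx0 mul0mx mulmx0 addr0.
move=> /eqP x0 /eqP y0; rewrite linearP /= mulmxDl mulmxDr -scalemxAl -scalemxAr.
by rewrite addrACA -scalerDr x0 y0 scaler0 addr0.
Qed.

HB.instance Definition _ :=
  GRing.isSubmodClosed.Build K 'M[K]_(n + n) sp_pred sp_submod.

Definition sp : lmodType K := submod sp_pred.

Lemma sp_bracket_subproof (x y : sp) :
  submod_val x *m submod_val y - submod_val y *m submod_val x \in sp_pred.
Proof.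
case: x y => [x xP] [y yP] /=; move: xP yP; rewrite !unfold_in => xP yP.
have Ex : x^T *m symp_form = - (symp_form *m x) by apply/eqP; rewrite -addr_eq0.
have Ey : y^T *m symp_form = - (symp_form *m y) by apply/eqP; rewrite -addr_eq0.
rewrite linearB /= !trmx_mul mulmxBl mulmxBr -!mulmxA Ex Ey !mulmxN !mulmxA Ex Ey.
by rewrite !mulNmx !opprK -!mulmxA addrC subrKA subrr.
Qed.

Definition sp_bracket (x y : sp) : sp := Submod (sp_bracket_subproof x y).

Definition cartan (h : sp) : Prop := is_diag_mx (submod_val h).

(* [cartan] is the diagonal Cartan subalgebra; on diag(t_1, ..., t_n, -t_1, ..., -t_n) this is t_i. *)
Definition eps (i : 'I_n) (h : sp) : K := submod_val h (lshift n i) (lshift n i).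

Definition simple_root (i : 'I_n) (h : sp) : K :=
  if insub i.+1 is Some j then eps i h - eps j h else 2 * eps i h.

Definition fund_weight (i : 'I_n) (h : sp) : K := \sum_(k < n | (k <= i)%N) eps k h.

Definition root_space (chi : sp -> K) (x : sp) : Prop :=
  forall h, cartan h -> sp_bracket h x = chi h *: x.

End Symplectic.

(** [J n] is the ordered set 1 < 2 < ... < n < (n-1)bar < ... < 1bar, identified
    with its positions 0, ..., 2n-2. With indices counted from 0, as in ['I_n],
    the unbarred [i] is at position [i] and [i]bar at position [2n-2-i]; these
    coincide for the last index [i = n-1]. *)
Notation J n := 'I_(n.*2.-1).

Lemma J_abs_subproof n (x : J n) : (minn x (n.*2 - 2 - x) < n)%N.
Proof. have := ltn_ord x; lia. Qed.

(* The index of [x] with its bar, if any, removed. *)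
Definition J_abs n (x : J n) : 'I_n := Ordinal (J_abs_subproof x).

(** The pair [(r, q)] stands for the positive root alpha_(r,q); the conditions
    say that [r] is at most [q] and [q] at most [r]bar in [J n]. *)
Definition pos_root (n : nat) : finType :=
  {p : 'I_n * J n | (p.1 <= p.2 <= n.*2 - 2 - p.1)%N}.

Lemma J_subproof n (i : 'I_n) : (i < n.*2.-1)%N.
Proof. have := ltn_ord i; lia. Qed.

Lemma Jbar_subproof n (i : 'I_n) : (n.*2 - 2 - i < n.*2.-1)%N.
Proof. have := ltn_ord i; lia. Qed.

Lemma alpha_subproof n (i : 'I_n) :
  (i <= Ordinal (J_subproof i) <= n.*2 - 2 - i)%N.
Proof. have := ltn_ord i; rewrite /=; lia. Qed.

Lemma alphabar_subproof n (i : 'I_n) :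
  (i <= Ordinal (Jbar_subproof i) <= n.*2 - 2 - i)%N.
Proof. have := ltn_ord i; rewrite /=; lia. Qed.

Definition alpha n (i : 'I_n) : pos_root n :=
  exist _ (i, Ordinal (J_subproof i)) (alpha_subproof i).
Definition alphabar n (i : 'I_n) : pos_root n :=
  exist _ (i, Ordinal (Jbar_subproof i)) (alphabar_subproof i).

Definition root_wt n (K : fieldType) (a : pos_root n) (h : sp n K) : K :=
  \sum_(x : J n | ((val a).1 <= x <= (val a).2)%N) simple_root (J_abs x) h.

Definition nplus n (K : fieldType) : {pred sp n K} :=
  lspan [set x | exists a, root_space (root_wt a) x].

Definition nminus n (K : fieldType) : {pred sp n K} :=
  lspan [set x | exists a, root_space (fun h => - root_wt a h) x].

HB.instance Definition _ n K := GRing.SubmodClosed.on (@nplus n K).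
HB.instance Definition _ n K := GRing.SubmodClosed.on (@nminus n K).

Section Modules.
Variables (n : nat) (K : fieldType) (V : lmodType K).
Local Notation sp := (sp n K).

Record sp_module := SpModule {
  sp_act :> sp -> V -> V;
  sp_act_linearl : forall u, linear (sp_act^~ u);
  sp_act_linearr : forall x, linear (sp_act x);
  sp_act_bracket : forall x y u,
    sp_act (sp_bracket x y) u = sp_act x (sp_act y u) - sp_act y (sp_act x u) }.

Variable rho : sp_module.

Definition irreducible : Prop :=
  (exists u : V, u != 0) /\
  forall W : submodClosed V, (forall x u, u \in W -> rho x u \in W) ->
    (forall u, u \in W -> u = 0) \/ (forall u, u \in W).

Definition highest_weight_vector (lam : sp -> K) (v : V) : Prop :=
  [/\ v != 0,
      forall x, x \in @nplus n K -> rho x v = 0 &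
      forall h, cartan h -> rho h v = lam h *: v].

Variable v : V.

(* U(n^-)_s v. *)
Definition pbw (s : nat) : {pred V} :=
  lspan [set u | exists xs : seq (submod (@nminus n K)), (size xs <= s)%N /\
                   u = foldr (fun x w => rho (submod_val x) w) v xs].

HB.instance Definition _ s := GRing.SubmodClosed.on (pbw s).

Lemma pbw_act (x : submod (@nminus n K)) s u :
  u \in pbw s -> rho (submod_val x) u \in pbw s.+1.
Proof.
pose g := rho (submod_val x).
have g0 : g 0 = 0.
  by have := sp_act_linearr rho (submod_val x) (-1) 0 0; rewrite !scaleN1r !addNr.
move=> /asboolP[k [c [b [bP ->]]]]; rewrite -/(g _).
have -> : g (\sum_(i < k) c i *: b i) = \sum_(i < k) c i *: g (b i).
  elim/big_rec2: _ => // i y z _ <-.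
  by rewrite /g sp_act_linearr.
apply/asboolP; exists k, c, (fun i => g (b i)); split=> // i.
by have [xs [sz ->]] := bP i; exists (x :: xs).
Qed.

Lemma pbw_generator : v \in pbw 0.
Proof.
apply/asboolP; exists 1%N, (fun=> 1), (fun=> v); split; last first.
  by rewrite big_ord_recl big_ord0 addr0 scale1r.
by move=> i; exists [::].
Qed.

Definition gr_module : lmodType K := gr pbw.

(* The action of [x] in n^-, an element of degree 1 of S(n^-), on [gr_module]. *)
Definition gr_act (x : submod (@nminus n K)) : gr_module -> gr_module :=
  gr_shift (fun s u => @pbw_act x s u) (sp_act_linearr rho (submod_val x)).

Definition gr_generator : gr_module := gr_class pbw_generator.

(* [f^s v] in gr V. The operators [gr_act x] commute, since n^- is closed under
   the bracket, so that the order of the factors is irrelevant. *)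
Definition gr_monomial (f : pos_root n -> submod (@nminus n K))
    (s : {ffun pos_root n -> nat}) : gr_module :=
  foldr (fun a w => iter (s a) (gr_act (f a)) w) gr_generator (enum (pos_root n)).

End Modules.

Definition dominant_weight n (K : fieldType) (m : 'I_n -> nat) (h : sp n K) : K :=
  \sum_(i < n) (m i)%:R * fund_weight i h.

Section Polytope.
Variable n : nat.

Definition dyck_step (a b : pos_root n) : bool :=
  ((val b).1 == (val a).1 :> nat) && ((val b).2 == (val a).2.+1 :> nat) ||
  ((val b).1 == (val a).1.+1 :> nat) && ((val b).2 == (val a).2 :> nat).

(* The sequence (p(0), ..., p(k)) is [a :: p]. *)
Definition dyck_path (a : pos_root n) (p : seq (pos_root n)) : Prop :=
  path dyck_step a p /\
  exists i j : 'I_n, [/\ (i <= j)%N, a = alpha i &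
    last a p = alpha j \/ last a p = alphabar j].

Definition polytope (R : realFieldType) (m : 'I_n -> nat) : set (pos_root n -> R) :=
  [set s | (forall a, 0 <= s a) /\
    forall a p, dyck_path a p -> forall i j : 'I_n, a = alpha i ->
      (last a p = alpha j ->
         \sum_(b <- a :: p) s b <= (\sum_(k < n | (i <= k <= j)%N) m k)%:R) /\
      (last a p = alphabar j ->
         \sum_(b <- a :: p) s b <= (\sum_(k < n | (i <= k)%N) m k)%:R)].

Definition polytope_points (R : realFieldType) (m : 'I_n -> nat) :
    set {ffun pos_root n -> nat} :=
  [set s | polytope m (fun a => (s a)%:R : R)].

End Polytope.

(* Main.v *)
(** Spanning.  Write [n^-] as a quotient of Sym^2 of the vector representation,
    with coordinates [X a b] for unordered pairs [a, b] of weights.  In gr V a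
    power [X a b ^ N] vanishes for [N] large; polarising it by elements of n^+
    gives relations which equate to zero a sum, with positive coefficients, over
    all ways of matching given half-edges into edges.  Along a Dyck path the
    intervals [[b, a]] are nested, and by the rearrangement inequality the nested
    matching is the strict minimum of the sum of the products of positions [a b].
    Hence a monomial outside the polytope is a combination of monomials of the
    same degree with a larger value of this sum.

    Independence.  Let T be a tensor product of exterior algebras having a highest
    weight vector of weight lambda.  In V x T the submodule generated by the pair
    of highest weight vectors is the graph of an isomorphism, by irreducibility of
    V on one side and a contravariant Hermitian form on T on the other.  For a
    fundamental weight the points of the polytope are antichains, and each of them
    has a coordinate of the exterior algebra that is triangular with respect to
    the monomials, by the rearrangement inequality again.  Such functionals
    multiply under tensor products, and the lattice points of the polytope of
    lambda are sums of antichains (remove the minimal elements of the support). *)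

From HB Require Import structures.
Require Import Defs.
From mathcomp Require Import all_boot all_order all_algebra all_fingroup.
From mathcomp Require Import boolp classical_sets reals complex.
From mathcomp Require Import finset zify ring.

Set Implicit Arguments.
Unset Strict Implicit.
Unset Printing Implicit Defensive.

Import GRing.Theory Num.Theory.
Local Open Scope ring_scope.

(** * Dyck paths and chains of roots *)

(** No finite dimension, weight decomposition or vanishing of powers of root vectors is given for V:
    these come from a concrete finite-dimensional model. One comparison of cyclic modules serves
    both halves. It carries the vanishing of powers, checked on exterior powers and propagated
    through tensor products by the binomial argument, over to V, which gives the relations behind
    spanning; and it lets linear relations in V be tested by functionals on the model, which gives
    independence. No dimension or character formula enters.

    A single statistic, [Phi], serves both halves because its extremes are opposite. On a chain the
    given matching minimises [Phi], so every other term of a symmetrised relation has larger [Phi];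
    on an antichain it maximises [Phi], so the chosen coordinate sees, in the critical degree, only
    monomials of smaller [Phi]. Both facts point the same way in [expo_lt]. As degree and [Phi] are
    additive in the exponent, this order passes to tensor products. *)

Section Chains.
Variable n : nat.
Local Open Scope nat_scope.
Implicit Types (c : pos_root n) (C : seq (pos_root n)).

Definition row_of c : nat := (val c).1.
Definition col_of c : nat := (val c).2.

Lemma cellP c : [/\ row_of c < n, row_of c <= col_of c & col_of c <= n.*2 - 2 - row_of c].
Proof. by have /andP[? ?] := valP c; split=> //; rewrite /row_of ltn_ord. Qed.

Lemma cell_inj c c' : row_of c = row_of c' -> col_of c = col_of c' -> c = c'.
Proof.
rewrite /row_of /col_of => er eq; apply: val_inj.
by case: (val c) (val c') er eq => [r q] [r' q'] /= /val_inj-> /val_inj->.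
Qed.

Lemma cell_ex r q : r < n -> r <= q <= n.*2 - 2 - r ->
  exists c, row_of c = r /\ col_of c = q.
Proof.
move=> rn rq; have qn : q < n.*2.-1 by lia.
by exists (exist _ (Ordinal rn, Ordinal qn) rq).
Qed.

Definition root_le c c' := (row_of c <= row_of c') && (col_of c <= col_of c').

Lemma root_le_trans : transitive root_le.
Proof. by rewrite /root_le => c c' c'' /andP[? ?] /andP[? ?]; lia. Qed.

Lemma root_le_refl : reflexive root_le.
Proof. by move=> c; rewrite /root_le !leqnn. Qed.

Lemma root_le_anti c c' : root_le c c' -> root_le c' c -> c = c'.
Proof. by move=> /andP[? ?] /andP[? ?]; apply: cell_inj; lia. Qed.

Definition bound (m : 'I_n -> nat) (i j : nat) : nat :=
  \sum_(k < n | i <= k <= j) m k.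

(* The inequalities of the polytope, with Dyck paths replaced by chains; every
   [j >= n] stands for a path ending at some alphabar. *)
Definition chain_bounded (m : 'I_n -> nat) (s : pos_root n -> nat) : Prop :=
  forall C i j, uniq C -> sorted root_le C ->
    all (fun c => (i <= row_of c) && (col_of c <= j)) C ->
    \sum_(c <- C) s c <= bound m i j.

Lemma bound_sub m i j i' j' : i' <= i -> j <= j' -> bound m i j <= bound m i' j'.
Proof.
move=> ii jj; rewrite /bound big_mkcond [X in _ <= X]big_mkcond /=.
apply: leq_sum => k _; case: ifP => // /andP[? ?].
by rewrite ifT //; lia.
Qed.

Lemma dyck_stepE a b : dyck_step a b =
  (row_of b == row_of a) && (col_of b == (col_of a).+1) || (row_of b == (row_of a).+1) && (col_of b == col_of a).
Proof. by []. Qed.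

Lemma dyck_root_le a b : dyck_step a b -> root_le a b.
Proof. by rewrite dyck_stepE /root_le => /orP[] /andP[/eqP -> /eqP ->]; lia. Qed.

Lemma dyck_uniq a p : path (@dyck_step n) a p -> uniq (a :: p).
Proof.
move=> pp; have : sorted ltn (map (fun c => row_of c + col_of c) (a :: p)).
  rewrite sorted_map; apply: sub_path pp => b c.
  rewrite dyck_stepE => /orP[] /andP[/eqP e1 /eqP e2]; rewrite /= e1 e2; lia.
by move/(sorted_uniq ltn_trans ltnn); apply: map_uniq.
Qed.

(** The column moves before the row: raising the row first could leave the region where the row is
    at most the column. *)
Lemma dyck_connect c c' : root_le c c' ->
  exists p, path (@dyck_step n) c p /\ last c p = c'.
Proof.
move En : (col_of c' - col_of c + (row_of c' - row_of c)) => N.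
elim: N c En => [|N IH] c En cc.
  by exists [::]; split => //; apply: root_le_anti cc _; rewrite /root_le; lia.
have [? ? ?] := cellP c; have [? ? ?] := cellP c'.
have /andP[? ?] := cc.
have [|] := ltnP (col_of c) (col_of c') => lec.
  have [||d [rd cd]] := @cell_ex (row_of c) (col_of c).+1; [by lia|by lia|].
  have [||p [pp lp]] := IH d; [by lia|by rewrite /root_le; lia|].
  exists (d :: p) => /=; split => //.
  by rewrite pp andbT dyck_stepE rd cd !eqxx.
have [||d [rd cd]] := @cell_ex (row_of c).+1 (col_of c); [by lia|by lia|].
have [||p [pp lp]] := IH d; [by lia|by rewrite /root_le; lia|].
exists (d :: p) => /=; split => //.
by rewrite pp andbT dyck_stepE rd cd !eqxx orbT.
Qed.

Lemma dyck_complete c C : path root_le c C ->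
  exists p, [/\ path (@dyck_step n) c p, last c p = last c C &
    {subset C <= c :: p}].
Proof.
elim: C c => [|d C IH] c /=; first by exists [::].
move=> /andP[cd dC]; have [p [pp lp]] := dyck_connect cd.
have [p' [pp' lp' sub]] := IH d dC.
exists (p ++ p'); split.
- by rewrite cat_path pp lp.
- by rewrite last_cat lp.
- move=> x; rewrite inE => /orP[/eqP->|/sub].
    by rewrite -lp -cat_cons mem_cat mem_last.
  rewrite inE -cat_cons mem_cat => /orP[/eqP->|->]; last by rewrite orbT.
  by rewrite -lp mem_last.
Qed.

Lemma sum_sub_uniq (T : eqType) (F : T -> nat) (l l' : seq T) :
  uniq l -> {subset l <= l'} -> \sum_(c <- l) F c <= \sum_(c <- l') F c.
Proof.
elim: l l' => [|x l IH] l' /=; first by rewrite big_nil.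
move=> /andP[xl ul] sub.
have xl' : x \in l' by apply: sub; rewrite mem_head.
rewrite big_cons (perm_big _ (perm_to_rem xl')) big_cons leq_add2l.
apply: IH => // y yl.
have := sub y; rewrite inE yl orbT => /(_ isT).
rewrite (perm_mem (perm_to_rem xl')) inE => /orP[/eqP yx|//].
by rewrite -yx yl in xl.
Qed.

Lemma rw_alpha (i : 'I_n) : row_of (alpha i) = i. Proof. by []. Qed.
Lemma cl_alpha (i : 'I_n) : col_of (alpha i) = i. Proof. by []. Qed.
Lemma rw_alphabar (i : 'I_n) : row_of (alphabar i) = i. Proof. by []. Qed.
Lemma cl_alphabar (i : 'I_n) : col_of (alphabar i) = n.*2 - 2 - i. Proof. by []. Qed.

(** A Dyck path is a chain, and every chain extends to a Dyck path; since [s] is nonnegative, the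
    extension only makes the inequality stronger. *)
Lemma polytopeP (R : realType) (m : 'I_n -> nat) (s : {ffun pos_root n -> nat}) :
  polytope_points R m s <-> chain_bounded m s.
Proof.
split=> [[_ sP]|sP].
- move=> [|c C] i j uC sC aC; first by rewrite big_nil.
  have [d Ed] : exists d, d = last c C by exists (last c C).
  have dC : d \in c :: C by rewrite Ed mem_last.
  have [cn ? ?] := cellP c; have [dn ? ?] := cellP d.
  have /andP[ic cj] := allP aC c (mem_head c C).
  have /andP[id dj] := allP aC d dC.
  have /andP[cl1 cl2] : root_le c d.
    have /allP ap := order_path_min root_le_trans sC.
    by move: dC; rewrite inE => /orP[/eqP->|/ap//]; exact: root_le_refl.
  pose r0 := Ordinal cn.
  have fin x (dx : root_le d x) : exists p,
    [/\ path (@dyck_step n) (alpha r0) p, last (alpha r0) p = x &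
       \sum_(b <- c :: C) s b <= \sum_(b <- alpha r0 :: p) s b].
    have st : path root_le (alpha r0) ((c :: C) ++ [:: x]).
      rewrite cat_path /= -Ed dx (sC : path root_le c C) !andbT.
      by rewrite /root_le rw_alpha cl_alpha /r0 /=; lia.
    have [p [pp lp sub]] := dyck_complete st.
    exists p; split; [by []|by rewrite lp last_cat /=|].
    by apply: sum_sub_uniq => // y yC; apply: sub; rewrite mem_cat yC.
  (* For [j < n] the path can end at [alpha j]. Otherwise it ends at the [alphabar] of the last row,
     where the bound contains all indices from the first row on. *)
  have [jn|nj] := ltnP j n.
    have dx : root_le d (alpha (Ordinal jn)) by rewrite /root_le rw_alpha cl_alpha /=; lia.
    have [p [pp lp le]] := fin _ dx; apply: leq_trans le _.
    have [] := sP (alpha r0) p _ r0 (Ordinal jn) erefl.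
      split=> //; exists r0, (Ordinal jn); split=> //; last by left.
      by rewrite /r0 /=; lia.
    move=> /(_ lp) + _; rewrite -natr_sum ler_nat => H.
    by apply: leq_trans H _; apply: bound_sub.
  pose r1 := Ordinal dn.
  have dx : root_le d (alphabar r1) by rewrite /root_le rw_alphabar cl_alphabar /=; lia.
  have [p [pp lp le]] := fin _ dx; apply: leq_trans le _.
  have [] := sP (alpha r0) p _ r0 r1 erefl.
    by split=> //; exists r0, r1; split=> //; right.
  move=> _ /(_ lp); rewrite -natr_sum ler_nat => H.
  apply: leq_trans H _; rewrite /bound big_mkcond [X in _ <= X]big_mkcond /=.
  apply: leq_sum => k _; case: ifP => // ?.
  by rewrite ifT //; have := ltn_ord k; lia.
split=> [a|a p [pp _] i j aE]; first exact: ler0n.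
have up : uniq (a :: p) by apply: dyck_uniq.
have sp : sorted root_le (a :: p) by apply: sub_path pp => ? ?; apply: dyck_root_le.
have /allP ap := order_path_min root_le_trans sp.
have rP c : c \in a :: p -> i <= row_of c.
  rewrite inE => /orP[/eqP->|/ap/andP[+ _]]; first by rewrite aE rw_alpha.
  by rewrite aE rw_alpha.
split=> lE; rewrite -natr_sum ler_nat.
  apply: sP => //; apply/allP => c cp; rewrite rP //=.
  have : root_le c (last a p).
    have [->|ne] := eqVneq c (last a p); first exact: root_le_refl.
    move: sp cp; rewrite (sorted_pairwise root_le_trans) lastI pairwise_rcons.
    by rewrite mem_rcons inE (negPf ne) /= => /andP[/allP + _]; apply.
  by rewrite lE /root_le cl_alpha => /andP[].
rewrite (eq_bigl (fun k : 'I_n => i <= k <= n)); last first.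
  by move=> k; have := ltn_ord k; lia.
apply: leq_trans (sP (a :: p) i n.*2 up sp _) _.
  by apply/allP => c cp; rewrite rP //=; have [] := cellP c; lia.
rewrite /bound big_mkcond [X in _ <= X]big_mkcond /=.
by apply: leq_sum => k _; case: ifP => // ?; rewrite ifT //; have := ltn_ord k; lia.
Qed.

(** * Peeling off the minimal roots of the support *)

Section Strip.
Variables (m : 'I_n -> nat) (s : pos_root n -> nat) (k : 'I_n).
Hypotheses (sP : chain_bounded m s) (mk : 0 < m k)
  (m0 : forall k' : 'I_n, k' < k -> m k' = 0).

Lemma bound_low i j : i <= k -> k <= j -> bound m i j = bound m 0 j.
Proof.
move=> ik kj; rewrite /bound big_mkcond [RHS]big_mkcond /=; apply: eq_bigr => l _.
case: (ltnP l k) => lk; first by rewrite (m0 lk); do 2!case: ifP.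
by congr (if _ then _ else _); lia.
Qed.

Lemma bound_step j : k <= j -> bound m 0 j = m k + bound m k.+1 j.
Proof.
move=> kj; rewrite -(@bound_low k j) // /bound (bigD1 k) ?leqnn //=.
congr (_ + _); apply: eq_bigl => l.
rewrite -val_eqE /=; lia.
Qed.

Definition live c := (0 < s c) && (row_of c <= k).

(** The minimal live roots form the antichain that will account for one copy of the fundamental
    weight of index [k]. *)
Definition strip c := live c && [forall c', live c' && root_le c' c ==> (c' == c)].

(** Otherwise [c] alone would be a chain bounded by coefficients of index less than [k], which all
    vanish. *)
Lemma strip_cl c : strip c -> k <= col_of c.
Proof.
move=> /andP[/andP[sc rc] _]; rewrite leqNgt; apply/negP => ck.
have := @sP [:: c] 0 (col_of c) isT isT; rewrite /= leqnn big_seq1 => /(_ isT).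
rewrite /bound big1 ?leqn0; first by case: (s c) sc.
by move=> l /= lc; apply: m0; lia.
Qed.

Lemma strip_anti c c' : strip c -> strip c' -> root_le c c' -> c = c'.
Proof.
by move=> /andP[lc _] /andP[_ /forallP/(_ c)]; rewrite lc /= => /implyP h /h/eqP.
Qed.

(* If the chain [C] misses the removed minimal elements, then either it can be
   prolonged by one of them, or its support lies in the rows below [k]. *)
Lemma strip_chain_bounded :
  chain_bounded (fun l => m l - (l == k)) (fun c => s c - strip c).
Proof.
move=> C i j uC sC aC.
have le0 : \sum_(c <- C) (s c - strip c) <= \sum_(c <- C) s c.
  by apply: leq_sum => c _; apply: leq_subr.
have [/andP[ik kj]|nij] := boolP (i <= k <= j); last first.
  apply: leq_trans le0 _; apply: leq_trans (sP uC sC aC) _.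
  rewrite /bound; apply: leq_sum => l ij; case: eqP => [lk|_]; last by lia.
  by rewrite -lk ij in nij.
have E : bound (fun l => m l - (l == k)) i j = (bound m i j).-1.
  rewrite /bound (bigD1 k) ?ik //= [in RHS](bigD1 k) ?ik //= eqxx.
  rewrite (eq_bigr m) => [|l /andP[_ /negPf ->]]; last by lia.
  by lia.
have [/hasP[c cC sc]|/hasPn ns] := boolP (has strip C).
  have sc0 : 0 < s c by case/andP: sc => /andP[].
  suff : \sum_(c <- C) (s c - strip c) < \sum_(c <- C) s c.
    by rewrite E; have := sP uC sC aC; lia.
  rewrite (big_rem c) //= [X in _ < X](big_rem c) //= sc.
  rewrite -addSn; apply: leq_add; first by rewrite /=; lia.
  by apply: leq_sum => ? _; apply: leq_subr.
rewrite E; apply: leq_trans le0 _.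
suff : \sum_(c <- C) s c < bound m i j by lia.
pose C1 := [seq c <- C | 0 < s c].
have -> : \sum_(c <- C) s c = \sum_(c <- C1) s c.
  rewrite big_filter [RHS]big_mkcond; apply: eq_bigr => c _.
  by case: (s c).
have uC1 : uniq C1 by apply: filter_uniq.
have sC1 : sorted root_le C1 by apply: sorted_filter => //; apply: root_le_trans.
have aC1 : all (fun c => (i <= row_of c) && (col_of c <= j)) C1.
  by apply/allP => c; rewrite mem_filter => /andP[_ /(allP aC)].
have pC1 c : c \in C1 -> 0 < s c by rewrite mem_filter => /andP[].
have nC1 c : c \in C1 -> ~~ strip c by rewrite mem_filter => /andP[_ /ns].
rewrite bound_low //.
case: (boolP (has (fun c => row_of c <= k) C1)) => [/hasP[c0 c0C rc0]|/hasPn nk].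
  case: C1 c0C uC1 sC1 aC1 pC1 nC1 => // c C2 c0C uC1 sC1 aC1 pC1 nC1.
  have ap := allP (order_path_min root_le_trans sC1).
  have rc : row_of c <= k.
    by move: c0C; rewrite inE => /orP[/eqP<-//|/ap/andP[]]; lia.
  have lc : live c by rewrite /live rc pC1 ?mem_head.
  (* A live root that is not minimal has a live [d] below it. Prolonging the chain by [d] adds
     [s d > 0] to the sum and leaves the bound unchanged, because [m] vanishes before [k]. *)
  have /forallPn[d] : ~~ [forall c', live c' && root_le c' c ==> (c' == c)].
    by have := nC1 c (mem_head _ _); rewrite /strip lc.
  rewrite negb_imply => /andP[/andP[ld dc] ndc].
  have : \sum_(x <- d :: c :: C2) s x <= bound m 0 j.
    apply: sP.
    - rewrite cons_uniq uC1 andbT inE (negPf ndc) /=.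
      apply/negP => /ap cd; case/negP: ndc; apply/eqP; exact: root_le_anti.
    - by rewrite /= dc.
    - apply/allP => x; rewrite inE => /orP[/eqP->|/(allP aC1)/andP[]]; last by lia.
      by have /andP[_] := allP aC1 c (mem_head _ _); case/andP: dc; lia.
  by rewrite big_cons; case/andP: ld; lia.
rewrite bound_step //.
have : \sum_(c <- C1) s c <= bound m k.+1 j; last by lia.
apply: sP => //; apply/allP => c cC1; rewrite ltnNge nk //=.
by have /andP[] := allP aC1 c cC1.
Qed.

End Strip.
End Chains.

(** * The rearrangement inequality *)

Section Rearrangement.
Local Open Scope nat_scope.
Implicit Types (L : seq (nat * nat)) (p : nat * nat).

Definition above L x y := count (fun p => (x <= p.1) && (y <= p.2)) L.

(** Each quadrant count is at most the number of first entries from [x] on and at most the number of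
    second entries from [y] on. These depend only on the marginals, and a co-monotone list attains
    one of them. *)
Lemma above_le L L' x y :
  perm_eq (map fst L) (map fst L') -> perm_eq (map snd L) (map snd L') ->
  {in L &, forall p p', ~~ ((p.1 < p'.1) && (p'.2 < p.2))} ->
  above L' x y <= above L x y.
Proof.
move=> p1 p2 ch.
have c1 : count (fun p => x <= p.1) L' = count (fun p => x <= p.1) L.
  by have := seq.permP p1 (fun z => x <= z); rewrite !count_map => /esym.
have c2 : count (fun p => y <= p.2) L' = count (fun p => y <= p.2) L.
  by have := seq.permP p2 (fun z => y <= z); rewrite !count_map => /esym.
have [/hasP[p pL /andP[xp py]]|/hasPn h] :=
    boolP (has (fun p => (x <= p.1) && (p.2 < y)) L).
  apply: leq_trans (sub_count (a2 := fun p => y <= p.2) _ _) _.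
    by move=> z /andP[].
  rewrite c2 /above eq_leq //; apply: eq_in_count => q qL /=.
  by have := ch q p qL pL; lia.
apply: leq_trans (sub_count (a2 := fun p => x <= p.1) _ _) _.
  by move=> z /andP[].
rewrite c1 /above eq_leq //; apply: eq_in_count => q qL /=.
by have := h q qL; lia.
Qed.

Lemma perm_sum (l l' : seq nat) : perm_eq l l' -> \sum_(x <- l) x = \sum_(x <- l') x.
Proof. exact: perm_big. Qed.

(** A pair dominates exactly [p.1.+1 * p.2.+1] lattice points, so sums of products become sums of
    quadrant counts, which compare term by term. *)
Lemma sum_above L N : all (fun p => (p.1 < N) && (p.2 < N)) L ->
  \sum_(x < N) \sum_(y < N) above L x y = \sum_(p <- L) p.1.+1 * p.2.+1.
Proof.
elim: L => [_|p L IH /= /andP[/andP[p1 p2] aL]].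
  by rewrite big_nil big1 // => x _; rewrite big1.
rewrite big_cons -(IH aL).
rewrite (eq_bigr (fun x : 'I_N => \sum_(y < N) ((x <= p.1) && (y <= p.2)) +
   \sum_(y < N) above L x y)); last by move=> x _; rewrite -big_split.
rewrite big_split /=; congr (_ + _).
have lt a : a < N -> \sum_(x < N) (x <= a) = a.+1.
  have -> M : \sum_(x < M) (x <= a) = minn M a.+1.
    elim: M => [|M IHM]; first by rewrite big_ord0 min0n.
    by rewrite big_ord_recr /= IHM; lia.
  by lia.
rewrite -(lt _ p1) -(lt _ p2) big_distrl; apply: eq_bigr => x _ /=.
by rewrite big_distrr; apply: eq_bigr => y _; case: (_ <= _); case: (_ <= _).
Qed.

(** Inclusion-exclusion over four neighbouring quadrants recovers the multiplicity of a point. *)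
Lemma perm_of_above L L' : (forall x y, above L x y = above L' x y) -> perm_eq L L'.
Proof.
move=> E; apply/allP => -[a b] _ /=.
have key (a' b' : nat) (l : seq (nat * nat)) :
    count_mem (a', b') l + above l a'.+1 b' + above l a' b'.+1 =
    above l a' b' + above l a'.+1 b'.+1.
  rewrite /above; elim: l => [//|[c d] l IH] /=.
  have -> : ((c, d) == (a', b')) = (c == a') && (d == b') by [].
  by move: IH; case: (ltngtP a' c); case: (ltngtP b' d) => /= _ _; lia.
by apply/eqP; have := key a b L; have := key a b L'; rewrite !E => <- /addIn/addIn.
Qed.

Lemma rearrangement L L' :
  perm_eq (map fst L) (map fst L') -> perm_eq (map snd L) (map snd L') ->
  {in L &, forall p p', ~~ ((p.1 < p'.1) && (p'.2 < p.2))} ->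
  \sum_(p <- L') p.1 * p.2 <= \sum_(p <- L) p.1 * p.2
  ?= iff perm_eq L L'.
Proof.
move=> p1 p2 ch.
have S1 : \sum_(p <- L) p.1 = \sum_(p <- L') p.1.
  by have := perm_sum p1; rewrite !big_map.
have S2 : \sum_(p <- L) p.2 = \sum_(p <- L') p.2.
  by have := perm_sum p2; rewrite !big_map.
have S0 : size L = size L' by have := perm_size p1; rewrite !size_map.
(* Shifting both factors by one changes the sum by quantities that depend on the marginals only. *)
have ex l : \sum_(p <- l) p.1.+1 * p.2.+1 =
    \sum_(p <- l) p.1 * p.2 + \sum_(p <- l) p.1 + \sum_(p <- l) p.2 + size l.
  by elim: l => [|p l IH]; rewrite ?big_nil ?big_cons //= IH; lia.
pose N := (\sum_(p <- L ++ L') (p.1 + p.2)).+1.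
have aN : all (fun p => (p.1 < N) && (p.2 < N)) (L ++ L').
  apply/allP => p pL; rewrite /N (big_rem p) //=; lia.
have := aN; rewrite all_cat => /andP[aL aL'].
have le : forall x y, above L' x y <= above L x y by move=> x y; apply: above_le.
have E1 := sum_above aL; have E2 := sum_above aL'.
rewrite !ex in E1 E2.
have leS : \sum_(x < N) \sum_(y < N) above L' x y <=
    \sum_(x < N) \sum_(y < N) above L x y.
  by apply: leq_sum => x _; apply: leq_sum => y _.
split; first by lia.
apply/eqP/idP => [E|pL]; last by rewrite (perm_big _ pL).
apply: perm_of_above => x y.
have far l : all (fun p => (p.1 < N) && (p.2 < N)) l -> ~~ ((x < N) && (y < N)) ->
    above l x y = 0.
  move=> /allP al nxy; apply/eqP; rewrite -leqn0 leqNgt -has_count.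
  by apply/hasPn => p /al; lia.
case: (boolP ((x < N) && (y < N))) => [/andP[xN yN]|nxy]; last by rewrite !far.
apply/eqP; rewrite eqn_leq le andbT leqNgt; apply/negP => lt.
have : \sum_(x < N) \sum_(y < N) above L' x y <
    \sum_(x < N) \sum_(y < N) above L x y; last by lia.
rewrite (bigD1 (Ordinal xN)) //= [X in _ < X](bigD1 (Ordinal xN)) //=.
rewrite -addSn; apply: leq_add; last first.
  by apply: leq_sum => x' _; apply: leq_sum => y' _.
rewrite (bigD1 (Ordinal yN)) //= [X in _ < X](bigD1 (Ordinal yN)) //=.
rewrite -addSn; apply: leq_add => //.
by apply: leq_sum => y' _.
Qed.

(** The reflection of second entries, y to N - y, exchanges the two monotonicity conditions and
    turns the sum of products into a constant minus it. *)
Lemma rearrangement_anti L L' :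
  perm_eq (map fst L) (map fst L') -> perm_eq (map snd L) (map snd L') ->
  {in L &, forall p p', ~~ ((p.1 < p'.1) && (p.2 < p'.2))} ->
  \sum_(p <- L) p.1 * p.2 <= \sum_(p <- L') p.1 * p.2
  ?= iff perm_eq L L'.
Proof.
move=> p1 p2 ch.
pose N := \sum_(p <- L ++ L') p.2.
have aN : all (fun p => p.2 <= N) (L ++ L').
  by apply/allP => p pL; rewrite /N (big_rem p) //=; lia.
have := aN; rewrite all_cat => /andP[aL aL'].
pose f p := (p.1, N - p.2).
have fK l : all (fun p => p.2 <= N) l -> map f (map f l) = l.
  move=> /allP al; rewrite -map_comp -[RHS]map_id; apply/eq_in_map => -[a b] /al /= bN.
  by rewrite /f /= subKn.
have S1 : \sum_(p <- L) p.1 = \sum_(p <- L') p.1.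
  by have := perm_sum p1; rewrite !big_map.
have ex l : all (fun p => p.2 <= N) l ->
    \sum_(p <- map f l) p.1 * p.2 + \sum_(p <- l) p.1 * p.2 = N * \sum_(p <- l) p.1.
  rewrite big_map; elim: l => [|p l IH]; rewrite ?big_nil ?big_cons ?muln0 //=.
  move=> /andP[pN /IH]; rewrite mulnDr => <-; rewrite mulnBr.
  have : p.1 * p.2 <= p.1 * N by rewrite leq_mul2l pN orbT.
  rewrite (mulnC N) -[\sum_(j <- l) j.1 * (N - j.2)]/(\sum_(j <- l) (f j).1 * (f j).2); lia.
have [|||le eE] := @rearrangement (map f L) (map f L').
- by rewrite -!map_comp.
- have E l : map snd (map f l) = map (fun x => N - x) (map snd l).
    by rewrite -!map_comp.
  by rewrite !E; apply: perm_map.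
- move=> _ _ /mapP[p pL ->] /mapP[p' pL' ->] /=.
  by have := ch p p' pL pL'; have /= := allP aL p pL; have /= := allP aL p' pL'; lia.
have E1 := ex _ aL; have E2 := ex _ aL'; rewrite -S1 in E2.
split; first by lia.
rewrite (_ : perm_eq L L' = perm_eq (map f L) (map f L')).
  by rewrite -eE; apply/eqP/eqP; lia.
apply/idP/idP => [pL|/(perm_map f)]; first exact: perm_map.
by rewrite !fK.
Qed.

End Rearrangement.

(** * A spanning set of the symplectic Lie algebra *)

Section Indices.
Variable n : nat.
Local Notation idx := 'I_(n + n).
Implicit Types (a b : idx).

(* [lshift i] carries the weight eps_i and [rshift i] the weight -eps_i; [pos] is
   the position in the order eps_1 > ... > eps_n > -eps_n > ... > -eps_1. *)
Definition pos a : nat :=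
  match split a with inl i => i | inr i => n.*2.-1 - i end.

Definition bar a : idx :=
  match split a with inl i => rshift n i | inr i => lshift n i end.

Lemma split_l (i : 'I_n) : split (lshift n i) = inl i.
Proof. by rewrite -[lshift _ _]/(unsplit (inl i)) unsplitK. Qed.

Lemma split_r (i : 'I_n) : split (rshift n i) = inr i.
Proof. by rewrite -[rshift _ _]/(unsplit (inr i)) unsplitK. Qed.

Lemma pos_l (i : 'I_n) : pos (lshift n i) = i.
Proof. by rewrite /pos split_l. Qed.

Lemma pos_r (i : 'I_n) : pos (rshift n i) = (n.*2.-1 - i)%N.
Proof. by rewrite /pos split_r. Qed.

Lemma bar_l (i : 'I_n) : bar (lshift n i) = rshift n i.
Proof. by rewrite /bar split_l. Qed.

Lemma bar_r (i : 'I_n) : bar (rshift n i) = lshift n i.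
Proof. by rewrite /bar split_r. Qed.

Lemma barK : involutive bar.
Proof. by move=> a; case: (split_ordP a) => i ->; rewrite !(bar_l, bar_r). Qed.

Lemma bar_inj : injective bar. Proof. exact: can_inj barK. Qed.

Lemma pos_bar a : pos (bar a) = (n.*2.-1 - pos a)%N.
Proof.
case: (split_ordP a) => i ->; rewrite !(bar_l, bar_r, pos_l, pos_r) //.
by have := ltn_ord i; lia.
Qed.

Lemma pos_lt a : (pos a < n.*2)%N.
Proof.
by case: (split_ordP a) => i ->; rewrite !(pos_l, pos_r); have := ltn_ord i; lia.
Qed.

Lemma pos_inj : injective pos.
Proof.
move=> a b; case: (split_ordP a) => i ->; case: (split_ordP b) => j ->;
  rewrite !(pos_l, pos_r) => E; have := ltn_ord i; have := ltn_ord j => ? ?.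
- by congr lshift; apply: val_inj.
- by exfalso; lia.
- by exfalso; lia.
- by congr rshift; apply: val_inj => /=; lia.
Qed.

Lemma pos_surj p : (p < n.*2)%N -> exists a, pos a = p.
Proof.
move=> pn; case: (ltnP p n) => [lt|ge]; first by exists (lshift n (Ordinal lt)); rewrite pos_l.
have lt : (n.*2.-1 - p < n)%N by lia.
by exists (rshift n (Ordinal lt)); rewrite pos_r /=; lia.
Qed.

Lemma bar_neq a : bar a != a.
Proof. by apply/eqP => /(congr1 pos); rewrite pos_bar; have := pos_lt a; lia. Qed.

(* The root alpha_(r,q) is attached to the unordered pair of these two indices,
   of positions [2n-1-r] and [q+1]. *)
Definition rootA (c : pos_root n) : idx := rshift n (val c).1.
Definition rootB (c : pos_root n) : idx :=
  odflt (rootA c) [pick a | pos a == (col_of c).+1].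

Lemma pos_rootA c : pos (rootA c) = (n.*2.-1 - row_of c)%N.
Proof. by rewrite pos_r. Qed.

Lemma pos_rootB c : pos (rootB c) = (col_of c).+1.
Proof.
rewrite /rootB; case: pickP => [a /eqP //|no]; have [? ? ?] := cellP c.
have [|a pa] := @pos_surj (col_of c).+1; first by lia.
by have := no a; rewrite pa eqxx.
Qed.

Lemma root_lower c : (n.*2 <= pos (rootA c) + pos (rootB c))%N.
Proof. by rewrite pos_rootA pos_rootB; have [? ? ?] := cellP c; lia. Qed.

Lemma rootBA c : (pos (rootB c) <= pos (rootA c))%N.
Proof. by rewrite pos_rootA pos_rootB; have [? ? ?] := cellP c; lia. Qed.

Lemma root_inj c c' : pos (rootA c) = pos (rootA c') ->
  pos (rootB c) = pos (rootB c') -> c = c'.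
Proof.
rewrite !pos_rootA !pos_rootB => E1 E2; have [? ? ?] := cellP c.
by have [? ? ?] := cellP c'; apply: cell_inj; lia.
Qed.

Lemma lower_root a b : (n.*2 <= pos a + pos b)%N ->
  exists c, (a = rootA c /\ b = rootB c) \/ (b = rootA c /\ a = rootB c).
Proof.
wlog le : a b / (pos b <= pos a)%N.
  move=> wl; case: (leqP (pos b) (pos a)) => [/wl|lt ab]; first by [].
  by have [||c [?|?]] := wl b a; [lia|lia|exists c; right|exists c; left].
move=> ab; have := pos_lt a => an.
have [||c [rc cc]] := @cell_ex n (n.*2.-1 - pos a) (pos b).-1; [lia|lia|].
exists c; left; split; apply: pos_inj; rewrite ?pos_rootA ?pos_rootB ?rc ?cc; lia.
Qed.

End Indices.

Section Sp.
Variables (n : nat) (K : numClosedFieldType).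
Local Notation idx := 'I_(n + n).
Local Notation sp := (sp n K).
Implicit Types (a b c d : idx) (u v w : 'cV[K]_(n + n)) (x y : sp).

Local Notation Jm := (symp_form n K).

Definition sg a : K := if split a is inl _ then 1 else -1.

Definition ev a : 'cV[K]_(n + n) := delta_mx a 0.

Lemma sg_bar a : sg (bar a) = - sg a.
Proof.
by case: (split_ordP a) => i ->; rewrite ?(bar_l, bar_r) /sg !(split_l, split_r) ?opprK.
Qed.

Lemma sgK a : sg a * sg a = 1.
Proof. by rewrite /sg; case: split => _; rewrite ?mulrNN mulr1. Qed.

Lemma sg_neq0 a : sg a != 0.
Proof. by apply/eqP => E; have := sgK a; rewrite E mul0r => /eqP; rewrite eq_sym oner_eq0. Qed.

Lemma conj_sg a : (sg a)^* = sg a.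
Proof. by rewrite /sg; case: split => _; rewrite ?rmorphN1 ?rmorph1. Qed.

Lemma JmE a b : Jm a b = (sg a) *+ (b == bar a).
Proof.
rewrite /symp_form; case: (split_ordP a) => i ->; case: (split_ordP b) => j ->;
 rewrite ?(block_mxEul, block_mxEur, block_mxEdl, block_mxEdr) ?bar_l ?bar_r /sg
   ?split_l ?split_r ?mxE ?(eq_lshift, eq_rshift, eq_lrshift, eq_rlshift) //.
  by rewrite eq_sym.
by rewrite eq_sym mulNrn.
Qed.

Lemma Jm_tr : Jm^T = - Jm.
Proof.
apply/matrixP => a b; rewrite mxE [in RHS]mxE !JmE.
have -> : (a == bar b) = (b == bar a).
  by rewrite -(can2_eq (@barK n) (@barK n)) eq_sym.
by case: eqP => [->|]; rewrite ?mulr0n ?oppr0 // sg_bar.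
Qed.

Lemma JmJm : Jm *m Jm = - 1%:M.
Proof.
apply/matrixP => a b; rewrite mxE (bigD1 (bar a)) //= big1 => [|c /negPf nc]; last first.
  by rewrite JmE nc mulr0n mul0r.
by rewrite !JmE eqxx barK sg_bar addr0 !mxE mulr1n mulrnAr mulrN sgK mulNrn eq_sym.
Qed.

Lemma evJ a : (ev a)^T *m Jm = sg a *: (ev (bar a))^T.
Proof.
have evE c : (ev a)^T 0 c = (c == a)%:R by rewrite !mxE andbT.
apply/rowP => b; rewrite mxE (bigD1 a) //= big1 => [|c /negPf nc]; last first.
  by rewrite evE nc mul0r.
by rewrite evE eqxx mul1r addr0 JmE !mxE andbT mulr_natr.
Qed.

Lemma spE x : (submod_val x)^T *m Jm = - (Jm *m submod_val x).
Proof. by apply/eqP; rewrite -addr_eq0; have := valP x; rewrite unfold_in. Qed.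

Lemma sp_inj x y : submod_val x = submod_val y -> x = y.
Proof. exact: submod_inj. Qed.

(** The identification of Sym^2 of the vector representation with sp: the product of u and v acts on
    w as the sum of u times v^T J w and v times u^T J w. *)
Definition xm u v : 'M[K]_(n + n) := (u *m v^T + v *m u^T) *m Jm.

Lemma xm_sp u v : xm u v \in @sp_pred n K.
Proof.
rewrite unfold_in /xm trmx_mul Jm_tr linearD /= !trmx_mul !trmxK -!mulmxA.
by rewrite mulNmx [X in - (_ *m (X *m _))]addrC addNr.
Qed.

Definition xs u v : sp := Submod (xm_sp u v).

Lemma xsC u v : xs u v = xs v u.
Proof. by apply: sp_inj; rewrite /= /xm addrC. Qed.

Lemma xs_lin u v w k : xs (k *: u + v) w = k *: xs u w + xs v w.
Proof.
apply: sp_inj; rewrite /= /xm linearP /= mulmxDr [(_ + v) *m _]mulmxDl -scalemxAl -scalemxAr.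
by rewrite addrACA -scalerDr [LHS]mulmxDl -scalemxAl.
Qed.

Lemma xsZ k u w : xs (k *: u) w = k *: xs u w.
Proof.
have -> : xs (k *: u) w = xs (k *: u + 0) w by rewrite addr0.
rewrite xs_lin; have : xs 0 w = 0 by apply: sp_inj; rewrite /= /xm trmx0 mul0mx mulmx0 addr0 mul0mx.
by move=> ->; rewrite addr0.
Qed.

Lemma xsD u v w : xs (u + v) w = xs u w + xs v w.
Proof. by have := xs_lin u v w 1; rewrite !scale1r. Qed.

(** Equivariance of this identification: the adjoint action is a derivation of symmetric
    products. *)
Lemma bracket_xs x u v : sp_bracket x (xs u v) =
  xs (submod_val x *m u) v + xs u (submod_val x *m v).
Proof.
have Jx : Jm *m submod_val x = - ((submod_val x)^T *m Jm) by rewrite spE opprK.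
apply: sp_inj; rewrite /= /xm -(mulmxA _ Jm) Jx mulmxN opprK !trmx_mul !mulmxA.
rewrite -!mulmxDl; congr (_ *m Jm); rewrite mulmxDr mulmxDl !mulmxA -!addrA.
by congr (_ + _); rewrite [LHS]addrC -addrA addrCA.
Qed.

(** The weight is the sum of those of [a] and [b]. As [pos a + pos b] is 2n-1 exactly when
    [b = bar a], the element raises, is diagonal, or lowers according as this sum is below, equal
    to, or above 2n-1. *)
Definition X a b : sp := xs (ev a) (ev b).

Lemma XC a b : X a b = X b a. Proof. exact: xsC. Qed.

Lemma X_mx a b : submod_val (X a b) =
  sg b *: delta_mx a (bar b) + sg a *: delta_mx b (bar a).
Proof.
rewrite /= /xm mulmxDl -!mulmxA !evJ -!scalemxAr /ev !trmx_delta.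
by rewrite !mul_delta_mx.
Qed.

Lemma X_ev c d a : submod_val (X c d) *m ev a =
  (sg d *+ (a == bar d)) *: ev c + (sg c *+ (a == bar c)) *: ev d.
Proof.
rewrite X_mx mulmxDl -!scalemxAl /ev !mul_delta_mx_cond -!scalerMnr !scalerMnl.
by rewrite (eq_sym (bar d)) (eq_sym (bar c)).
Qed.

(** Membership in sp makes S = -xJ symmetric, and x = SJ. Writing S in symmetrised matrix units
    meets each off-diagonal pair twice and doubles each diagonal unit, whence the factor 1/2. *)
Lemma X_span x : x =
  \sum_a \sum_b (sg b * submod_val x a (bar b) / 2) *: X a b.
Proof.
pose S : 'M_(n + n) := - (submod_val x *m Jm).
have xE : submod_val x = S *m Jm.
  by rewrite /S mulNmx -mulmxA JmJm mulmxN mulmx1 opprK.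
have ST : S^T = S.
  rewrite /S linearN /= trmx_mul Jm_tr mulNmx opprK.
  rewrite -[(submod_val x)^T]mulmx1 -[1%:M]opprK -JmJm mulmxN mulmxA spE.
  by rewrite mulNmx opprK !mulmxA JmJm mulNmx mul1mx mulNmx.
have SE a b : sg b * submod_val x a (bar b) = S a b.
  rewrite mxE mxE (bigD1 (bar b)) //= big1 => [|c nc].
    by rewrite JmE barK eqxx mulr1n sg_bar addr0 mulrN opprK mulrC.
  rewrite JmE; case: eqP => [E|_]; last by rewrite mulr0n mulr0.
  by rewrite E barK eqxx in nc.
under eq_bigr do under eq_bigr do rewrite SE.
apply: sp_inj.
have -> : submod_val (\sum_a \sum_b S a b / 2 *: X a b) =
    \sum_a \sum_b (S a b / 2) *: (delta_mx a b + delta_mx b a) *m Jm.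
  rewrite (big_morph (@submod_val _ _ _) (id1 := 0) (op1 := +%R)) //.
  apply: eq_bigr => a _.
  rewrite (big_morph (@submod_val _ _ _) (id1 := 0) (op1 := +%R)) //.
  apply: eq_bigr => b _; rewrite -scalemxAl.
  by rewrite -[LHS]/(S a b / 2 *: xm (ev a) (ev b)) /xm /ev !trmx_delta !mul_delta_mx.
under eq_bigr do rewrite -mulmx_suml; rewrite -mulmx_suml xE; congr (_ *m _).
have E (A : 'M[K]_(n + n)) : \sum_a \sum_b (A a b / 2) *: delta_mx a b = 2^-1 *: A.
  rewrite [in RHS](matrix_sum_delta A) scaler_sumr; apply: eq_bigr => a _.
  by rewrite scaler_sumr; apply: eq_bigr => b _; rewrite scalerA mulrC.
transitivity (2^-1 *: S + 2^-1 *: S).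
  by rewrite -scalerDr -mulr2n -scaler_nat scalerA mulVf ?scale1r // pnatr_eq0.
have E2 : \sum_a \sum_b (S a b / 2) *: delta_mx b a = 2^-1 *: S.
  rewrite -E exchange_big; apply: eq_bigr => a _; apply: eq_bigr => b _ /=.
  by rewrite -{1}ST mxE.
rewrite -{1}E -E2 -big_split; apply: eq_bigr => a _ /=.
by rewrite -big_split; apply: eq_bigr => b _ /=; rewrite scalerDr.
Qed.

(** * Root spaces *)

Definition wt a x : K := submod_val x a a.

Lemma cartan_ev x a : cartan x -> submod_val x *m ev a = wt a x *: ev a.
Proof.
move=> /is_diag_mxP dx; apply/colP => b; rewrite !mxE (bigD1 a) //= big1 => [|c /negPf nc].
  rewrite !mxE !eqxx addr0 andbT mulr1; case: eqP => [->|/eqP ne]; first by rewrite mulr1.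
  by rewrite dx // mulr0.
by rewrite !mxE nc mulr0.
Qed.

Lemma wt_bar x a : cartan x -> wt (bar a) x = - wt a x.
Proof.
move=> /is_diag_mxP dx; have /matrixP/(_ a (bar a)) := spE x.
rewrite mxE (bigD1 a) //= big1 => [|c nc]; last by rewrite mxE dx // mul0r.
rewrite [RHS]mxE [X in - X]mxE (bigD1 (bar a)) //=.
rewrite big1 => [|c nc]; last by rewrite dx // mulr0.
rewrite mxE !addr0 JmE eqxx mulr1n mulrC -mulrN => /(mulfI (sg_neq0 a)) E.
by rewrite /wt E opprK.
Qed.

Lemma cartan_X h a b : cartan h -> sp_bracket h (X a b) = (wt a h + wt b h) *: X a b.
Proof.
by move=> ch; rewrite bracket_xs !cartan_ev // xsZ [xs _ (_ *: _)]xsC xsZ [xs (ev b) _]xsC -scalerDl.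
Qed.

(* The diagonal matrix [E_(a,a) - E_(bar a, bar a)]. *)
Definition hx a : sp := - sg a *: X a (bar a).

Lemma wt_hx a b : wt b (hx a) = (b == a)%:R - (b == bar a)%:R.
Proof.
rewrite /wt; have -> : submod_val (hx a) = - sg a *: submod_val (X a (bar a)) by [].
rewrite X_mx barK sg_bar !mxE !andbb mulrDr !mulrA mulrNN mulNr !sgK.
by rewrite mul1r mulN1r.
Qed.

Lemma cartan_hx a : cartan (hx a).
Proof.
apply/is_diag_mxP => b c bc.
have -> : submod_val (hx a) = - sg a *: submod_val (X a (bar a)) by [].
rewrite X_mx barK !mxE.
suff z d : (b == d) && (c == d) = false by rewrite !z !mulr0 addr0 mulr0.
by apply/negP => /andP[/eqP bd /eqP cd]; rewrite bd cd eqxx in bc.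
Qed.

(** If [X c d] occurs in [x], the weights of the pairs {c, d} and {a, b} agree on diagonal matrices;
    the two test elements [hx a] and [hx b] already force the pairs to coincide. The bound on
    positions excludes [b = bar a], where the weight is zero. *)
Lemma root_space_X a b x : (n.*2 <= pos a + pos b)%N ->
  root_space (fun h => wt a h + wt b h) x -> exists k, x = k *: X a b.
Proof.
move=> lab rx.
have vbr h c d : cartan h ->
    submod_val (sp_bracket h x) c d = (wt c h - wt d h) * submod_val x c d.
  move=> /is_diag_mxP dh /=; rewrite !mxE (bigD1 c) //= big1 => [|e ne]; last first.
    by rewrite dh 1?eq_sym // mul0r.
  rewrite (bigD1 d) //= big1 => [|e ne]; last by rewrite dh // mulr0.
  by rewrite !addr0 mulrBl [_ * submod_val h d d]mulrC.
have supp c d h : cartan h -> submod_val x c d != 0 -> wt c h - wt d h = wt a h + wt b h.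
  move=> ch nz; have := congr1 (fun y : sp => submod_val y c d) (rx h ch).
  by rewrite vbr // => /eqP; rewrite [X in _ == X]mxE (inj_eq (mulIf nz)) => /eqP.
rewrite (X_span x).
have D (P Q : sp) : (exists k, P = k *: X a b) -> (exists k, Q = k *: X a b) ->
    exists k, P + Q = k *: X a b.
  by move=> [k ->] [l ->]; exists (k + l); rewrite scalerDl.
have Z : exists k, (0 : sp) = k *: X a b by exists 0; rewrite scale0r.
apply: (big_ind (fun P : sp => exists k, P = k *: X a b)) => // c _.
apply: (big_ind (fun P : sp => exists k, P = k *: X a b)) => // d _.
have [z|nz] := eqVneq (submod_val x c (bar d)) 0.
  by exists 0; rewrite z mulr0 mul0r !scale0r.
have {}supp h : cartan h -> wt c h + wt d h = wt a h + wt b h.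
  by move=> ch; rewrite -(supp _ _ _ ch nz) wt_bar // opprK.
suff [[-> ->]|[-> ->]] : (c = a /\ d = b) \/ (c = b /\ d = a).
- by eexists; reflexivity.
- by rewrite XC; eexists; reflexivity.
have nb : b != bar a by apply/eqP => E; move: lab; rewrite E pos_bar; have := pos_lt a; lia.
have na : a != bar b by apply/eqP => E; move: lab; rewrite E pos_bar; have := pos_lt b; lia.
have := supp _ (cartan_hx a); have := supp _ (cartan_hx b).
rewrite !wt_hx !eqxx (negPf na) (negPf nb) ![_ == bar _]eq_sym ?(negPf (bar_neq _)).
have one e : (e == b)%:R - (bar b == e)%:R = 1 :> K -> e = b.
  move=> E; apply/eqP; case: (eqVneq e b) E => //= _ /eqP; rewrite sub0r.
  by rewrite eq_sym -subr_eq0 opprK nat1r pnatr_eq0.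
case: (eqVneq c a) => [->|ca].
  rewrite (eq_sym _ a) (negPf na) !subr0 => /addrI/one -> _; by left.
case: (eqVneq d a) => [->|da].
  rewrite (eq_sym _ a) (negPf na) !subr0 addrC => /addrI/one -> _; by right.
move=> _ /eqP; rewrite !sub0r !subr0 -opprD eq_sym -subr_eq0 opprK -!natrD.
by rewrite pnatr_eq0.
Qed.

(** With [e p] the weight at position [p], the simple root at place [x] of [J n] is [e x - e x.+1]
    on the unbarred half, at the long root and on the barred half alike, so the sum telescopes. *)
Lemma root_wtE (c : pos_root n) (h : sp) : cartan h ->
  root_wt c h = - (wt (rootA c) h + wt (rootB c) h).
Proof.
move=> ch; pose e p := \sum_(a | pos a == p) wt a h.
have eE a : e (pos a) = wt a h.
  by rewrite /e (big_pred1 a) // => b; rewrite (inj_eq (@pos_inj n)).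
have er (i : 'I_n) : wt (rshift n i) h = - eps i h.
  by rewrite -bar_l wt_bar.
have e_lt (i : 'I_n) : e i = eps i h by rewrite -pos_l eE.
have e_ge (i : 'I_n) : e (n.*2.-1 - i)%N = - eps i h by rewrite -pos_r eE er.
have step (x : J n) : simple_root (J_abs x) h = e x - e x.+1.
  have xn := ltn_ord x; rewrite /simple_root /=; case: insubP => [j jn jE|nj] /=.
    case: (ltnP x n.-1) => lx.
      have -> : e x = eps (J_abs x) h by rewrite -e_lt; congr e => /=; lia.
      by congr (_ - _); rewrite -e_lt; congr e; rewrite jE /=; lia.
    have -> : e x = - eps j h by rewrite -e_ge; congr e; rewrite jE /=; lia.
    have -> : e x.+1 = - eps (J_abs x) h by rewrite -e_ge; congr e => /=; lia.
    by rewrite opprK addrC.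
  have xE : x = n.-1 :> nat by move: nj; rewrite -leqNgt; lia.
  have -> : e x = eps (J_abs x) h by rewrite -e_lt; congr e => /=; lia.
  have -> : e x.+1 = - eps (J_abs x) h by rewrite -e_ge; congr e => /=; lia.
  by rewrite opprK mulr_natl mulr2n.
rewrite /root_wt (eq_bigr (fun x : J n => e x - e x.+1)); last by move=> x _; apply: step.
have [rn rq qn] := cellP c.
transitivity (\sum_(row_of c <= t < (col_of c).+1) (e t - e t.+1)).
  rewrite (big_nat_widen _ _ n.*2.-1); last by lia.
  rewrite (big_nat_widenl _ 0%N) // big_mkord; apply: eq_bigl => t.
  by rewrite -/(row_of c) -/(col_of c) /= ltnS andbC.
rewrite (eq_bigr (fun t => - (e t.+1 - e t))) => [|t _]; last by rewrite opprB.
rewrite sumrN telescope_sumr; last by lia.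
congr (- _); rewrite -pos_rootB eE addrC; congr (_ + _).
by rewrite er -e_lt.
Qed.

Lemma root_vector (c : pos_root n) x :
  root_space (fun h => - root_wt c h) x -> exists k, x = k *: X (rootA c) (rootB c).
Proof.
move=> rx; apply: root_space_X; first exact: root_lower.
by move=> h ch; rewrite rx // root_wtE // opprK.
Qed.

Lemma X_nplus a b : (pos a + pos b < n.*2.-1)%N -> X a b \in @nplus n K.
Proof.
move=> ab; have [|c cE] := @lower_root n (bar a) (bar b).
  by rewrite !pos_bar; have := pos_lt a; lia.
apply/asboolP; exists 1%N, (fun=> 1), (fun=> X a b); split; last first.
  by rewrite big_ord_recl big_ord0 addr0 scale1r.
move=> _; exists c => h ch; rewrite cartan_X // root_wtE // opprD.
congr (_ *: _); rewrite -!wt_bar //.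
by case: cE => -[<- <-]; rewrite !barK // addrC.
Qed.

(** Meant for [h = X a (bar a)] with [a = lshift n i], which is minus [hx a]; this is the source of
    the minus signs in the Cartan relations below. *)
Lemma fund_wtE (m : 'I_n -> nat) (i : 'I_n) (h : sp) :
  (forall k, eps k h = - (k == i)%:R) ->
  dominant_weight m h = - (\sum_(k < n | (i <= k)%N) m k)%:R.
Proof.
move=> hE; rewrite /dominant_weight natr_sum -sumrN [RHS]big_mkcond /=.
apply: eq_bigr => k _; rewrite /fund_weight.
case: ifPn => ik.
  rewrite (bigD1 i) //= big1 => [|l /andP[_ /negPf li]]; last by rewrite hE li oppr0.
  by rewrite hE eqxx addr0 mulrN1.
rewrite big1 ?mulr0 // => l lk; rewrite hE; case: eqP => [li|]; last by rewrite oppr0.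
by rewrite -li lk in ik.
Qed.

End Sp.

(** * The PBW filtration of a highest weight module *)

Section LSpan.
Variables (K : pzRingType) (V : lmodType K).

Lemma lspan_gen (A : set V) u : A u -> u \in lspan A.
Proof.
move=> Au; apply/asboolP; exists 1%N, (fun=> 1), (fun=> u); split=> //.
by rewrite big_ord_recl big_ord0 addr0 scale1r.
Qed.

Lemma lspan_map (W : lmodType K) (A : set V) (S : submodClosed W) (g : V -> W) :
  linear g -> (forall u, A u -> g u \in S) -> forall u, u \in lspan A -> g u \in S.
Proof.
move=> gl gA _ /asboolP[k [c [a [aA ->]]]].
have g0 : g 0 = 0 by rewrite -(subrr 0) -scaleN1r addrC gl scaleN1r addNr.
elim/big_rec: _ => [|i y _ gy]; first by rewrite g0 rpred0.
by rewrite gl rpredD // rpredZ // gA.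
Qed.

Lemma lspan_sub (A : set V) (S : submodClosed V) :
  (forall u, A u -> u \in S) -> forall u, u \in lspan A -> u \in S.
Proof. exact: (@lspan_map V A S id). Qed.

End LSpan.

Section Words.
Variables (n : nat) (K : numClosedFieldType) (V : lmodType K).
Local Notation idx := 'I_(n + n).
Local Notation sp := (sp n K).
Variable (rho : sp_module n V).
Implicit Types (x y D : sp) (l : seq sp) (u w : V).

Lemma actD x u w : rho x (u + w) = rho x u + rho x w.
Proof. by have := sp_act_linearr rho x 1 u w; rewrite !scale1r. Qed.

Lemma act0 x : rho x 0 = 0.
Proof. by have := actD x 0 0; rewrite addr0 => /eqP; rewrite addrC -subr_eq subrr => /eqP. Qed.

Lemma actZ x k u : rho x (k *: u) = k *: rho x u.
Proof. by have := sp_act_linearr rho x k u 0; rewrite !addr0 act0 addr0. Qed.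

Lemma actB x u w : rho x (u - w) = rho x u - rho x w.
Proof. by rewrite actD -scaleN1r actZ scaleN1r. Qed.

Lemma act_sum x (I : Type) (r : seq I) (P : pred I) (F : I -> V) :
  rho x (\sum_(i <- r | P i) F i) = \sum_(i <- r | P i) rho x (F i).
Proof. by apply: big_morph; [exact: actD|exact: act0]. Qed.

Lemma actlD x y u : rho (x + y) u = rho x u + rho y u.
Proof. by have := sp_act_linearl rho u 1 x y; rewrite !scale1r. Qed.

Lemma actl0 u : rho 0 u = 0.
Proof. by have := actlD 0 0 u; rewrite addr0 => /eqP; rewrite addrC -subr_eq subrr => /eqP. Qed.

Lemma actlZ x k u : rho (k *: x) u = k *: rho x u.
Proof. by have := sp_act_linearl rho u k x 0; rewrite !addr0 actl0 addr0. Qed.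

Lemma actl_sum u (I : Type) (r : seq I) (P : pred I) (F : I -> sp) :
  rho (\sum_(i <- r | P i) F i) u = \sum_(i <- r | P i) rho (F i) u.
Proof. by apply: (big_morph (fun x => rho x u)); [move=> *; exact: actlD|exact: actl0]. Qed.

Lemma act_swap x y u : rho x (rho y u) = rho y (rho x u) + rho (sp_bracket x y) u.
Proof. by rewrite sp_act_bracket addrC subrK. Qed.

Definition word l u : V := foldr (fun x w => rho x w) u l.

Lemma word_cat l l' u : word (l ++ l') u = word l (word l' u).
Proof. by rewrite /word foldr_cat. Qed.

Lemma word_lin l : linear (word l).
Proof. by elim: l => [//|x l IH] k u w /=; rewrite IH actD actZ. Qed.

Lemma word0 l : word l 0 = 0.
Proof. by elim: l => [//|x l /= ->]; rewrite act0. Qed.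

Lemma wordD l u w : word l (u + w) = word l u + word l w.
Proof. by have := word_lin l 1 u w; rewrite !scale1r. Qed.

Lemma wordZ l k u : word l (k *: u) = k *: word l u.
Proof. by have := word_lin l k u 0; rewrite !addr0 word0 addr0. Qed.

Lemma word_sum l (I : Type) (r : seq I) (P : pred I) (F : I -> V) :
  word l (\sum_(i <- r | P i) F i) = \sum_(i <- r | P i) word l (F i).
Proof. by apply: big_morph; [exact: wordD|exact: word0]. Qed.

Variable v : V.

(* Indices are shifted: this is the step [N - 1] of the PBW filtration. *)
Definition pbw_lt (N : nat) : {pred V} :=
  lspan [set u | exists l, (size l < N)%N /\ u = word l v].

HB.instance Definition _ N := GRing.SubmodClosed.on (pbw_lt N).

Definition stab x := exists k, rho x v = k *: v.

Lemma word_pbw_lt l N : (size l < N)%N -> word l v \in pbw_lt N.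
Proof. by move=> lN; apply: lspan_gen; exists l. Qed.

Lemma pbw_lt_mono N N' u : (N <= N')%N -> u \in pbw_lt N -> u \in pbw_lt N'.
Proof.
by move=> NN; apply: lspan_sub => _ [l [lN ->]]; apply: word_pbw_lt; apply: leq_trans NN.
Qed.

Lemma pbw_lt_word N l u : u \in pbw_lt N -> word l u \in pbw_lt (size l + N).
Proof.
apply: lspan_map; first exact: word_lin.
by move=> _ [l' [lN ->]]; rewrite -word_cat word_pbw_lt // size_cat ltn_add2l.
Qed.

Lemma pbw_lt_act N x u : u \in pbw_lt N -> rho x u \in pbw_lt N.+1.
Proof. exact: (@pbw_lt_word N [:: x]). Qed.

(** Commuting [x] to the right replaces one letter at a time by a bracket and keeps the length. The
    bracket may be any element of sp, which is why [pbw_lt] admits all letters and not only those of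
    n^-. *)
Lemma stab_word x l : stab x -> rho x (word l v) \in pbw_lt (size l).+1.
Proof.
move=> [k xv]; elim: l => [|y l IH] /=.
  by rewrite xv rpredZ // (@word_pbw_lt [::]).
rewrite act_swap; apply: rpredD; first exact: pbw_lt_act.
exact: (@word_pbw_lt (sp_bracket x y :: l) _ (ltnSn _)).
Qed.

Lemma pbw_lt_stab N x u : stab x -> u \in pbw_lt N -> rho x u \in pbw_lt N.
Proof.
move=> xs; apply: lspan_map; first exact: sp_act_linearr.
by move=> _ [l [lN ->]]; apply: pbw_lt_mono lN _; apply: stab_word.
Qed.

(** The right-hand index is the length of the word itself: a word with a stabilising letter lies one
    step lower than expected and vanishes in the graded module. *)
Lemma word_stab l1 l2 x : stab x -> word (l1 ++ x :: l2) v \in pbw_lt (size l1 + size l2).+1.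
Proof. by move=> xs; rewrite word_cat -addnS pbw_lt_word // stab_word. Qed.

Lemma word_perm l l' : perm_eq l l' -> word l v - word l' v \in pbw_lt (size l).
Proof.
elim: l l' => [|x l IH] l' pl.
  by move: pl; rewrite perm_sym => /perm_nilP ->; rewrite subrr rpred0.
have xl' : x \in l' by rewrite -(perm_mem pl) mem_head.
case/splitPr: xl' pl => l1 l2 pl.
have pl' : perm_eq l (l1 ++ l2).
  by move: pl; rewrite perm_sym (perm_catCA l1 [:: x] l2) perm_cons perm_sym.
have -> : word (x :: l) v - word (l1 ++ x :: l2) v =
    rho x (word l v - word (l1 ++ l2) v) +
    (rho x (word (l1 ++ l2) v) - word (l1 ++ x :: l2) v).
  by rewrite /= actB addrA subrK.
apply: rpredD; first by rewrite /= pbw_lt_act ?IH.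
rewrite /= (perm_size pl') size_cat {IH pl pl'}.
elim: l1 => [|y l1 IH] /=; first by rewrite subrr rpred0.
rewrite act_swap addrAC rpredD //; last first.
  by have := @word_pbw_lt (sp_bracket x y :: l1 ++ l2) _ (ltnSn _); rewrite /= size_cat.
by rewrite -actB pbw_lt_act.
Qed.

(** * Polarisation *)

Section Deriv.
Variables (I : eqType) (y : I -> sp).

Definition word_at (s : seq I) k x u := word [seq if j == k then x else y j | j <- s] u.

Lemma word_at_out s k x u : k \notin s -> word_at s k x u = word (map y s) u.
Proof.
move=> ks; congr word; apply/eq_in_map => j js; case: eqP => // jk.
by rewrite -jk js in ks.
Qed.

Lemma word_deriv s D u : uniq s ->
  rho D (word (map y s) u) =
  \sum_(k <- s) word_at s k (sp_bracket D (y k)) u + word (map y s) (rho D u).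
Proof.
elim: s => [|j s IH] /=; first by rewrite big_nil add0r.
move=> /andP[js us]; rewrite act_swap IH // actD big_cons act_sum addrC -!addrA.
congr (_ + _); first by rewrite /word_at /= eqxx -/(word_at _ _ _ _) word_at_out.
congr (_ + _); apply: eq_big_seq => k ks; rewrite /word_at /=.
by case: eqP => // jk; rewrite jk ks in js.
Qed.

Lemma word_at_split s k : uniq s -> k \in s -> exists l1 l2,
  (size l1 + size l2).+1 = size s /\ forall x u, word_at s k x u = word (l1 ++ x :: l2) u.
Proof.
move=> us /splitPr ks; case: ks us => s1 s2 us.
exists (map y s1), (map y s2); split; first by rewrite !size_map size_cat /= addnS.
move=> x u; rewrite /word_at map_cat /= eqxx.
move: us; rewrite uniq_catC /= mem_cat negb_or => /andP[/andP[k2 k1] _].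
by congr (word (_ ++ _ :: _) _); apply/eq_in_map => j js; case: eqP => // jk;
  [rewrite -jk js in k1|rewrite -jk js in k2].
Qed.

Lemma word_at_linear s k u : uniq s -> k \in s -> linear (fun x => word_at s k x u).
Proof.
move=> us ks; have [l1 [l2 [_ E]]] := word_at_split us ks.
by move=> a x x'; rewrite !E !word_cat /= actlD actlZ word_lin.
Qed.

Lemma word_at_stab s k x : uniq s -> k \in s -> stab x -> word_at s k x v \in pbw_lt (size s).
Proof.
by move=> us ks xs; have [l1 [l2 [<- ->]]] := word_at_split us ks; apply: word_stab.
Qed.

End Deriv.

Hypothesis upper0 : forall a b : idx, (pos a + pos b < n.*2.-1)%N -> rho (X K a b) v = 0.
Hypothesis stabX : forall a b : idx, (pos a + pos b <= n.*2.-1)%N -> stab (X K a b).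

Section Polar.
Variable N : nat.
Local Notation H := ('I_N * bool)%type.
Implicit Types (h : H) (z : {ffun H -> idx}) (s : {perm H}).

Definition flip h : H := (h.1, ~~ h.2).

(** A word of N letters is a perfect matching of 2N half-edges labelled by weights of the vector
    representation; (k, b) is the end [b] of the letter [k]. *)
Definition edgeX z k := X K (z (k, false)) (z (k, true)).

Definition monX z := word [seq edgeX z k | k <- enum 'I_N] v.

Definition upd z h (c : idx) : {ffun H -> idx} := [ffun h' => if h' == h then c else z h'].

Lemma bracket_edge (c o a b : idx) : sp_bracket (X K c (bar o)) (X K a b) =
  (sg K (bar o) *+ (a == o)) *: X K c b + (sg K c *+ (a == bar c)) *: X K (bar o) b +
  ((sg K (bar o) *+ (b == o)) *: X K a c + (sg K c *+ (b == bar c)) *: X K a (bar o)).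
Proof.
rewrite bracket_xs !X_ev barK xsD !xsZ; congr (_ + _).
by rewrite xsC xsD !xsZ xsC [xs (ev K (bar o)) _]xsC.
Qed.

(** By [bracket_edge] the operator changes a label [o] into [c], or a label [bar c] into [bar o]. A
    term of the second kind acquires a letter [X (bar o) b] with [pos b <= pos o], which stabilises
    the line of v, so it drops out. The operator itself kills v because [pos c < pos o]. *)
Lemma monX_deriv z c o : (pos c < pos o)%N ->
  (forall h, z h = bar c -> (pos (z (flip h)) <= pos o)%N) ->
  rho (X K c (bar o)) (monX z) -
    sg K (bar o) *: \sum_(h | z h == o) monX (upd z h c) \in pbw_lt N.
Proof.
move=> co comp; have cn := pos_lt o.
rewrite /monX word_deriv ?enum_uniq // upper0; last by rewrite pos_bar; lia.
rewrite word0 addr0 big_enum /= scaler_sumr.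
have -> : \sum_(h | z h == o) sg K (bar o) *: monX (upd z h c) =
    \sum_(k < N) ((sg K (bar o) *+ (z (k, false) == o)) *: monX (upd z (k, false) c) +
     (sg K (bar o) *+ (z (k, true) == o)) *: monX (upd z (k, true) c)).
  rewrite big_mkcond /= (eq_bigr (fun h =>
    (sg K (bar o) *+ (z (h.1, h.2) == o)) *: monX (upd z (h.1, h.2) c))); last first.
    by case=> k b _ /=; case: (_ == _); rewrite ?mulr0n ?scale0r.
  rewrite -(pair_big predT predT (fun k b =>
    (sg K (bar o) *+ (z (k, b) == o)) *: monX (upd z (k, b) c))) /=.
  by apply: eq_bigr => k _; rewrite big_bool addrC.
rewrite -sumrB; apply: rpred_sum => k _.
have uk := enum_uniq 'I_N; have kk : k \in enum 'I_N by rewrite mem_enum.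
pose W x := word_at (edgeX z) (enum 'I_N) k x v.
have W0 x y : W (x + y) = W x + W y.
  by have := word_at_linear (edgeX z) v uk kk 1 x y; rewrite !scale1r.
have WZ a x : W (a *: x) = a *: W x.
  have E : W 0 = 0 by have /eqP := W0 0 0; rewrite addr0 -subr_eq subrr => /eqP.
  by have := word_at_linear (edgeX z) v uk kk a x 0; rewrite -!/(W _) E !addr0.
have Wu b x : edgeX (upd z (k, b) c) k = x -> W x = monX (upd z (k, b) c).
  move=> xE; congr word; apply/eq_map => j /=; case: eqP => [->//|jk].
  by rewrite /edgeX !ffunE !xpair_eqE; case: eqP.
have Ws b : (sg K c *+ (z (k, b) == bar c)) *: W (X K (bar o) (z (k, ~~ b))) \in pbw_lt N.
  case: eqP => [zb|_]; last by rewrite mulr0n scale0r rpred0.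
  have xs : stab (X K (bar o) (z (k, ~~ b))).
    by apply: stabX; rewrite pos_bar; have := comp (k, b) zb; rewrite /flip /=; lia.
  by rewrite rpredZ //; have := word_at_stab (edgeX z) uk kk xs; rewrite size_enum_ord.
rewrite -/(W _) bracket_edge !W0 !WZ.
rewrite (Wu false (X K c (z (k, true)))); last by rewrite /edgeX !ffunE !xpair_eqE !eqxx.
rewrite (Wu true (X K (z (k, false)) c)); last by rewrite /edgeX !ffunE !xpair_eqE !eqxx.
rewrite addrACA [X in X - _]addrC addrK; apply: rpredD; first exact: (Ws false).
by rewrite XC; exact: (Ws true).
Qed.

Variables (cls : H -> bool) (o : bool -> idx) (P : bool -> pred idx) (z : {ffun H -> idx}).

Definition clsG : {set {perm H}} := [set s : {perm H} | [forall h, cls (s h) == cls h]].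

Definition symX z := \sum_(s in clsG) monX [ffun h => z (s h)].

Lemma symX_perm (s : {perm H}) z' : s \in clsG -> symX [ffun h => z' (s h)] = symX z'.
Proof.
rewrite inE => /forallP sG; rewrite /symX [RHS](reindex_inj (mulIg s)) /=.
apply: eq_big => [t|t _].
  by rewrite !inE; apply: eq_forallb => h; rewrite permM (eqP (sG _)).
by congr monX; apply/ffunP => h; rewrite !ffunE permM.
Qed.

Lemma tperm_clsG h h' : cls h = cls h' -> tperm h h' \in clsG.
Proof.
by move=> E; rewrite inE; apply/forallP => g; case: tpermP => [->|->|]; rewrite ?E.
Qed.

(** [P] is the range of labels of a class and [o] its extreme label. [Psep] keeps the extreme label
    of one class out of the other, so that one operator acts on one class; [Pcomp] supplies the side
    condition of [monX_deriv]; [base] is the starting relation, in the applications a vanishing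
    power of one root vector. *)
Hypothesis zP : forall h, P (cls h) (z h).
Hypothesis oP : forall h, P (cls h) (o (cls h)).
Hypothesis Pmax : forall h a, P (cls h) a -> a = o (cls h) \/ (pos a < pos (o (cls h)))%N.
Hypothesis Psep : forall h h0, P (cls h) (o (cls h0)) -> cls h = cls h0.
Hypothesis Pcomp : forall h h0 (a b c : idx),
  P (cls h) a -> P (cls (flip h)) b -> P (cls h0) c -> a = bar c ->
  (pos b <= pos (o (cls h0)))%N.
Hypothesis cls_flip : forall h h', cls h = cls h' -> cls (flip h) = cls (flip h').
Hypothesis base : monX [ffun h => o (cls h)] \in pbw_lt N.

(* Every application of the operator [X c (bar o)] turns one half-edge from its
   extreme value [o] into [c]; the sum over the group makes all choices of the
   half-edge equivalent. *)
Lemma symX_pbw_lt : symX z \in pbw_lt N.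
Proof.
move En : #|[pred h | z h != o (cls h)]| => e; elim: e z En zP => [|e IH] z1 En z1P.
  have z1E : z1 = [ffun h => o (cls h)].
    apply/ffunP => h; rewrite ffunE; apply/eqP; have := card0_eq En h.
    by rewrite inE => /negbFE.
  apply: rpred_sum => s; rewrite inE => /forallP sG.
  rewrite (_ : [ffun h => z1 (s h)] = [ffun h => o (cls h)]) //.
  by apply/ffunP => h; rewrite !ffunE z1E ffunE (eqP (sG h)).
have [h0 h0P] : exists h0, z1 h0 != o (cls h0).
  have /card_gt0P[h0] : (0 < #|[pred h | z1 h != o (cls h)]|)%N by rewrite En.
  by exists h0.
set c := z1 h0; set o0 := o (cls h0).
have co : (pos c < pos o0)%N.
  by have [E|//] := Pmax (z1P h0); rewrite -E eqxx in h0P.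
pose z2 := upd z1 h0 o0.
have z2P h : P (cls h) (z2 h).
  by rewrite ffunE; case: eqP => [->|_] //; apply: oP.
have z2W : symX z2 \in pbw_lt N.
  apply: IH => //; move: En; rewrite (cardD1 h0) inE h0P add1n => -[<-].
  apply: eq_card => h; rewrite !inE ffunE.
  by case: (eqVneq h h0) => [->|_] /=; rewrite ?andbT /o0 ?eqxx.
(* The operator preserves the filtration, while by [D2] it sends [symX z2] to a multiple of
   [symX z1]. The factor is, up to sign, the number [p] of extreme labels, nonzero in characteristic
   0. *)
have D1 : rho (X K c (bar o0)) (symX z2) \in pbw_lt N.
  by apply: pbw_lt_stab z2W; apply: stabX; rewrite pos_bar; have := pos_lt o0; lia.
pose p := #|[pred h | z2 h == o0]|.
have p0 : (0 < p)%N by apply/card_gt0P; exists h0; rewrite inE ffunE eqxx.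
have D2 : rho (X K c (bar o0)) (symX z2) - (sg K (bar o0) * p%:R) *: symX z1 \in pbw_lt N.
  rewrite act_sum.
  have -> : (sg K (bar o0) * p%:R) *: symX z1 = \sum_(s in clsG) sg K (bar o0) *:
      \sum_(h | z2 (s h) == o0) monX (upd [ffun h => z2 (s h)] h c).
    rewrite -scaler_sumr -scalerA scaler_nat; congr (_ *: _).
    transitivity (\sum_(h | z2 h == o0) symX (upd z2 h c)).
      rewrite -[p]/(#|[pred h | z2 h == o0]|) -sumr_const; apply: eq_bigr => h /eqP zh.
      have hh : cls h = cls h0 by apply: Psep; rewrite -/o0 -zh.
      (* Changing the label at [h] instead of [h0] differs by a transposition inside a class, which
         the symmetrisation absorbs. *)
      rewrite -(symX_perm z1 (tperm_clsG hh)); congr symX.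
      apply/ffunP => g; rewrite !ffunE; case: tpermP => [->|->|].
      - by rewrite eqxx.
      - case: (eqVneq h0 h) => [<-//|nh]; rewrite eqxx.
        by move: zh; rewrite ffunE eq_sym (negPf nh) => ->.
      - by move=> /eqP/negPf -> /eqP/negPf ->.
    rewrite exchange_big /=; apply: eq_bigr => s _.
    rewrite (reindex_inj (@perm_inj _ s)) /=; apply: eq_bigr => h _; congr monX.
    by apply/ffunP => g; rewrite !ffunE (inj_eq (@perm_inj _ s)).
  rewrite -sumrB; apply: rpred_sum => s; rewrite inE => /forallP sG.
  have sf h : cls (s (flip h)) = cls (flip (s h)).
    by rewrite (eqP (sG _)); apply: cls_flip; rewrite (eqP (sG h)).
  rewrite (eq_bigl (fun h => [ffun h => z2 (s h)] h == o0)); last first.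
    by move=> h; rewrite ffunE.
  have zs g : [ffun h => z2 (s h)] g = z2 (s g) by rewrite ffunE.
  apply: monX_deriv => // h; rewrite !zs => zc.
  by apply: (Pcomp (z2P (s h)) _ (z1P h0) zc); rewrite -sf; apply: z2P.
have : (sg K (bar o0) * p%:R) *: symX z1 \in pbw_lt N.
  by rewrite -[X in X \in _](subKr (rho (X K c (bar o0)) (symX z2))) rpredB.
rewrite -[X in _ -> X \in _](scalerK (a := sg K (bar o0) * p%:R)); last first.
  by rewrite mulf_neq0 ?sg_neq0 // pnatr_eq0 -lt0n.
by move=> ?; rewrite rpredZ.
Qed.

End Polar.
End Words.

(** * Multi-exponents *)

Section Exponents.
Variable n : nat.
Local Notation root := (pos_root n).
Local Notation expo := {ffun pos_root n -> nat}.
Implicit Types (c : root) (l : seq root) (s t : expo).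
Local Open Scope nat_scope.

Definition expo_of l : expo := [ffun c => count_mem c l].

Definition word_of s : seq root := flatten [seq nseq (s c) c | c <- enum {: root}].

Definition pAB c := pos (rootA c) * pos (rootB c).

Definition edeg s := \sum_c s c.

Definition Phi s := \sum_c s c * pAB c.

(* On exponents of equal weight, the smaller ones are those of larger [Phi]. *)
Definition expo_lt t s := (edeg t < edeg s) || (edeg t == edeg s) && (Phi s < Phi t).

Lemma word_ofK s : expo_of (word_of s) = s.
Proof.
apply/ffunP => c; rewrite ffunE count_flatten -map_comp sumnE big_map big_enum /=.
rewrite (bigD1 c) //= count_nseq /= eqxx mul1n big1 ?addn0 // => d /negPf dc.
by rewrite count_nseq /= dc.
Qed.

Lemma sum_expo_of l (F : root -> nat) : \sum_(c <- l) F c = \sum_c expo_of l c * F c.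
Proof.
elim: l => [|d l IH].
  by rewrite big_nil big1 // => c _; rewrite ffunE.
rewrite big_cons IH; under [RHS]eq_bigr do rewrite ffunE /= mulnDl.
rewrite big_split /=; congr (_ + _); last by apply: eq_bigr => c _; rewrite ffunE.
by rewrite (bigD1 d) //= eqxx mul1n big1 ?addn0 // => c /negPf; rewrite eq_sym => ->.
Qed.

Lemma edeg_expo_of l : edeg (expo_of l) = size l.
Proof. by rewrite -sum1_size sum_expo_of; apply: eq_bigr => c _; rewrite muln1. Qed.

Lemma Phi_expo_of l : Phi (expo_of l) = \sum_(c <- l) pAB c.
Proof. by rewrite sum_expo_of. Qed.

Lemma size_word_of s : size (word_of s) = edeg s.
Proof. by rewrite -edeg_expo_of word_ofK. Qed.

Lemma perm_expo_of l l' : perm_eq l l' <-> expo_of l = expo_of l'.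
Proof.
split=> [/seq.permP pl|E]; first by apply/ffunP => c; rewrite !ffunE pl.
by apply/allP => c _ /=; have := congr1 (fun f : expo => f c) E; rewrite !ffunE => ->.
Qed.

Lemma perm_word_of l : perm_eq l (word_of (expo_of l)).
Proof. by apply/perm_expo_of; rewrite word_ofK. Qed.

Lemma Phi_le s : Phi s <= edeg s * (n.*2 * n.*2).
Proof.
rewrite /Phi /edeg big_distrl; apply: leq_sum => c _ /=; rewrite leq_mul2l; apply/orP; right.
by rewrite leq_mul // ltnW // pos_lt.
Qed.

End Exponents.

(** * Edges and half-edges *)

Section Edges.
Variables (n N : nat).
Local Notation idx := 'I_(n + n).
Local Notation root := (pos_root n).
Local Notation H := ('I_N * bool)%type.
Local Open Scope nat_scope.
Implicit Types (z : {ffun H -> idx}) (ck : 'I_N -> root).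

Definition edge_of (a b : idx) (c : root) : Prop :=
  (a = rootA c /\ b = rootB c) \/ (b = rootA c /\ a = rootB c).

(** Each edge is listed in both orientations, so that any permutation of half-edges preserves both
    marginals, as the rearrangement inequality demands. *)
Definition pairs z : seq (nat * nat) :=
  [seq (pos (z h), pos (z (flip h))) | h <- enum {: H}].

Lemma sum_pairs z (F : nat * nat -> nat) : \sum_(p <- pairs z) F p =
  \sum_(k < N) (F (pos (z (k, false)), pos (z (k, true))) +
                F (pos (z (k, true)), pos (z (k, false)))).
Proof.
rewrite big_map big_enum /= (eq_bigr (fun h : H =>
  F (pos (z (h.1, h.2)), pos (z (h.1, ~~ h.2))))); last by case.
rewrite -(pair_big predT predT (fun k b => F (pos (z (k, b)), pos (z (k, ~~ b))))) /=.
by apply: eq_bigr => k _; rewrite big_bool addnC.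
Qed.

Lemma pairs_perm z (s : {perm H}) :
  perm_eq (map fst (pairs z)) (map fst (pairs [ffun h => z (s h)])) /\
  perm_eq (map snd (pairs z)) (map snd (pairs [ffun h => z (s h)])).
Proof.
have pp (f g : H -> H) : injective f -> injective g ->
    perm_eq [seq pos (z (f h)) | h <- enum {: H}] [seq pos (z (g h)) | h <- enum {: H}].
  move=> fi gi.
  have E (f' : H -> H) : injective f' -> perm_eq (map f' (enum {: H})) (enum {: H}).
    move=> f'i; apply: uniq_perm; rewrite ?(map_inj_uniq f'i) ?enum_uniq // => h.
    rewrite [RHS]mem_enum; apply/mapP.
    by have [g' _ K] := injF_bij f'i; exists (g' h); rewrite ?mem_enum ?K.
  have E2 (f' : H -> H) : [seq pos (z (f' h)) | h <- enum {: H}] =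
      [seq pos (z h) | h <- map f' (enum {: H})].
    exact: (map_comp (fun h => pos (z h)) f').
  rewrite (E2 f) (E2 g).
  by apply: perm_map; apply: perm_trans (E _ fi) _; rewrite perm_sym E.
have flip_inj : injective (@flip N) by move=> [k b] [k' b'] [-> /negb_inj ->].
have F1 z' : map fst (pairs z') = [seq pos (z' h) | h <- enum {: H}].
  by rewrite -map_comp.
have F2 z' : map snd (pairs z') = [seq pos (z' (flip h)) | h <- enum {: H}].
  by rewrite -map_comp.
have G (f : H -> H) : [seq pos ([ffun h => z (s h)] (f h)) | h <- enum {: H}] =
    [seq pos (z (s (f h))) | h <- enum {: H}] by apply: eq_map => h; rewrite ffunE.
rewrite !F1 !F2 (G id) (G (@flip N)); split; first exact: (pp id s _ (@perm_inj _ s)).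
exact: (pp (@flip N) (s \o @flip N) flip_inj (inj_comp (@perm_inj _ s) flip_inj)).
Qed.

Variables (z : {ffun H -> idx}) (ck : 'I_N -> root).
Hypothesis zck : forall k, edge_of (z (k, false)) (z (k, true)) (ck k).

Lemma sum_edges : \sum_(p <- pairs z) p.1 * p.2 =
  2 * \sum_(c <- map ck (enum 'I_N)) pAB c.
Proof.
rewrite sum_pairs big_map big_enum big_distrr; apply: eq_bigr => k _ /=.
by rewrite /pAB; case: (zck k) => -[-> ->]; lia.
Qed.

(** For a long root the two ends coincide and one edge is counted in both orientations; for other
    roots exactly one orientation matches. *)
Lemma count_edges (c : root) :
  count_mem (pos (rootA c), pos (rootB c)) (pairs z) =
  (rootA c == rootB c).+1 * count_mem c (map ck (enum 'I_N)).
Proof.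
rewrite -!sum1_count [LHS]big_mkcond [X in _ * X]big_mkcond /=.
rewrite sum_pairs big_map big_enum big_distrr; apply: eq_bigr => k _ /=.
have xE (a b : idx) : ((pos a, pos b) == (pos (rootA c), pos (rootB c))) =
    (a == rootA c) && (b == rootB c).
  by rewrite xpair_eqE !(inj_eq (@pos_inj n)).
have E : ((rootA (ck k) == rootA c) && (rootB (ck k) == rootB c)) +
    ((rootB (ck k) == rootA c) && (rootA (ck k) == rootB c)) =
    (rootA c == rootB c).+1 * (ck k == c).
  case: (eqVneq (ck k) c) => [->|ne].
    by rewrite !eqxx [rootB c == _]eq_sym; case: (_ == _).
  have n1 : (rootA (ck k) == rootA c) && (rootB (ck k) == rootB c) = false.
    apply/negP => /andP[/eqP E1 /eqP E2]; case/eqP: ne.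
    by apply: root_inj; rewrite ?E1 ?E2.
  rewrite n1 muln0 add0n; apply/eqP; rewrite eqb0; apply/negP => /andP[/eqP E1 /eqP E2].
  have := rootBA c; have := rootBA (ck k); rewrite E1 E2 => l1 l2.
  have E : rootA c = rootB c by apply: pos_inj; lia.
  by move: n1; rewrite E1 E2 E eqxx.
have ifE (b : bool) : (if b then 1 else 0) = b :> nat by case: b.
by rewrite !ifE -E !xE; case: (zck k) => -[-> ->]; rewrite // addnC.
Qed.

End Edges.

(** * The straightening law *)

Section Straightening.
Variables (n : nat) (K : numClosedFieldType) (V : lmodType K).
Local Notation idx := 'I_(n + n).
Local Notation sp := (sp n K).
Local Notation root := (pos_root n).
Local Notation expo := {ffun pos_root n -> nat}.
Variables (rho : sp_module n V) (v : V) (m : 'I_n -> nat).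
Implicit Types (l : seq root) (s t : expo).

Local Notation pbw_lt := (pbw_lt rho v).

Definition Xr (c : root) : sp := X K (rootA c) (rootB c).

Definition rword l u := word rho (map Xr l) u.

Lemma rword_cat l l' u : rword (l ++ l') u = rword l (rword l' u).
Proof. by rewrite /rword map_cat word_cat. Qed.

Hypothesis upper0 : forall a b : idx, (pos a + pos b < n.*2.-1)%N -> rho (X K a b) v = 0.
Hypothesis stabX : forall a b : idx, (pos a + pos b <= n.*2.-1)%N -> stab rho v (X K a b).

Definition root_span N : {pred V} :=
  lspan [set u | exists l, (size l < N)%N /\ u = rword l v].

HB.instance Definition _ N := GRing.SubmodClosed.on (root_span N).

Lemma root_span_mono N N' u : (N <= N')%N -> u \in root_span N -> u \in root_span N'.
Proof.
move=> NN; apply: lspan_sub => _ [l [lN ->]]; apply: lspan_gen.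
by exists l; split=> //; apply: leq_trans NN.
Qed.

(** By [X_span] the first letter is a combination of elements [X a b]: the lowering ones are root
    vectors, and the others preserve the filtration, so they leave a word one letter shorter. *)
Lemma pbw_lt_root_span N u : u \in pbw_lt N -> u \in root_span N.
Proof.
elim: N u => [|N IH] u; first by apply: lspan_sub => ? [? []].
apply: lspan_sub => _ [[|x l] [lN ->]]; first by apply: lspan_gen; exists [::].
have : word rho l v \in root_span N by apply: IH; apply: word_pbw_lt.
apply: lspan_map; first exact: sp_act_linearr.
move=> _ [l' [lN' ->]]; rewrite [x]X_span actl_sum; apply: rpred_sum => a _.
rewrite actl_sum; apply: rpred_sum => b _; rewrite actlZ; apply: rpredZ.
have [low|up] := leqP n.*2 (pos a + pos b)%N.
  have [c cE] := lower_root low.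
  have -> : X K a b = Xr c by case: cE => -[-> ->]; rewrite /Xr // XC.
  by apply: lspan_gen; exists (c :: l').
apply: root_span_mono (leqnSn N) _; apply: IH; apply: pbw_lt_stab.
  by apply: stabX; lia.
by apply: word_pbw_lt; rewrite size_map.
Qed.

Definition xmono s := rword (word_of s) v.

Lemma rword_xmono l : rword l v - xmono (expo_of l) \in pbw_lt (size l).
Proof.
rewrite -(size_map Xr); apply: word_perm; apply: perm_map; exact: perm_word_of.
Qed.

Definition mono_lt_span s : {pred V} := lspan [set u | exists t, expo_lt t s /\ u = xmono t].

HB.instance Definition _ s := GRing.SubmodClosed.on (mono_lt_span s).

Lemma pbw_lt_mono_lt_span s u : u \in pbw_lt (edeg s) -> u \in mono_lt_span s.
Proof.
suff H N : (N <= edeg s)%N -> u \in pbw_lt N -> u \in mono_lt_span s by apply: H.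
elim: N u => [|N IH] u Ns; first by apply: lspan_sub => ? [? []].
move=> /pbw_lt_root_span; apply: lspan_sub => _ [l [lN ->]].
rewrite -[rword l v](subrK (xmono (expo_of l))); apply: rpredD.
  by apply: IH; [lia|apply: pbw_lt_mono (rword_xmono l); lia].
by apply: lspan_gen; exists (expo_of l); split=> //; rewrite /expo_lt edeg_expo_of; apply/orP; left; lia.
Qed.

(** The powers are those of the vectors of the long root [alphabar i] and, in [rel2], of the root
    from [i] to [j]; [bound] is the value of the highest weight on the corresponding coroot. *)
Hypothesis rel1 : forall i : 'I_n,
  word rho (nseq (bound m i n).+1 (X K (rshift n i) (rshift n i))) v = 0.
Hypothesis rel2 : forall i j j' : 'I_n, (i <= j)%N -> j' = j.+1 :> nat ->
  word rho (nseq (bound m i j).+1 (X K (rshift n i) (lshift n j'))) v = 0.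

Lemma word_nseq0 x N M : (M <= N)%N -> word rho (nseq M x) v = 0 ->
  word rho (nseq N x) v = 0.
Proof. by move=> /subnK <- E; rewrite nseqD word_cat E word0. Qed.

Section Chain.
Variables (L : seq root) (i j : nat).
Local Notation N := (size L).
Local Notation H := ('I_N * bool)%type.
Hypotheses (sL : sorted (@root_le n) L)
  (aL : all (fun c => (i <= row_of c)%N && (col_of c <= j)%N) L)
  (bL : (bound m i j < N)%N).

Let c0 : 'I_N -> root := fun k => tnth (in_tuple L) k.

Definition zL : {ffun H -> idx} :=
  [ffun h => if h.2 then rootB (c0 h.1) else rootA (c0 h.1)].

Definition clsL (h : H) : bool := (j.+1 < n)%N && h.2.

Lemma c0P k : (i <= row_of (c0 k))%N && (col_of (c0 k) <= j)%N.
Proof. by apply: (allP aL); apply: mem_tnth. Qed.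

Lemma map_c0 : map c0 (enum 'I_N) = L.
Proof. by rewrite /c0 map_tnth_enum. Qed.

(** If [j.+1 < n], the positions of the ends [rootB] and [rootA] lie in disjoint ranges; each class
    is pushed to its own extreme, and the base case is [rel2]. Otherwise the ranges meet, all
    half-edges form one class pushed to position 2n-1-i, and the base case is the long root relation
    [rel1]. *)
Lemma symX_chain : symX rho v clsL zL \in pbw_lt N.
Proof.
have N0 : (0 < N)%N by lia.
have /andP[i0 j0] := c0P (Ordinal N0); have [rn rc cn] := cellP (c0 (Ordinal N0)).
have ilt : (i < n)%N by lia.
pose i' := Ordinal ilt.
have [jn|nj] := ltnP j.+1 n.
  pose j' := Ordinal jn; have jlt : (j < n)%N by lia.
  pose o (e : bool) := if e then lshift n j' else rshift n i'.
  pose P (e : bool) := fun a : idx => if e then (i < pos a <= j.+1)%N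
    else (n.*2.-1 - j <= pos a <= n.*2.-1 - i)%N.
  have clE h : clsL h = h.2 by rewrite /clsL jn.
  have po : pos (o true) = j.+1 /\ pos (o false) = (n.*2.-1 - i)%N.
    by rewrite /o pos_l pos_r.
  apply: (@symX_pbw_lt _ _ _ rho v upper0 stabX N clsL o P) => [[k b]|h|h a|h h1|h h1 a b c|h h'|].
  - rewrite clE ffunE /P /=; have := c0P k; have [? ? ?] := cellP (c0 k).
    by case: b; rewrite ?pos_rootA ?pos_rootB; lia.
  - rewrite clE; case: po => p1 p2; rewrite /P; case: (h.2); rewrite ?p1 ?p2; lia.
  - rewrite clE; case: po => p1 p2; rewrite /P; case: (h.2) => ap.
      have [e|ne] := eqVneq (pos a) j.+1; last by right; rewrite p1; lia.
      by left; apply: pos_inj; rewrite p1.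
    have [e|ne] := eqVneq (pos a) (n.*2.-1 - i)%N; last by right; rewrite p2; lia.
    by left; apply: pos_inj; rewrite p2.
  - by rewrite !clE; case: po => p1 p2; rewrite /P; case: (h.2); case: (h1.2);
      rewrite ?p1 ?p2 //; lia.
  - rewrite !clE /= /P; case: po => p1 p2; have := pos_lt c; have := pos_bar c.
    by move=> pb cn'; case: (h.2); case: (h1.2) => /=; rewrite ?p1 ?p2 => ? ? ? E;
      move: pb; rewrite -E; lia.
  - by rewrite !clE /= => ->.
  - rewrite (_ : monX _ _ _ = 0) ?rpred0 // -[RHS](@word_nseq0 (X K (rshift n i') (lshift n j')) N _ bL).
      congr word; apply: (@eq_from_nth _ 0); rewrite size_map size_enum_ord ?size_nseq // => k kN.
      rewrite (nth_map (Ordinal kN)) ?size_enum_ord // nth_nseq kN /edgeX !ffunE !clE /=.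
      by [].
    by apply: (@rel2 i' (Ordinal jlt) j') => //; rewrite /=; lia.
pose o (e : bool) := rshift n i'.
pose P (e : bool) := fun a : idx => (i < pos a <= n.*2.-1 - i)%N.
have clE h : clsL h = false by rewrite /clsL ltnNge nj.
have po e : pos (o e) = (n.*2.-1 - i)%N by rewrite /o pos_r.
apply: (@symX_pbw_lt _ _ _ rho v upper0 stabX N clsL o P) => [[k b]|h|h a|h h1|h h1 a b c|h h'|].
- rewrite ffunE /P /=; have := c0P k; have [? ? ?] := cellP (c0 k).
  by case: b; rewrite ?pos_rootA ?pos_rootB; lia.
- by rewrite /P po; lia.
- rewrite /P po => ap.
  have [e|ne] := eqVneq (pos a) (n.*2.-1 - i)%N; last by right; lia.
  by left; apply: pos_inj; rewrite po.
- by rewrite !clE.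
- by rewrite /P po; lia.
- by rewrite !clE.
- rewrite (_ : monX _ _ _ = 0) ?rpred0 //.
  have bN : ((bound m i n).+1 <= N)%N.
    apply: leq_trans bL; rewrite ltnS /bound big_mkcond [X in (_ <= X)%N]big_mkcond /=.
    by apply: leq_sum => k _; case: ifP => // ?; rewrite ifT //; have := ltn_ord k; lia.
  rewrite -[RHS](@word_nseq0 (X K (rshift n i') (rshift n i')) N _ bN).
    congr word; apply: (@eq_from_nth _ 0); rewrite size_map size_enum_ord ?size_nseq // => k kN.
    by rewrite (nth_map (Ordinal kN)) ?size_enum_ord // nth_nseq kN /edgeX !ffunE !clE.
  exact: (rel1 i').
Qed.

Variables (s : expo) (r : seq root).
Hypothesis rL : perm_eq (word_of s) (r ++ L).

Lemma wgt_rL : edeg s = (size r + N)%N.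
Proof. by rewrite -size_word_of (perm_size rL) size_cat. Qed.

Lemma zL_edge k : edge_of (zL (k, false)) (zL (k, true)) (c0 k).
Proof. by rewrite !ffunE; left. Qed.

Lemma word_edges (z : {ffun H -> idx}) (ck : 'I_N -> root) :
  (forall k, edge_of (z (k, false)) (z (k, true)) (ck k)) ->
  word rho (map Xr r) (monX rho v z) = rword (r ++ map ck (enum 'I_N)) v.
Proof.
move=> zck; rewrite rword_cat /rword /monX -map_comp; congr (word _ _ (word _ _ _)).
by apply: eq_map => k; rewrite /edgeX /Xr /=; case: (zck k) => -[-> ->] //; rewrite XC.
Qed.

(* The intervals [[rootB c, rootA c]] shrink along a chain. *)
Lemma pairs_nested : {in pairs zL &, forall p p' : nat * nat,
  ~~ ((p.1 < p'.1)%N && (p.2 < p'.2)%N)}.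
Proof.
have cmp (k k2 : 'I_N) : (k <= k2)%N -> root_le (c0 k) (c0 k2).
  move=> kl; rewrite /c0 !(tnth_nth (c0 k)) /=.
  by apply: (sorted_leq_nth (@root_le_trans n) (@root_le_refl n)); rewrite ?inE ?ltn_ord.
move=> _ _ /mapP[[k b] _ ->] /mapP[[k' b'] _ ->] /=; rewrite !ffunE /=.
have [? ? ?] := cellP (c0 k); have [? ? ?] := cellP (c0 k').
have [/cmp/andP[? ?]|/ltnW/cmp/andP[? ?]] := leqP k k';
  by case: b; case: b'; rewrite /= !(pos_rootA, pos_rootB); lia.
Qed.

(** A rematching with a letter that does not lower drops in degree. If all letters lower,
    [rearrangement_anti] bounds [Phi] from below by that of [s], with equality only for the same
    multiset of roots. *)
Lemma perm_term (g : {perm H}) :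
  let T := word rho (map Xr r) (monX rho v [ffun h => zL (g h)]) in
  T \in mono_lt_span s \/ T - xmono s \in mono_lt_span s.
Proof.
set z := [ffun h => zL (g h)]; move=> T.
have [/forallP low|/forallPn[k]] :=
    boolP [forall k, (n.*2 <= pos (z (k, false)) + pos (z (k, true)))%N]; last first.
  rewrite -ltnNge => up; left; apply: pbw_lt_mono_lt_span; rewrite wgt_rL -(size_map Xr).
  apply: pbw_lt_word; rewrite /monX.
  have aux p q : (p < q)%N -> (p <= q.-1)%N by lia.
  have st : stab rho v (edgeX K z k) by apply: stabX; apply: aux.
  have kk : k \in enum 'I_N by rewrite mem_enum.
  have := word_at_stab (edgeX K z) (enum_uniq 'I_N) kk st.
  rewrite size_enum_ord (_ : word_at _ _ _ _ _ _ = monX rho v z) //.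
  by congr word; apply/eq_map => k2; case: eqP => [->|].
have [ck zck] := fin_all_exists (fun k => lower_root (low k)).
have TE : T = rword (r ++ map ck (enum 'I_N)) v by apply: word_edges.
set l := r ++ map ck (enum 'I_N) in TE.
have sl : size l = edeg s by rewrite wgt_rL size_cat size_map size_enum_ord.
have d : T - xmono (expo_of l) \in mono_lt_span s.
  by rewrite TE; apply: pbw_lt_mono_lt_span; rewrite -sl; apply: rword_xmono.
have [p1 p2] := pairs_perm zL g.
have [le eqi] := rearrangement_anti p1 p2 pairs_nested.
rewrite (sum_edges zL_edge) (sum_edges zck) map_c0 in le eqi.
have PE : Phi s = (\sum_(c <- r) pAB c + \sum_(c <- L) pAB c)%N.
  by rewrite -big_cat -Phi_expo_of -(iffLR (perm_expo_of _ _) rL) word_ofK.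
have PE' : Phi (expo_of l) = (\sum_(c <- r) pAB c + \sum_(c <- map ck (enum 'I_N)) pAB c)%N.
  by rewrite -big_cat -Phi_expo_of.
have [lt|ge] := ltnP (Phi s) (Phi (expo_of l)).
  left; rewrite -[T](subrK (xmono (expo_of l))); apply: rpredD => //.
  by apply: lspan_gen; exists (expo_of l); split=> //; rewrite /expo_lt edeg_expo_of sl eqxx lt orbT.
right; suff E : expo_of l = s by rewrite -[in X in _ - X]E.
rewrite -[s]word_ofK; apply/perm_expo_of; rewrite perm_sym; apply: perm_trans rL _.
rewrite perm_cat2l; apply/allP => c _ /=; apply/eqP.
have pp : perm_eq (pairs zL) (pairs z).
  by rewrite -eqi eqn_pmul2l // eqn_leq -(leq_pmul2l (isT : 0 < 2)%N) le -(leq_add2l (\sum_(c <- r) pAB c)%N) -PE -PE'.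
have /seq.permP/(_ (pred1 (pos (rootA c), pos (rootB c)))) := pp.
rewrite (count_edges zL_edge) (count_edges zck) map_c0.
by move=> /eqP; rewrite eqn_pmul2l // => /eqP.
Qed.

Lemma straighten_chain : xmono s \in mono_lt_span s.
Proof.
pose T (g : {perm H}) := word rho (map Xr r) (monX rho v [ffun h => zL (g h)]).
have TS : \sum_(g in clsG clsL) T g \in mono_lt_span s.
  rewrite -word_sum; apply: pbw_lt_mono_lt_span.
  by have := pbw_lt_word (map Xr r) symX_chain; rewrite size_map -wgt_rL.
(* All terms have coefficient 1, so those that reproduce [xmono s] cannot cancel; the identity
   permutation is one of them. *)
pose Q := [pred g : {perm H} | (g \in clsG clsL) && (T g - xmono s \in mono_lt_span s)].
have S1 : \sum_(g in clsG clsL) T g - xmono s *+ #|Q| \in mono_lt_span s.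
  rewrite -sumr_const big_mkcond [X in _ - X]big_mkcond -sumrB /=.
  apply: rpred_sum => g _.
  have -> : (g \in Q) = (g \in clsG clsL) && (T g - xmono s \in mono_lt_span s) by [].
  case: (g \in clsG clsL) => /=; last by rewrite subrr rpred0.
  case: ifPn => // ns; rewrite subr0.
  by have [//|] := perm_term g; rewrite -/(T g) (negPf ns).
have Q0 : (0 < #|Q|)%N.
  apply/card_gt0P; exists 1%g; rewrite !inE; apply/andP; split.
    by apply/forallP => h; rewrite perm1.
  have -> : T 1%g = rword (r ++ L) v.
    rewrite -[in RHS]map_c0; apply: word_edges => k.
    by rewrite !ffunE !perm1 /=; left.
  have -> : xmono s = xmono (expo_of (r ++ L)).
    by rewrite -(iffLR (perm_expo_of _ _) rL) word_ofK.
  by apply: pbw_lt_mono_lt_span; rewrite wgt_rL -size_cat rword_xmono.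
have : xmono s *+ #|Q| \in mono_lt_span s.
  by rewrite -[X in X \in _](subKr (\sum_(g in clsG clsL) T g)) rpredB.
rewrite -scaler_nat => H; rewrite -[xmono s](scalerK (a := #|Q|%:R)).
  by rewrite rpredZ.
by rewrite pnatr_eq0 -lt0n.
Qed.

End Chain.

Lemma straighten s : ~ chain_bounded m s -> xmono s \in mono_lt_span s.
Proof.
move=> ns; have [C [i [j [uC sC aC bC]]]] : exists C i j,
    [/\ uniq C, sorted (@root_le n) C, all (fun c => (i <= row_of c)%N && (col_of c <= j)%N) C &
     (bound m i j < \sum_(c <- C) s c)%N].
  apply: contrapT => nex; apply: ns => C i j uC sC aC; rewrite leqNgt; apply/negP => lt.
  by apply: nex; exists C, i, j.
(* The violated chain with each root repeated according to its exponent; the rest of the monomial is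
   carried along as a prefix. *)
pose L := flatten [seq nseq (s c) c | c <- C].
have LC c : c \in L -> c \in C by move=> /flatten_mapP[d dC]; rewrite mem_nseq => /andP[_ /eqP->].
have sL : sorted (@root_le n) L.
  move: sC; rewrite !(sorted_pairwise (@root_le_trans n)) /L {uC aC bC L LC}.
  elim: C => //= c C IH /andP[/allP cC /IH {IH} pC].
  rewrite pairwise_cat pC andbT; apply/andP; split.
    apply/allrelP => x y; rewrite mem_nseq => /andP[_ /eqP->] /flatten_mapP[d dC].
    by rewrite mem_nseq => /andP[_ /eqP->]; apply: cC.
  by elim: (s c) => //= k ->; rewrite andbT; apply/allP => x; rewrite mem_nseq =>
    /andP[_ /eqP->]; apply: root_le_refl.
have cL c : count_mem c L = (if c \in C then s c else 0)%N.
  rewrite count_flatten -map_comp sumnE big_map.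
  have [cC|nC] := boolP (c \in C).
    rewrite (bigD1_seq c) //= count_nseq /= eqxx mul1n big1 ?addn0 // => d /negPf dc.
    by rewrite count_nseq /= dc.
  rewrite big_seq big1 // => d dC /=; rewrite count_nseq /=; case: eqP => // dc.
  by rewrite -dc dC in nC.
apply: (@straighten_chain L i j sL _ _ s (word_of [ffun c => if c \in C then 0%N else s c])).
- by apply/allP => c /LC/(allP aC).
- rewrite size_flatten /shape -map_comp sumnE big_map.
  by under eq_bigr do rewrite /= size_nseq.
apply/allP => c _ /=; apply/eqP; have := congr1 (fun f : expo => f c) (word_ofK s).
rewrite ffunE => ->; rewrite count_cat cL.
have := congr1 (fun f : expo => f c) (word_ofK [ffun c => if c \in C then 0%N else s c]).
by rewrite !ffunE => ->; case: ifP; rewrite ?addn0 ?add0n.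
Qed.

Definition basis_span d : {pred V} :=
  lspan [set u | exists t, [/\ chain_bounded m t, (edeg t <= d)%N & u = xmono t]].

HB.instance Definition _ d := GRing.SubmodClosed.on (basis_span d).

Lemma basis_span_mono d d' u : (d <= d')%N -> u \in basis_span d -> u \in basis_span d'.
Proof.
move=> dd; apply: lspan_sub => _ [t [tm td ->]]; apply: lspan_gen.
by exists t; split=> //; apply: leq_trans dd.
Qed.

(** Straightening terminates: it lowers the degree, or keeps it and raises [Phi], which [Phi_le]
    bounds in each degree. *)
Lemma xmono_basis_span s : xmono s \in basis_span (edeg s).
Proof.
move Ed: (edeg s) => d; elim/ltn_ind: d s Ed => d IHd s Ed.
move Ek: (d * (n.*2 * n.*2) - Phi s)%N => k; elim/ltn_ind: k s Ed Ek => k IHk s Ed Ek.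
have [sm|sm] := pselect (chain_bounded m s).
  by apply: lspan_gen; exists s; split=> //; rewrite Ed.
move: (straighten sm); apply: lspan_sub => _ [t [ts ->]].
move: ts; rewrite /expo_lt Ed => /orP[lt|/andP[/eqP wt Pt]].
  by apply: basis_span_mono (IHd _ lt t erefl); apply: ltnW.
apply: (IHk _ _ t wt erefl); rewrite -Ek; have := Phi_le t; rewrite wt; lia.
Qed.

Lemma pbw_lt_basis_span d u : u \in pbw_lt d.+1 -> u \in basis_span d.
Proof.
elim/ltn_ind: d u => d IH u /pbw_lt_root_span; apply: lspan_sub => _ [l [ld ->]].
rewrite -[rword l v](subrK (xmono (expo_of l))); apply: rpredD; last first.
  by apply: basis_span_mono (xmono_basis_span _); rewrite edeg_expo_of.
have := rword_xmono l; case: (size l) ld => [|e] ld; last first.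
  by move=> /(IH e ld); apply: basis_span_mono; lia.
by apply: lspan_sub => ? [? []].
Qed.

End Straightening.

(** * The exterior algebra of the vector representation *)

Lemma exchange4 (I : finType) (V : nmodType) (F : I -> I -> I -> I -> V) :
  \sum_a \sum_b \sum_c \sum_d F a b c d = \sum_c \sum_d \sum_a \sum_b F a b c d.
Proof.
under eq_bigr do rewrite exchange_big /=.
rewrite exchange_big /=; apply: eq_bigr => c _.
by under eq_bigr do rewrite exchange_big /=; rewrite exchange_big.
Qed.

Section Fock.
Variables (n : nat) (K : numClosedFieldType).
Local Notation idx := 'I_(n + n).
Local Notation sp := (sp n K).
Local Notation root := (pos_root n).
Local Notation fock := {ffun {set idx} -> K^o}.
Implicit Types (a b c d : idx) (I T : {set idx}) (u w : fock).

(** The sign of moving the basis vector [a] to its place in the wedge indexed by [I]. With it, [cre]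
    and [ann] are exterior multiplication and contraction. *)
Definition fsgn a I : K := (-1) ^+ #|[set x in I | (x < a)%N]|.

Definition cre a u : fock := [ffun I : {set idx} => if a \in I then fsgn a I * u (I :\ a) else 0].
Definition ann b u : fock := [ffun I : {set idx} => if b \in I then 0 else fsgn b I * u (b |: I)].

Lemma fsgnK a I : fsgn a I * fsgn a I = 1.
Proof. by rewrite /fsgn -exprD addnn -muln2 exprM sqrr_sign. Qed.

Lemma fsgn_neq0 a I : fsgn a I != 0.
Proof. by rewrite /fsgn signr_eq0. Qed.

Lemma fsgn_conj a I : (fsgn a I)^* = fsgn a I.
Proof. by rewrite /fsgn rmorphXn rmorphN1. Qed.

Lemma fsgnD a b I : b \in I -> fsgn a I = (-1) ^+ (b < a)%N * fsgn a (I :\ b).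
Proof.
move=> bI; rewrite /fsgn -exprD; congr (_ ^+ _).
rewrite (cardsD1 b) !inE bI /=; congr (_ + _)%N; apply: eq_card => x.
by rewrite !inE; case: (x == b); case: (x \in I).
Qed.

Lemma fsgnU a b I : b \notin I -> fsgn a (b |: I) = (-1) ^+ (b < a)%N * fsgn a I.
Proof.
move=> bI; rewrite (@fsgnD a b) ?setU11 //; congr (_ * fsgn _ _).
by rewrite setU1K.
Qed.

Lemma fsgn_self a I : fsgn a (I :\ a) = fsgn a I.
Proof.
rewrite /fsgn; congr (_ ^+ _); apply: eq_card => x; rewrite !inE.
by case: eqP => [->|_] //=; rewrite ltnn andbF.
Qed.

Lemma fsgnU_self a I : fsgn a (a |: I) = fsgn a I.
Proof.
rewrite /fsgn; congr (_ ^+ _); apply: eq_card => x; rewrite !inE.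
by case: eqP => [->|_] //=; rewrite ltnn andbF.
Qed.

Lemma signlt a b : a != b -> (-1) ^+ (a < b)%N = - (-1) ^+ (b < a)%N :> K.
Proof.
by move=> ab; rewrite ltnNge leq_eqVlt val_eqE eq_sym (negPf ab) /=; case: (b < a)%N; rewrite ?expr0 ?expr1 ?opprK.
Qed.

Lemma cre_cre a b u : cre a (cre b u) = - cre b (cre a u).
Proof.
apply/ffunP => I; rewrite !ffunE.
have [<-|ab] := eqVneq a b; first by rewrite !inE eqxx /=; case: ifP; rewrite ?mulr0 oppr0.
rewrite !inE ab eq_sym ab /=; case: ifP => aI; case: ifP => bI; rewrite ?mulr0 ?oppr0 //.
have -> : I :\ b :\ a = I :\ a :\ b by apply/setP => x; rewrite !inE andbCA.
by rewrite (@fsgnD a b) // (@fsgnD b a I) // (signlt ab); ring.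
Qed.

Lemma ann_ann a b u : ann a (ann b u) = - ann b (ann a u).
Proof.
apply/ffunP => I; rewrite !ffunE.
have [<-|ab] := eqVneq a b; first by rewrite !inE eqxx /=; case: ifP; rewrite ?mulr0 oppr0.
rewrite !inE (negPf ab) eq_sym (negPf ab) /=; case: ifP => aI; case: ifP => bI; rewrite ?mulr0 ?oppr0 //.
have -> : b |: (a |: I) = a |: (b |: I) by rewrite finset.setUCA.
by rewrite (@fsgnU a b) ?bI // (@fsgnU b a) ?aI // (signlt ab); ring.
Qed.

Lemma ann_cre a b u : ann b (cre a u) = (u *+ (a == b)) - cre a (ann b u).
Proof.
apply/ffunP => I; rewrite !ffunE.
have [<-|ab] := eqVneq a b.
  rewrite mulr1n !inE eqxx /= fsgnU_self fsgn_self; case: ifPn => aI.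
    by rewrite setD1K // mulrA fsgnK mul1r subrr.
  by rewrite setU1K // mulrA fsgnK mul1r subr0.
rewrite mulr0n !ffunE add0r !inE [b == a]eq_sym (negPf ab) /=.
case: ifPn => bI; case: ifPn => aI; rewrite ?bI ?mulr0 ?oppr0 //.
have -> : (b |: I) :\ a = b |: (I :\ a).
  by apply/setP => x; rewrite !inE; case: eqP => [->|//]; rewrite (negPf ab).
by rewrite (@fsgnU a b) // (@fsgnD b a I) // (signlt ab); case: (b < a)%N; rewrite ?expr0 ?expr1; ring.
Qed.

Lemma creD a u w : cre a (u + w) = cre a u + cre a w.
Proof. by apply/ffunP => I; rewrite !ffunE; case: ifP; rewrite ?mulrDr ?addr0. Qed.
Lemma creZ a (k : K) u : cre a (k *: u) = k *: cre a u.
Proof. by apply/ffunP => I; rewrite !ffunE; case: ifP => _; [exact: mulrCA|rewrite scaler0]. Qed.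
Lemma annD a u w : ann a (u + w) = ann a u + ann a w.
Proof. by apply/ffunP => I; rewrite !ffunE; case: ifP; rewrite ?mulrDr ?addr0. Qed.
Lemma annZ a (k : K) u : ann a (k *: u) = k *: ann a u.
Proof. by apply/ffunP => I; rewrite !ffunE; case: ifP => _; [rewrite scaler0|exact: mulrCA]. Qed.

Definition Eop a b u := cre a (ann b u).

Lemma EopD a b u w : Eop a b (u + w) = Eop a b u + Eop a b w.
Proof. by rewrite /Eop annD creD. Qed.
Lemma EopZ a b (k : K) u : Eop a b (k *: u) = k *: Eop a b u.
Proof. by rewrite /Eop annZ creZ. Qed.
Lemma Eop0 a b : Eop a b 0 = 0.
Proof. by have := EopZ a b 0 0; rewrite !scale0r. Qed.

Lemma Eop_comm a b c d u : Eop a b (Eop c d u) - Eop c d (Eop a b u) =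
  (Eop a d u) *+ (b == c) - (Eop c b u) *+ (a == d).
Proof.
have creN e w : cre e (- w) = - cre e w by rewrite -!scaleN1r creZ.
have annN e w : ann e (- w) = - ann e w by rewrite -!scaleN1r annZ.
have cre_n e w (t : bool) : cre e (w *+ t) = cre e w *+ t.
  by case: t; rewrite ?mulr1n ?mulr0n // -(scale0r w) creZ !scale0r.
have PQ : cre a (cre c (ann b (ann d u))) = cre c (cre a (ann d (ann b u))).
  by rewrite cre_cre ann_ann !creN opprK.
rewrite /Eop !ann_cre !creD !creN !cre_n (eq_sym c b) PQ.
by rewrite opprD opprK addrACA addNr addr0.
Qed.

Definition fock_act (x : sp) u : fock := \sum_a \sum_b submod_val x a b *: Eop a b u.

Lemma fock_linl u : linear (fock_act^~ u).
Proof.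
move=> k x y; rewrite /fock_act scaler_sumr -big_split; apply: eq_bigr => a _ /=.
rewrite scaler_sumr -big_split; apply: eq_bigr => b _ /=.
by rewrite !mxE scalerDl scalerA.
Qed.

Lemma fock_linr x : linear (fock_act x).
Proof.
move=> k u w; rewrite /fock_act scaler_sumr -big_split; apply: eq_bigr => a _ /=.
rewrite scaler_sumr -big_split; apply: eq_bigr => b _ /=.
by rewrite EopD EopZ scalerDr !scalerA mulrC.
Qed.

Lemma Eop_fock a b x u :
  Eop a b (fock_act x u) = \sum_c \sum_d submod_val x c d *: Eop a b (Eop c d u).
Proof.
rewrite /fock_act (big_morph (Eop a b) (EopD a b) (Eop0 a b)); apply: eq_bigr => c _.
rewrite (big_morph (Eop a b) (EopD a b) (Eop0 a b)); apply: eq_bigr => d _.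
by rewrite EopZ.
Qed.

Lemma fock_bracket x y u :
  fock_act (sp_bracket x y) u = fock_act x (fock_act y u) - fock_act y (fock_act x u).
Proof.
have act2 (x' y' : sp) : fock_act x' (fock_act y' u) =
    \sum_a \sum_b \sum_c \sum_d
      (submod_val x' a b * submod_val y' c d) *: Eop a b (Eop c d u).
  apply: eq_bigr => a _; apply: eq_bigr => b _; rewrite Eop_fock scaler_sumr.
  by apply: eq_bigr => c _; rewrite scaler_sumr; apply: eq_bigr => d _; rewrite scalerA.
rewrite !act2 [X in _ - X]exchange4.
transitivity (\sum_a \sum_b \sum_c \sum_d
   ((submod_val x a b * submod_val y c d) *: (Eop a d u *+ (b == c)) -
    (submod_val x a b * submod_val y c d) *: (Eop c b u *+ (a == d)))); last first.
  rewrite -sumrB; apply: eq_bigr => a _; rewrite -sumrB; apply: eq_bigr => b _.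
  rewrite -sumrB; apply: eq_bigr => c _; rewrite -sumrB; apply: eq_bigr => d _.
  by rewrite [in RHS](mulrC (submod_val y c d)) -!scalerBr Eop_comm.
have mulE (x' y' : sp) : \sum_a \sum_b (submod_val x' *m submod_val y') a b *: Eop a b u =
    \sum_a \sum_b \sum_c \sum_d (submod_val x' a b * submod_val y' c d) *:
      (Eop a d u *+ (b == c)).
  apply: eq_bigr => a _; transitivity (\sum_b \sum_d
      (submod_val x' a b * submod_val y' b d) *: Eop a d u).
    by rewrite exchange_big; apply: eq_bigr => d _; rewrite mxE scaler_suml.
  apply: eq_bigr => b _; rewrite [RHS](bigD1 b) //= [X in _ + X]big1 => [|c /negPf cb].
    by rewrite addr0; apply: eq_bigr => d _; rewrite eqxx mulr1n.
  by rewrite big1 // => d _; rewrite eq_sym cb mulr0n scaler0.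
transitivity (\sum_a \sum_b (submod_val x *m submod_val y) a b *: Eop a b u -
   \sum_a \sum_b (submod_val y *m submod_val x) a b *: Eop a b u).
  rewrite -sumrB; apply: eq_bigr => a _; rewrite -sumrB; apply: eq_bigr => b _.
  by rewrite -scalerBl; congr (_ *: _); rewrite /= !mxE.
rewrite !mulE [X in _ - X]exchange4.
rewrite -sumrB; apply: eq_bigr => a _; rewrite -sumrB; apply: eq_bigr => b _.
rewrite -sumrB; apply: eq_bigr => c _; rewrite -sumrB; apply: eq_bigr => d _.
by congr (_ - _); rewrite mulrC (eq_sym d).
Qed.

Definition fock_sp : sp_module n fock :=
  SpModule fock_linl fock_linr fock_bracket.

Lemma EopE a b u I : Eop a b u I =
  if (a \in I) && (b \notin I :\ a) then
    fsgn a I * fsgn b (I :\ a) * u (b |: (I :\ a)) else 0.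
Proof.
rewrite /Eop !ffunE; case: (a \in I) => //=.
by case: ifP => _ /=; rewrite ?mulr0 // mulrA.
Qed.

Lemma fock_X a b u : fock_sp (X K a b) u =
  sg K b *: Eop a (bar b) u + sg K a *: Eop b (bar a) u.
Proof.
have D (k : K) (c d : idx) : \sum_e \sum_g (k *: delta_mx c d : 'M[K]_(n + n)) e g *: Eop e g u =
    k *: Eop c d u.
  rewrite (bigD1 c) //= [X in _ + X]big1 => [|e /negPf ne]; last first.
    by rewrite big1 // => g _; rewrite !mxE ne mulr0 scale0r.
  rewrite (bigD1 d) //= big1 => [|g /negPf ng]; last by rewrite !mxE ng andbF mulr0 scale0r.
  by rewrite !mxE !eqxx mulr1 !addr0.
rewrite -!D -big_split; apply: eq_bigr => c _; rewrite -big_split; apply: eq_bigr => d _.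
by rewrite X_mx [in LHS]mxE scalerDl.
Qed.

Definition hdot (J : finType) (u w : {ffun J -> K^o}) : K := \sum_i (u i)^* * w i.

Lemma hdotC (J : finType) (u w : {ffun J -> K^o}) : hdot u w = (hdot w u)^*.
Proof. by rewrite /hdot rmorph_sum; apply: eq_bigr => i _; rewrite rmorphM /= conjCK mulrC. Qed.

Lemma hdotDl (J : finType) k (u1 u2 w : {ffun J -> K^o}) :
  hdot (k *: u1 + u2) w = k^* * hdot u1 w + hdot u2 w.
Proof.
rewrite /hdot mulr_sumr -big_split; apply: eq_bigr => i _ /=.
by rewrite !ffunE rmorphD rmorphM /= mulrDl mulrA.
Qed.

Lemma hdotDr (J : finType) k (u w1 w2 : {ffun J -> K^o}) :
  hdot u (k *: w1 + w2) = k * hdot u w1 + hdot u w2.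
Proof. by rewrite hdotC hdotDl rmorphD rmorphM /= conjCK -!hdotC. Qed.

Lemma hdot0l (J : finType) (w : {ffun J -> K^o}) : hdot 0 w = 0.
Proof. by rewrite /hdot big1 // => i _; rewrite ffunE conjC0 mul0r. Qed.

Lemma hdotZl (J : finType) k (u w : {ffun J -> K^o}) : hdot (k *: u) w = k^* * hdot u w.
Proof. by rewrite -[k *: u]addr0 hdotDl hdot0l addr0. Qed.

Lemma hdotZr (J : finType) k (u w : {ffun J -> K^o}) : hdot u (k *: w) = k * hdot u w.
Proof. by rewrite hdotC hdotZl rmorphM /= conjCK -hdotC. Qed.

Lemma hdot_Eop a b u w : hdot (Eop a b u) w = hdot u (Eop b a w).
Proof.
have C e u' w' : hdot (cre e u') w' = hdot u' (ann e w').
  rewrite /hdot (bigID (fun I => e \in I)) /= [X in _ + X]big1 => [|I /negPf eI]; last first.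
    by rewrite ffunE eI conjC0 mul0r.
  rewrite [RHS](bigID (fun I => e \in I)) /= [X in _ = X + _]big1 => [|I eI]; last first.
    by rewrite ffunE eI mulr0.
  rewrite addr0 add0r (reindex_onto (fun I => e |: I) (fun I => I :\ e)) /=; last first.
    by move=> I eI; rewrite setD1K.
  apply: eq_big => [I|I].
    rewrite setU11 /=; apply/eqP/idP => [<-|eI]; first by rewrite !inE eqxx.
    by rewrite setU1K.
  move=> /andP[_ /eqP E]; have eI : e \notin I by rewrite -E !inE eqxx.
  rewrite !ffunE setU11 (negPf eI) E fsgnU_self.
  by rewrite rmorphM /= fsgn_conj mulrCA mulrA.
by rewrite /Eop C hdotC -C -hdotC.
Qed.

(** Contravariance: matrix units are adjoint to their transposes, so the adjoint of a lowering
    element is, up to sign, the opposite raising element. *)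
Lemma hdot_fock a b u w : hdot (fock_sp (X K a b) u) w =
  - (sg K a * sg K b) * hdot u (fock_sp (X K (bar a) (bar b)) w).
Proof.
rewrite !fock_X !barK !sg_bar hdotDl hdotDr hdotZl hdotZr !conj_sg !hdot_Eop.
have := sgK K a; have := sgK K b.
set A := hdot _ _; set B := hdot _ _; set p := sg K a; set q := sg K b => q2 p2.
transitivity ((p * p) * (q * A) + (q * q) * (p * B)); first by rewrite p2 q2 !mul1r.
by ring.
Qed.

End Fock.

Section Essential.
Variables (n : nat) (K : numClosedFieldType).
Local Notation expo := {ffun pos_root n -> nat}.

(* [xi] is dual to the monomial [s] up to words above [s]; existence of such
   functionals gives independence and is stable under tensor products. *)
Definition essential (V : lmodType K) (rho : sp_module n V) (v : V) (s : expo) : Prop :=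
  exists xi : V -> K^o, [/\ linear xi, xi (rword rho (word_of s) v) != 0 &
    forall l, xi (rword rho l v) != 0 -> expo_of l = s \/ expo_lt s (expo_of l)].

End Essential.

(** * Fundamental weights: exterior powers and antichains *)

Section FockVector.
Variables (n : nat) (K : numClosedFieldType) (k : 'I_n).
Local Notation idx := 'I_(n + n).
Local Notation sp := (sp n K).
Local Notation root := (pos_root n).
Local Notation fock := {ffun {set idx} -> K^o}.
Implicit Types (a b : idx) (c d : root) (I : {set idx}) (u w : fock) (l : seq root).

(** The wedge of the first k+1 basis vectors in the order of [pos] is a highest weight vector of
    weight [fund_weight k]. *)
Definition vacT : {set idx} := [set a | (pos a <= k)%N].
Definition vac : fock := [ffun I => (I == vacT)%:R].

Local Notation fk := (fock_sp n K).
Local Notation vword l := (rword fk l vac).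

Lemma Eop_neq0 a b u I : Eop a b u I != 0 ->
  [/\ a \in I, b \notin I :\ a & u (b |: (I :\ a)) != 0].
Proof.
rewrite EopE; case: ifP => [/andP[aI bI] E|_]; last by rewrite eqxx.
by split=> //; apply: contraNneq E => ->; rewrite mulr0.
Qed.

Lemma vac_neq0 I : vac I != 0 -> I = vacT.
Proof. by rewrite ffunE; case: (eqVneq I vacT) => [->//|_] /=; rewrite eqxx. Qed.

Lemma Eop_vac0 a b : (a \in vacT) && (a != b) || (b \notin vacT) -> Eop a b vac = 0.
Proof.
move=> h; apply/ffunP => I; rewrite [RHS]ffunE; apply/eqP; apply: contraT.
move=> /Eop_neq0[aI bI /vac_neq0 E]; move: h; rewrite -E !inE eqxx /= orbF.
by case/orP => [/andP[/eqP->]|]; rewrite ?eqxx.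
Qed.

Lemma Eop_vac_id a : Eop a a vac = (a \in vacT)%:R *: vac.
Proof.
case: (boolP (a \in vacT)) => aT; last by rewrite Eop_vac0 ?aT ?orbT // scale0r.
rewrite scale1r; apply/ffunP => I; rewrite EopE !inE eqxx /= andbT.
case: (boolP (a \in I)) => aI; first by rewrite setD1K // fsgn_self fsgnK mul1r.
by rewrite ffunE; case: eqP => // E; rewrite E aT in aI.
Qed.

Lemma Eop_sq a b u : a != b -> Eop a b (Eop a b u) = 0.
Proof.
move=> ab; apply/ffunP => I; rewrite [RHS]ffunE; apply/eqP; apply: contraT.
by move=> /Eop_neq0[aI bI /Eop_neq0[]]; rewrite !inE eqxx (negPf ab).
Qed.

Definition bk (l : 'I_n) : nat := l == k.

Lemma bound_bk i j : bound bk i j = (i <= k <= j)%N.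
Proof.
rewrite /bound /bk big_mkcond (bigD1 k) //= eqxx big1 ?addn0; first by case: ifP.
by move=> l /negPf ->; case: ifP.
Qed.

Lemma vac_upper a b : (pos a + pos b < n.*2.-1)%N -> fk (X K a b) vac = 0.
Proof.
move=> ab; have := pos_lt a; have := pos_lt b => bn an.
have H a' b' : (pos a' + pos b' < n.*2.-1)%N -> (pos b' < n.*2)%N -> Eop a' (bar b') vac = 0.
  move=> ab' bn'; apply: Eop_vac0; rewrite !inE -(inj_eq (@pos_inj n)) pos_bar.
  by case: (leqP (n.*2.-1 - pos b') k) => /= h; rewrite ?orbT // orbF; lia.
by rewrite fock_X !H ?scaler0 ?addr0 // addnC.
Qed.

Lemma vac_cartan (i : 'I_n) :
  fk (X K (lshift n i) (rshift n i)) vac = - (bound bk i n)%:R *: vac.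
Proof.
rewrite fock_X bar_r bar_l !Eop_vac_id !inE pos_l pos_r bound_bk.
have -> : (n.*2.-1 - i <= k)%N = false by have := ltn_ord i; have := ltn_ord k; lia.
have -> : (k <= n)%N by have := ltn_ord k; lia.
by rewrite scale0r scaler0 addr0 andbT -(bar_l i) sg_bar /sg split_l scaleNr scale1r scaleNr.
Qed.

Lemma vac_rel1 (i : 'I_n) :
  word fk (nseq (bound bk i n).+1 (X K (rshift n i) (rshift n i))) vac = 0.
Proof.
have XE u : fock_act (X K (rshift n i) (rshift n i)) u =
    (sg K (rshift n i) + sg K (rshift n i)) *: Eop (rshift n i) (lshift n i) u.
  by rewrite -[LHS]/(fk _ u) fock_X bar_r -scalerDl.
have kn : (k <= n)%N by have := ltn_ord k; lia.
rewrite bound_bk kn andbT; case: leqP => ik /=; rewrite !XE.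
  by rewrite EopZ Eop_sq ?scaler0 // eq_rlshift.
by rewrite Eop_vac0 ?scaler0 // !inE pos_l -ltnNge ik orbT.
Qed.

(** The operator is a sum of two matrix units. The one removing a barred index finds none in [vac];
    the other squares to zero, and kills [vac] at once unless [i <= k <= j]. *)
Lemma vac_rel2 (i j j' : 'I_n) : (i <= j)%N -> j' = j.+1 :> nat ->
  word fk (nseq (bound bk i j).+1 (X K (rshift n i) (lshift n j'))) vac = 0.
Proof.
move=> ij jj.
have XE u : fock_act (X K (rshift n i) (lshift n j')) u =
    sg K (lshift n j') *: Eop (rshift n i) (rshift n j') u +
    sg K (rshift n i) *: Eop (lshift n j') (lshift n i) u.
  by rewrite -[LHS]/(fk _ u) fock_X bar_r bar_l.
have E1 : Eop (rshift n i) (rshift n j') vac = 0.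
  apply: Eop_vac0; rewrite !inE !pos_r; apply/orP; right.
  by have := ltn_ord j'; have := ltn_ord k; lia.
have ne : lshift n j' != lshift n i by rewrite eq_lshift -val_eqE /=; lia.
rewrite bound_bk; have [/andP[ik kj]|nk] := boolP (_ <= _ <= _)%N.
  rewrite /= !XE E1 scaler0 add0r !EopZ Eop_sq // !scaler0 addr0 scalerA.
  suff -> : Eop (rshift n i) (rshift n j') (Eop (lshift n j') (lshift n i) vac) = 0.
    by rewrite scaler0.
  apply/ffunP => I; rewrite [RHS]ffunE; apply/eqP; apply: contraT.
  move=> /Eop_neq0[_ _ /Eop_neq0[_ _ /vac_neq0 /setP/(_ (rshift n j'))]].
  rewrite !inE !eqxx !eq_rlshift /= pos_r => /esym.
  by have := ltn_ord j'; have := ltn_ord k; lia.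
rewrite /= XE E1 scaler0 add0r Eop_vac0 ?scaler0 // ne !inE !pos_l andbT -ltnNge.
by move: nk; rewrite negb_and -!ltnNge jj; lia.
Qed.

(* [pl] lists the moves [p.1 -> p.2] by which the word [l] leads from the set
   [vacT] to the set [I]. *)
Fixpoint matched (pl : seq (idx * idx)) l : Prop :=
  match pl, l with
  | p :: pl', c :: l' => edge_of (bar p.1) p.2 c /\ matched pl' l'
  | [::], [::] => True
  | _, _ => False
  end.

Definition matching I l (pl : seq (idx * idx)) : Prop :=
  [/\ matched pl l, perm_eq (map fst pl) (enum (vacT :\: I)) &
      perm_eq (map snd pl) (enum (I :\: vacT))].

Definition short I l : Prop := (#|vacT :\: I| <= size l)%N /\
  (#|vacT :\: I| = size l -> exists pl, matching I l pl).

Lemma perm_enum1 (a : idx) (A B : {set idx}) (s : seq idx) : a \notin B -> A = a |: B ->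
  perm_eq s (enum B) -> perm_eq (a :: s) (enum A).
Proof.
move=> aB -> sB; apply: perm_trans (_ : perm_eq (a :: s) (a :: enum B)) _.
  by rewrite perm_cons.
apply: uniq_perm; rewrite /= ?enum_uniq ?mem_enum ?aB // => x.
by rewrite !inE !mem_enum !inE.
Qed.

Lemma short_step a b c I l : edge_of b a c ->
  short (bar b |: (I :\ a)) l -> a \in I ->
  [/\ (#|vacT :\: I| <= (size l).+1)%N &
    #|vacT :\: I| = (size l).+1 -> exists pl, matching I (c :: l) ((bar b, a) :: pl)].
Proof.
set I' := bar b |: (I :\ a) => abc [le mt] aI.
have sub : vacT :\: I \subset bar b |: (vacT :\: I').
  apply/fintype.subsetP => x; rewrite !inE; case: (x == bar b) => //=.
  by move=> /andP[xI ->]; rewrite (negPf xI) andbF.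
have := subset_leq_card sub; rewrite cardsU1 => le2.
split; first by move: le2 le; case: (_ \notin _) => /=; lia.
move=> E.
have nb : bar b \notin vacT :\: I' by rewrite !inE eqxx.
have E1 : vacT :\: I = bar b |: (vacT :\: I').
  by apply/eqP; rewrite eqEcard sub cardsU1 nb E add1n ltnS.
have eI' : #|vacT :\: I'| = size l by move: (congr1 (fun A : {set idx} => #|A|) E1); rewrite cardsU1 nb E add1n => -[].
have [pl [mpl p1 p2]] := mt eI'.
have bV : bar b \in vacT :\: I by rewrite E1 setU11.
have {bV}[bI bT] : bar b \notin I /\ bar b \in vacT by move: bV; rewrite inE => /andP.
have ab : a != bar b by apply: contraNneq bI => <-.
have aT : a \notin vacT.
  apply/negP => aT; have : a \in vacT :\: I' by rewrite in_setD aT andbT in_setU1 in_setD1 eqxx (negPf ab).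
  move=> aV; have : a \in vacT :\: I by rewrite E1 in_setU1 aV orbT.
  by rewrite in_setD aI.
have E2 : I :\: vacT = a |: (I' :\: vacT).
  apply/setP => x; rewrite in_setU1 !in_setD in_setU1 in_setD1.
  case: (eqVneq x a) => [->|xa] /=; first by rewrite aT aI.
  by case: (eqVneq x (bar b)) => [->|_] //=; rewrite bT (negPf bI).
exists pl; split; first by split=> //=; rewrite barK.
  by rewrite /=; apply: perm_enum1 E1 p1.
by rewrite /=; apply: perm_enum1 E2 p2; rewrite in_setD in_setU1 in_setD1 eqxx (negPf ab) andbF.
Qed.

Lemma vword_cons c l I : vword (c :: l) I =
  sg K (rootB c) * Eop (rootA c) (bar (rootB c)) (vword l) I +
  sg K (rootA c) * Eop (rootB c) (bar (rootA c)) (vword l) I.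
Proof.
have -> : vword (c :: l) = fk (Xr K c) (vword l) by [].
by rewrite /Xr fock_X !ffunE.
Qed.

Lemma vword_short l I : vword l I != 0 -> short I l.
Proof.
elim: l I => [|c l IH] I.
  move=> /vac_neq0 ->; rewrite /short setDv cards0; split=> // _.
  by exists [::]; split=> //=; rewrite ?setDv enum_set0.
rewrite vword_cons => nz.
have [a [b [abc nzE]]] : exists a b, edge_of b a c /\ Eop a (bar b) (vword l) I != 0.
  have [z|nz1] := eqVneq (Eop (rootA c) (bar (rootB c)) (vword l) I) 0.
    exists (rootB c), (rootA c); split; first by left.
    by apply: contraNneq nz => z2; rewrite z z2 !mulr0 addr0.
  by exists (rootA c), (rootB c); split=> //; right.
have [aI _ /IH sh] := Eop_neq0 nzE.
have [le mt] := short_step abc sh aI.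
by split=> // /mt[pl ?]; exists ((bar b, a) :: pl).
Qed.

Section Antichain.
Variable lA : seq root.
Hypotheses (uA : uniq lA) (regA : forall c, c \in lA -> (row_of c <= k)%N && (k <= col_of c)%N)
  (antiA : forall c d, c \in lA -> d \in lA -> root_le c d -> c = d).

(** The set reached from [vacT] by the moves from [bar (rootA c)] to [rootB c]; in an antichain rows
    and columns are distinct, so these moves do not interfere. *)
Definition setA : {set idx} :=
  (vacT :\: [set bar (rootA c) | c in lA]) :|: [set rootB c | c in lA].

Lemma barA_T c : c \in lA -> bar (rootA c) \in vacT.
Proof. by move=> /regA/andP[rk _]; rewrite inE bar_r pos_l. Qed.

Lemma B_T c : c \in lA -> rootB c \notin vacT.
Proof. by move=> /regA/andP[_ ck]; rewrite inE pos_rootB -ltnNge ltnS. Qed.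

Lemma A_inj : {in lA &, injective (fun c => bar (rootA c))}.
Proof.
move=> c d cA dA /(@bar_inj n)/(congr1 (@pos n)); rewrite !pos_rootA => E.
have [? ? ?] := cellP c; have [? ? ?] := cellP d.
case: (leqP (col_of c) (col_of d)) => h; [|apply/esym]; apply: antiA => //; rewrite /root_le; lia.
Qed.

Lemma B_inj : {in lA &, injective (@rootB n)}.
Proof.
move=> c d cA dA /(congr1 (@pos n)); rewrite !pos_rootB => -[E].
by case: (leqP (row_of c) (row_of d)) => h; [|apply/esym]; apply: antiA => //; rewrite /root_le; lia.
Qed.

Lemma setA_DT : vacT :\: setA = [set bar (rootA c) | c in lA].
Proof.
apply/setP => x; rewrite !in_setD !in_setU in_setD.
case: (boolP (x \in [set bar (rootA c) | c in lA])) => [/imsetP[c cA ->]|nx] /=.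
  rewrite barA_T // andbT /=; apply/imsetP => -[d dA E].
  by have := B_T dA; rewrite -E barA_T.
by case: (x \in vacT); rewrite ?andbF.
Qed.

Lemma setA_TD : setA :\: vacT = [set rootB c | c in lA].
Proof.
apply/setP => x; rewrite !in_setD !in_setU in_setD.
case: (boolP (x \in [set rootB c | c in lA])) => [/imsetP[c cA ->]|nx] /=.
  by rewrite orbT andbT B_T.
by rewrite orbF; case: (x \in vacT); rewrite ?andbF.
Qed.

Lemma perm_im (f : root -> idx) : {in lA &, injective f} ->
  perm_eq (map f lA) (enum [set f c | c in lA]).
Proof.
move=> fi; apply: uniq_perm; rewrite ?enum_uniq ?(map_inj_in_uniq fi) // => x.
by rewrite mem_enum; apply/mapP/imsetP => -[c cA ->]; exists c.
Qed.

Definition pairA c : nat * nat := (pos (rootA c), pos (rootB c)).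
Definition pairP (p : idx * idx) : nat * nat := (pos (bar p.1), pos p.2).

Lemma pairA_inj : injective pairA.
Proof. by move=> c d [E1 E2]; apply: root_inj. Qed.

Lemma matched_sum pl l : matched pl l ->
  (\sum_(p <- map pairP pl) p.1 * p.2 = \sum_(c <- l) pAB c)%N.
Proof.
elim: pl l => [|p pl IH] [|c l] //=; first by rewrite !big_nil.
move=> [e /IH E]; rewrite !big_cons E /=; congr (_ + _)%N.
by rewrite /pAB; case: e => -[-> ->] //; rewrite mulnC.
Qed.

(** The inequality fixes the orientation of each edge, since [rootB] is the end of smaller
    position. *)
Lemma matched_map pl l : matched pl l ->
  all (fun p : nat * nat => p.2 <= p.1)%N (map pairP pl) ->
  map pairP pl = map pairA l.
Proof.
elim: pl l => [|p pl IH] [|c l] //= [e /IH E] /andP[le /E ->]; congr (_ :: _).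
rewrite /pairP /pairA; case: e le => -[e1 e2]; rewrite /= e1 e2 // => le.
by have := rootBA c => le'; congr (_, _); apply/eqP; rewrite eqn_leq le le'.
Qed.

Definition expA : {ffun root -> nat} := [ffun c => (c \in lA) : nat].

Lemma cnt_lA : expo_of lA = expA.
Proof. by apply/ffunP => c; rewrite !ffunE count_uniq_mem. Qed.

Lemma cardDA : #|vacT :\: setA| = size lA.
Proof. by rewrite setA_DT -(size_map (fun c => bar (rootA c))) (perm_size (perm_im A_inj)) -cardE. Qed.

(* Among all matchings between the two sets, the one given by the antichain has
   the largest [Phi]. *)
Lemma matching_A pl l : matching setA l pl ->
  (Phi (expo_of l) <= Phi expA)%N /\
  (Phi (expo_of l) = Phi expA -> map pairP pl = map pairA l /\ perm_eq l lA).
Proof.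
move=> [mpl p1 p2].
have q1 : perm_eq (map fst (map pairA lA)) (map fst (map pairP pl)).
  have -> : map fst (map pairP pl) = map (fun a => pos (bar a)) (map fst pl).
    by rewrite -!map_comp.
  have -> : map fst (map pairA lA) =
      map (fun a => pos (bar a)) (map (fun c => bar (rootA c)) lA).
    by rewrite -!map_comp; apply: eq_map => c /=; rewrite barK.
  apply: perm_map; apply: perm_trans (perm_im A_inj) _.
  by rewrite perm_sym -setA_DT.
have q2 : perm_eq (map snd (map pairA lA)) (map snd (map pairP pl)).
  have -> : map snd (map pairP pl) = map (@pos n) (map snd pl) by rewrite -!map_comp.
  have -> : map snd (map pairA lA) = map (@pos n) (map (@rootB n) lA) by rewrite -!map_comp.
  apply: perm_map; apply: perm_trans (perm_im B_inj) _.
  by rewrite perm_sym -setA_TD.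
have ch : {in map pairA lA &, forall p p' : nat * nat, ~~ ((p.1 < p'.1)%N && (p'.2 < p.2)%N)}.
  move=> _ _ /mapP[c cA ->] /mapP[d dA ->]; apply/negP => /andP[].
  rewrite /= !pos_rootA !pos_rootB => l1 l2.
  have E : d = c by apply: antiA => //; rewrite /root_le; lia.
  by rewrite E ltnn in l1.
have [le eqi] := rearrangement q1 q2 ch.
have SA : (\sum_(p <- map pairA lA) p.1 * p.2)%N = Phi expA.
  by rewrite -cnt_lA Phi_expo_of big_map.
rewrite (matched_sum mpl) SA -Phi_expo_of in le eqi.
split=> // E; have pp : perm_eq (map pairA lA) (map pairP pl) by rewrite -eqi E.
have mm : map pairP pl = map pairA l.
  apply: matched_map mpl _; rewrite -(perm_all _ pp).
  by apply/allP => _ /mapP[c _ ->]; apply: rootBA.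
split=> //; apply: (perm_map_inj pairA_inj).
by rewrite -mm perm_sym.
Qed.


End Antichain.

Lemma in_setA l x : (x \in setA l) =
  (x \in vacT) && (x \notin map (fun c => bar (rootA c)) l) || (x \in map (@rootB n) l).
Proof.
have E (f : root -> idx) : (x \in [set f c | c in l]) = (x \in map f l).
  by apply/imsetP/mapP => -[c cA ->]; exists c.
by rewrite in_setU in_setD !E andbC.
Qed.

(** Induction on the list: undoing the move of the first letter leads to the set of the tail, and
    nothing can cancel this contribution. *)
Lemma vword_setA l : uniq l -> (forall c, c \in l -> (row_of c <= k)%N && (k <= col_of c)%N) ->
  (forall c d, c \in l -> d \in l -> root_le c d -> c = d) -> vword l (setA l) != 0.
Proof.
elim: l => [|c l IH] ul rl al.
  have -> : setA [::] = vacT by apply/setP => x; rewrite in_setA /= andbT orbF.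
  by rewrite [X in X != _]ffunE eqxx oner_eq0.
have {}IH : vword l (setA l) != 0.
  apply: IH => [|d dl|d e dl el]; first by case/andP: ul.
    by apply: rl; rewrite inE dl orbT.
  by apply: al; rewrite inE ?dl ?el orbT.
set I := setA (c :: l).
have cc : c \in c :: l by rewrite mem_head.
have AT := barA_T rl cc; have BT := B_T rl cc.
have nAB : bar (rootA c) != rootB c by apply: contraNneq BT => <-.
have nA : bar (rootA c) \notin map (fun c => bar (rootA c)) l.
  have : uniq (map (fun c => bar (rootA c)) (c :: l)).
    by rewrite (map_inj_in_uniq (A_inj ul al)).
  by case/andP.
have nB : rootB c \notin map (@rootB n) l.
  have : uniq (map (@rootB n) (c :: l)) by rewrite (map_inj_in_uniq (B_inj ul al)).
  by case/andP.
have BI : rootB c \in I by rewrite in_setA /= mem_head orbT.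
have nAB' : bar (rootA c) \notin map (@rootB n) (c :: l).
  by apply/mapP => -[d dl E]; have := B_T rl dl; rewrite -E AT.
have AI : bar (rootA c) \notin I by rewrite in_setA /= mem_head andbF.
have IE : bar (rootA c) |: (I :\ rootB c) = setA l.
  apply/setP => x; rewrite in_setU1 in_setD1 !in_setA !in_cons.
  case: (eqVneq x (bar (rootA c))) => [->|_] /=; first by rewrite AT nA.
  by case: (eqVneq x (rootB c)) => [->|_] //=; rewrite (negPf BT) (negPf nB).
have main : Eop (rootB c) (bar (rootA c)) (vword l) I != 0.
  rewrite EopE BI in_setD1 negb_and AI orbT /= IE.
  by rewrite !mulf_neq0 ?fsgn_neq0.
(* For a long root both terms are the same and add up to twice the main one. *)
rewrite vword_cons; have [E|ne] := eqVneq (rootA c) (rootB c).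
  rewrite -E in main *; rewrite -mulr2n -mulr_natl !mulf_neq0 ?sg_neq0 //.
  by rewrite pnatr_eq0.
(* A contribution of the other term would give a matching of the same [Phi] that traverses [c]
   backwards, and [matching_A] then forces [rootA c = rootB c]. *)
suff -> : Eop (rootA c) (bar (rootB c)) (vword l) I = 0.
  by rewrite mulr0 add0r mulf_neq0 ?sg_neq0.
apply/eqP; apply: contraT => /Eop_neq0[AinI _ /vword_short sh].
have ed : edge_of (rootB c) (rootA c) c by right.
have [_ /(_ (cardDA ul rl al)) [pl mt]] := short_step ed sh AinI.
have [_ /(_ _) []] := matching_A ul rl al mt.
  by rewrite cnt_lA.
move=> /= [E _] _ _; case/eqP: ne; apply: pos_inj.
by rewrite -E barK.
Qed.

(** The dual functional is the coordinate at [setA]: shorter words do not reach this set, and words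
    of the same length but another exponent reach it only with smaller [Phi]. *)
Lemma vac_essential (A : pred root) :
  (forall c, A c -> (row_of c <= k)%N && (k <= col_of c)%N) ->
  (forall c d, A c -> A d -> root_le c d -> c = d) ->
  essential fk vac [ffun c => A c : nat].
Proof.
move=> rA aA; set s := [ffun c => A c : nat].
pose l := word_of s.
have pl : perm_eq l (enum A).
  apply/perm_expo_of; rewrite word_ofK; apply/ffunP => c.
  by rewrite !ffunE count_uniq_mem ?enum_uniq // mem_enum.
have ls c : (c \in l) = A c by rewrite (perm_mem pl) mem_enum.
have ul : uniq l by rewrite (perm_uniq pl) enum_uniq.
have rl c : c \in l -> (row_of c <= k)%N && (k <= col_of c)%N by rewrite ls; apply: rA.
have al c d : c \in l -> d \in l -> root_le c d -> c = d by rewrite !ls; apply: aA.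
have es : expA l = s by apply/ffunP => c; rewrite !ffunE ls.
exists (fun u => u (setA l)); split.
- by move=> a u w; rewrite !ffunE.
- exact: vword_setA.
move=> l' /vword_short [le mt]; rewrite (cardDA ul rl al) in le mt.
have ws : edeg s = size l by rewrite -(word_ofK s) edeg_expo_of.
have [lt|eq] := ltnP (size l) (size l').
  by right; rewrite /expo_lt ws edeg_expo_of lt.
have E : size l = size l' by apply/eqP; rewrite eqn_leq le eq.
have [pl' /(matching_A ul rl al) [lePhi eqPhi]] := mt E; rewrite es in lePhi eqPhi.
have [ePhi|nPhi] := eqVneq (Phi (expo_of l')) (Phi s).
  left; have [_ pp] := eqPhi ePhi.
  by rewrite (iffLR (perm_expo_of _ _) pp) word_ofK.
by right; rewrite /expo_lt ws edeg_expo_of E eqxx ltnn /= ltn_neqAle nPhi lePhi.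
Qed.

End FockVector.

(** * Tensor products *)

Lemma lin_ffunE (K : numClosedFieldType) (J : finType) (g : {ffun J -> K^o} -> K^o) :
  linear g -> forall u, g u = \sum_j u j * g [ffun j' => (j' == j)%:R].
Proof.
move=> gl u; have g0 : g 0 = 0 by have := gl (-1) 0 0; rewrite !scaleN1r !addNr.
have gD u1 u2 : g (u1 + u2) = g u1 + g u2 by have := gl 1 u1 u2; rewrite !scale1r.
have uE : u = \sum_j u j *: ([ffun j' => (j' == j)%:R] : {ffun J -> K^o}).
  apply/ffunP => j; rewrite sum_ffunE (bigD1 j) //= big1 => [|j' /negPf nj].
    by rewrite !ffunE eqxx addr0; exact/esym/mulr1.
  by rewrite !ffunE eq_sym nj; exact: mulr0.
rewrite {1}uE (big_morph g gD g0); apply: eq_bigr => j _.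
by have := gl (u j) [ffun j' => (j' == j)%:R] 0; rewrite !addr0 g0 addr0.
Qed.

Section Tensor.
Variables (n : nat) (K : numClosedFieldType) (J1 J2 : finType).
Local Notation idx := 'I_(n + n).
Local Notation sp := (sp n K).
Local Notation root := (pos_root n).
Local Notation V1 := {ffun J1 -> K^o}.
Local Notation V2 := {ffun J2 -> K^o}.
Local Notation V := {ffun J1 * J2 -> K^o}.
Variables (rho1 : sp_module n V1) (rho2 : sp_module n V2).
Implicit Types (x y : sp) (u w : V) (l : seq root).

Definition slice1 u (j : J2) : V1 := [ffun i => u (i, j)].
Definition slice2 u (i : J1) : V2 := [ffun j => u (i, j)].

Definition act1 x u : V := [ffun p => rho1 x (slice1 u p.2) p.1].
Definition act2 x u : V := [ffun p => rho2 x (slice2 u p.1) p.2].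

Definition tens_act x u : V := act1 x u + act2 x u.

Lemma slice1_lin k u w j : slice1 (k *: u + w) j = k *: slice1 u j + slice1 w j.
Proof. by apply/ffunP => i; rewrite !ffunE. Qed.

Lemma slice2_lin k u w i : slice2 (k *: u + w) i = k *: slice2 u i + slice2 w i.
Proof. by apply/ffunP => j; rewrite !ffunE. Qed.

Lemma slice1_act x u j : slice1 (act1 x u) j = rho1 x (slice1 u j).
Proof. by apply/ffunP => i; rewrite !ffunE. Qed.

Lemma slice2_act x u i : slice2 (act2 x u) i = rho2 x (slice2 u i).
Proof. by apply/ffunP => j; rewrite !ffunE. Qed.

Lemma act1_lin x : linear (act1 x).
Proof.
by move=> k u w; apply/ffunP => p; rewrite !ffunE slice1_lin actD actZ !ffunE.
Qed.

Lemma act2_lin x : linear (act2 x).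
Proof.
by move=> k u w; apply/ffunP => p; rewrite !ffunE slice2_lin actD actZ !ffunE.
Qed.

Lemma act12 x y u : act1 x (act2 y u) = act2 y (act1 x u).
Proof.
apply/ffunP => -[i j]; rewrite !ffunE /=.
have l1 : linear (fun w1 : V1 => rho1 x w1 i : K^o).
  by move=> k u1 u2; rewrite actD actZ !ffunE.
have l2 : linear (fun w2 : V2 => rho2 y w2 j : K^o).
  by move=> k u1 u2; rewrite actD actZ !ffunE.
rewrite (lin_ffunE l1) (lin_ffunE l2).
under eq_bigr => i' _ do rewrite !ffunE /= (lin_ffunE l2) mulr_suml.
under [RHS]eq_bigr => j' _ do rewrite !ffunE /= (lin_ffunE l1) mulr_suml.
rewrite exchange_big; apply: eq_bigr => j' _; apply: eq_bigr => i' _ /=.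
by rewrite !ffunE mulrAC.
Qed.

Lemma tens_linl u : linear (tens_act^~ u).
Proof.
by move=> k x y; apply/ffunP => p; rewrite !ffunE !actlD !actlZ !ffunE scalerDr addrACA.
Qed.

Lemma tens_linr x : linear (tens_act x).
Proof. by move=> k u w; rewrite /tens_act act1_lin act2_lin scalerDr addrACA. Qed.

Lemma tens_bracket x y u : tens_act (sp_bracket x y) u =
  tens_act x (tens_act y u) - tens_act y (tens_act x u).
Proof.
have d1 x' u' w' : act1 x' (u' + w') = act1 x' u' + act1 x' w'.
  by have := act1_lin x' 1 u' w'; rewrite !scale1r.
have d2 x' u' w' : act2 x' (u' + w') = act2 x' u' + act2 x' w'.
  by have := act2_lin x' 1 u' w'; rewrite !scale1r.
have b1 : act1 (sp_bracket x y) u = act1 x (act1 y u) - act1 y (act1 x u).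
  by apply/ffunP => p; rewrite !ffunE !slice1_act sp_act_bracket !ffunE.
have b2 : act2 (sp_bracket x y) u = act2 x (act2 y u) - act2 y (act2 x u).
  by apply/ffunP => p; rewrite !ffunE !slice2_act sp_act_bracket !ffunE.
rewrite /tens_act !d1 !d2 b1 b2 !act12.
set A := act1 x _; set B := act1 y _; set C := act2 x (act2 _ _); set D := act2 y (act2 _ _).
set P := act2 y _; set Q := act2 x _.
have -> : A + P + (Q + C) = A + C + (P + Q) by rewrite [Q + C]addrC addrACA.
have -> : B + Q + (P + D) = B + D + (P + Q) by rewrite [P + D]addrC addrACA [Q + P]addrC.
by rewrite opprD [RHS]addrACA subrr addr0 opprD addrACA.
Qed.

Definition tens_sp : sp_module n V := SpModule tens_linl tens_linr tens_bracket.

Implicit Types (f : V1) (g : V2).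

Definition tens f g : V := [ffun p => f p.1 * g p.2].

Lemma tens_spE x f g :
  tens_sp x (tens f g) = tens (rho1 x f) g + tens f (rho2 x g).
Proof.
apply/ffunP => -[i j]; rewrite !ffunE /=.
have -> : slice1 (tens f g) j = g j *: f.
  by apply/ffunP => i'; rewrite !ffunE /=; exact: mulrC.
have -> : slice2 (tens f g) i = f i *: g by apply/ffunP => j'; rewrite !ffunE.
by rewrite !actZ !ffunE; congr (_ + _); exact: mulrC.
Qed.

Lemma tens0l g : tens 0 g = 0.
Proof. by apply/ffunP => p; rewrite !ffunE mul0r. Qed.

Lemma tens0r f : tens f 0 = 0.
Proof. by apply/ffunP => p; rewrite !ffunE mulr0. Qed.

Lemma tensZl k f g : tens (k *: f) g = k *: tens f g.
Proof. by apply/ffunP => p; rewrite !ffunE; exact/esym/mulrA. Qed.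

Lemma tensZr k f g : tens f (k *: g) = k *: tens f g.
Proof. by apply/ffunP => p; rewrite !ffunE; exact: mulrCA. Qed.

Lemma word_nseqSr (U : lmodType K) (rho : sp_module n U) p x (z : U) :
  word rho (nseq p.+1 x) z = word rho (nseq p x) (rho x z).
Proof. by elim: p => [//|p IH]; exact: (congr1 (rho x) IH). Qed.

(** The binomial argument, each application of [x] lowering one of the two exponents. With p = b1 +
    1 and q = b2 + 1 the result is exactly b1 + b2 + 1, the exponent for the sum of two weights. *)
Lemma tens_nilp p q x f g : word rho1 (nseq p x) f = 0 ->
  word rho2 (nseq q x) g = 0 -> word tens_sp (nseq (p + q).-1 x) (tens f g) = 0.
Proof.
move En : (p + q)%N => e; elim: e p q f g En => [|e IH] p q f g En.
  by case: p En => // _ /= ->; rewrite tens0l ?word0.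
case: p En => [_ /= -> _|p En]; first by rewrite tens0l ?word0.
case: q En => [_ _ /= ->|q En]; first by rewrite tens0r ?word0.
move=> h1 h2; have e0 : e = (p + q).+1 by lia.
rewrite /= {1}e0 word_nseqSr tens_spE wordD -[(p + q)%N]/(p + q).+1.-1 -e0.
rewrite (IH p q.+1) ?(IH p.+1 q) ?addr0 //; try lia.
  by rewrite -word_nseqSr.
by rewrite -word_nseqSr.
Qed.

(** The coproduct of a word: all ways of sharing its letters, in order, between two factors. *)
Fixpoint splits (T : Type) (s : seq T) : seq (seq T * seq T) :=
  if s is a :: s' then
    map (fun p => (a :: p.1, p.2)) (splits s') ++ map (fun p => (p.1, a :: p.2)) (splits s')
  else [:: ([::], [::])].

Lemma rword_tens l f g : rword tens_sp l (tens f g) =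
  \sum_(p <- splits l) tens (rword rho1 p.1 f) (rword rho2 p.2 g).
Proof.
elim: l => [|c l IH]; first by rewrite big_seq1.
have -> : rword tens_sp (c :: l) (tens f g) =
  tens_sp (Xr K c) (rword tens_sp l (tens f g)) by [].
rewrite IH act_sum big_cat /= !big_map -big_split; apply: eq_bigr => p _ /=.
exact: tens_spE.
Qed.

Lemma cnt_splits l p : p \in splits l ->
  expo_of l = [ffun c => expo_of p.1 c + expo_of p.2 c]%N.
Proof.
elim: l p => [|c l IH] p; first by rewrite inE => /eqP ->; apply/ffunP => d; rewrite !ffunE.
rewrite mem_cat => /orP[] /mapP[q /IH E ->]; apply/ffunP => d;
  have := congr1 (fun e : {ffun root -> nat} => e d) E; rewrite !ffunE /= => ->; lia.
Qed.

Lemma splits_ex l (s1 s2 : {ffun root -> nat}) : expo_of l = [ffun c => s1 c + s2 c]%N ->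
  exists2 p, p \in splits l & expo_of p.1 = s1 /\ expo_of p.2 = s2.
Proof.
elim: l s1 s2 => [|c l IH] s1 s2 E.
  exists ([::], [::]); first by rewrite inE.
  by split; apply/ffunP => d; have := congr1 (fun e : {ffun root -> nat} => e d) E;
    rewrite !ffunE /=; lia.
have Ed d : ((c == d) + count_mem d l)%N = (s1 d + s2 d)%N.
  by have := congr1 (fun e : {ffun root -> nat} => e d) E; rewrite !ffunE.
have [s1c|s1c] := posnP (s1 c).
  have [|p pl [p1 p2]] := IH s1 [ffun d => s2 d - (c == d)]%N.
    apply/ffunP => d; rewrite !ffunE; have := Ed d.
    by case: (eqVneq c d) => [<-|_] /=; rewrite ?s1c; lia.
  exists (p.1, c :: p.2); first by rewrite mem_cat (map_f (fun p => (p.1, c :: p.2))) // orbT.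
  split=> //; apply/ffunP => d; have := congr1 (fun e : {ffun root -> nat} => e d) p2.
  rewrite !ffunE /= => ->; have := Ed d.
  by case: (eqVneq c d) => [<-|_] /=; rewrite ?s1c; lia.
have [|p pl [p1 p2]] := IH [ffun d => s1 d - (c == d)]%N s2.
  apply/ffunP => d; rewrite !ffunE; have := Ed d.
  by case: (eqVneq c d) => [<-|_] /=; [case: (s1 c) s1c => // ? _|]; lia.
exists (c :: p.1, p.2); first by rewrite mem_cat (map_f (fun p => (c :: p.1, p.2))).
split=> //; apply/ffunP => d; have := congr1 (fun e : {ffun root -> nat} => e d) p1.
rewrite !ffunE /= => ->; have := Ed d.
by case: (eqVneq c d) => [<-|_] /=; [case: (s1 c) s1c => // ? _|]; lia.
Qed.

End Tensor.

(** * Concrete models of the highest weight modules *)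

Section Model.
Variables (n : nat) (K : numClosedFieldType).
Local Notation idx := 'I_(n + n).
Local Notation sp := (sp n K).
Local Notation root := (pos_root n).
Local Notation expo := {ffun pos_root n -> nat}.
Implicit Types (l : seq root) (s t : expo).

Record model (m : 'I_n -> nat) (J : finType) (rho : sp_module n {ffun J -> K^o})
    (w : {ffun J -> K^o}) : Prop := Model {
  model_upper : forall a b : idx, (pos a + pos b < n.*2.-1)%N -> rho (X K a b) w = 0;
  model_cartan : forall i : 'I_n,
    rho (X K (lshift n i) (rshift n i)) w = - (bound m i n)%:R *: w;
  model_rel1 : forall i : 'I_n,
    word rho (nseq (bound m i n).+1 (X K (rshift n i) (rshift n i))) w = 0;
  model_rel2 : forall i j j' : 'I_n, (i <= j)%N -> j' = j.+1 :> nat ->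
    word rho (nseq (bound m i j).+1 (X K (rshift n i) (lshift n j'))) w = 0;
  model_hdot : forall (a b : idx) u u', hdot (rho (X K a b) u) u' =
    - (sg K a * sg K b) * hdot u (rho (X K (bar a) (bar b)) u');
  model_ess : forall s, chain_bounded m s -> essential rho w s }.

Lemma stab_cartan (V : lmodType K) (rho : sp_module n V) (v : V) :
  (forall a b : idx, (pos a + pos b < n.*2.-1)%N -> rho (X K a b) v = 0) ->
  (forall i : 'I_n, exists k, rho (X K (lshift n i) (rshift n i)) v = k *: v) ->
  forall a b : idx, (pos a + pos b <= n.*2.-1)%N -> stab rho v (X K a b).
Proof.
move=> up ca a b; rewrite leq_eqVlt => /orP[/eqP E|/up E]; last by exists 0; rewrite E scale0r.
have -> : b = bar a by apply: pos_inj; rewrite pos_bar; lia.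
by case: (split_ordP a) => i ->; rewrite ?bar_l ?bar_r; [|rewrite XC]; apply: ca.
Qed.

Lemma expo_lt_irr s : expo_lt s s = false.
Proof. by rewrite /expo_lt !ltnn andbF. Qed.

(** Degree and [Phi] are both additive, so their lexicographic order is compatible with sums. *)
Lemma expo_lt_add s1 s2 t1 t2 : s1 = t1 \/ expo_lt s1 t1 -> s2 = t2 \/ expo_lt s2 t2 ->
  (s1 = t1 /\ s2 = t2) \/
  expo_lt [ffun c => s1 c + s2 c]%N [ffun c => t1 c + t2 c]%N.
Proof.
have W (s t : expo) : edeg [ffun c => s c + t c]%N = (edeg s + edeg t)%N.
  by rewrite /edeg -big_split; apply: eq_bigr => c _; rewrite ffunE.
have P (s t : expo) : Phi [ffun c => s c + t c]%N = (Phi s + Phi t)%N.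
  by rewrite /Phi -big_split; apply: eq_bigr => c _; rewrite ffunE mulnDl.
rewrite /expo_lt !W !P => -[->|h1] [->|h2]; [by left|right|right|right];
  try (move/orP: h1 => [h1|/andP[/eqP h1 h1']]);
  try (move/orP: h2 => [h2|/andP[/eqP h2 h2']]); lia.
Qed.

(** Reordering a word changes the vector by shorter root words, and the functional vanishes on words
    shorter than the degree of [s]. *)
Lemma essential_perm (V : lmodType K) (rho : sp_module n V) (v : V) s :
  (forall a b : idx, (pos a + pos b <= n.*2.-1)%N -> stab rho v (X K a b)) ->
  essential rho v s -> exists (xi : V -> K^o) (k : K),
    [/\ linear xi, k != 0, forall l, xi (rword rho l v) != 0 -> expo_of l = s \/ expo_lt s (expo_of l) &
      forall l, expo_of l = s -> xi (rword rho l v) = k].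
Proof.
move=> st [xi [xl xs xv]]; exists xi, (xi (rword rho (word_of s) v)); split=> // l ls.
have x0 : xi 0 = 0 by have := xl (-1) 0 0; rewrite !scaleN1r !addNr.
have pl : perm_eq (map (@Xr n K) (word_of s)) (map (@Xr n K) l).
  by apply: perm_map; apply/perm_expo_of; rewrite word_ofK.
have := word_perm rho v pl; rewrite size_map => /(pbw_lt_root_span st) /asboolP[k [c [b [bP E]]]].
apply/eqP; rewrite eq_sym -subr_eq0; apply/eqP.
have -> : xi (rword rho (word_of s) v) - xi (rword rho l v) =
    xi (rword rho (word_of s) v - rword rho l v).
  by rewrite [in RHS]addrC -scaleN1r xl scaleN1r addrC.
rewrite /rword E; elim/big_rec: _ => [//|i y _ IH].
rewrite xl IH addr0; have [l' [ll' ->]] := bP i.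
have [->|/xv] := eqVneq (xi (rword rho l' v)) 0; first by rewrite scaler0.
rewrite size_word_of in ll'.
by rewrite /expo_lt => -[E'|]; [move: ll'; rewrite -E' edeg_expo_of ltnn|rewrite edeg_expo_of; lia].
Qed.

(** The functional is the tensor product of the two. On the monomial s1 + s2 only the splittings
    with exponents (s1, s2) survive; by [essential_perm] they all contribute the same nonzero value,
    so they cannot cancel. *)
Lemma essential_tens (J1 J2 : finType) (rho1 : sp_module n {ffun J1 -> K^o})
    (rho2 : sp_module n {ffun J2 -> K^o}) w1 w2 s1 s2 :
  (forall a b : idx, (pos a + pos b <= n.*2.-1)%N -> stab rho1 w1 (X K a b)) ->
  (forall a b : idx, (pos a + pos b <= n.*2.-1)%N -> stab rho2 w2 (X K a b)) ->
  essential rho1 w1 s1 -> essential rho2 w2 s2 ->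
  essential (tens_sp rho1 rho2) (tens w1 w2) [ffun c => s1 c + s2 c]%N.
Proof.
move=> st1 st2 /(essential_perm st1) [x1 [k1 [l1 k10 n1 c1]]].
move=> /(essential_perm st2) [x2 [k2 [l2 k20 n2 c2]]].
pose xi (u : {ffun J1 * J2 -> K^o}) : K^o :=
  x1 [ffun i => x2 [ffun j => u (i, j)]].
have xil : linear xi.
  move=> k u u'; rewrite /xi -l1; congr x1; apply/ffunP => i; rewrite !ffunE -l2.
  by congr x2; apply/ffunP => j; rewrite !ffunE.
have x10 : x1 0 = 0 by have := l1 (-1) 0 0; rewrite !scaleN1r !addNr.
have x20 : x2 0 = 0 by have := l2 (-1) 0 0; rewrite !scaleN1r !addNr.
have xi0 : xi 0 = 0 by have := xil (-1) 0 0; rewrite !scaleN1r !addNr.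
have xit u u' : xi (tens u u') = x1 u * x2 u'.
  have -> : xi (tens u u') = x1 (x2 u' *: u).
    congr x1; apply/ffunP => i; rewrite !ffunE.
    have -> : [ffun j => tens u u' (i, j)] = u i *: u' by apply/ffunP => j; rewrite !ffunE.
    have := l2 (u i) u' 0; rewrite !addr0 x20 addr0 => ->.
    exact: mulrC.
  have := l1 (x2 u') u 0; rewrite !addr0 x10 addr0 => ->.
  exact: mulrC.
have xiw l : xi (rword (tens_sp rho1 rho2) l (tens w1 w2)) =
    \sum_(p <- splits l) x1 (rword rho1 p.1 w1) * x2 (rword rho2 p.2 w2).
  rewrite rword_tens (big_morph xi (id1 := 0) (op1 := +%R)) //.
    by apply: eq_bigr => p _; rewrite xit.
  by move=> u u'; have := xil 1 u u'; rewrite !scale1r.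
have nz l p : p \in splits l -> x1 (rword rho1 p.1 w1) * x2 (rword rho2 p.2 w2) != 0 ->
    (s1 = expo_of p.1 /\ s2 = expo_of p.2) \/ expo_lt [ffun c => s1 c + s2 c]%N (expo_of l).
  move=> pl; rewrite mulf_eq0 negb_or => /andP[/n1 h1 /n2 h2].
  rewrite (cnt_splits pl); apply: expo_lt_add.
    by case: h1 => [->|]; [left|right].
  by case: h2 => [->|]; [left|right].
exists xi; split=> // [|l].
  rewrite xiw; set l := word_of _.
  have ls : expo_of l = [ffun c => s1 c + s2 c]%N by rewrite word_ofK.
  pose Q (p : seq root * seq root) := (expo_of p.1 == s1) && (expo_of p.2 == s2).
  have E p : p \in splits l -> x1 (rword rho1 p.1 w1) * x2 (rword rho2 p.2 w2) =
      if Q p then k1 * k2 else 0.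
    move=> pl; rewrite /Q; case: ifP => [/andP[/eqP/c1-> /eqP/c2->]//|nQ].
    apply/eqP; apply: contraFT nQ => /(nz _ _ pl) [[-> ->]|]; first by rewrite !eqxx.
    by rewrite ls expo_lt_irr.
  rewrite (eq_big_seq _ E) -big_mkcond /= big_const_seq iter_addr_0 -mulr_natl.
  rewrite !mulf_neq0 // pnatr_eq0 -lt0n -has_count; apply/hasP.
  by have [p pl [p1 p2]] := splits_ex ls; exists p => //; rewrite /Q p1 p2 !eqxx.
rewrite xiw => h; have [p pl pn] : exists2 p, p \in splits l &
    x1 (rword rho1 p.1 w1) * x2 (rword rho2 p.2 w2) != 0.
  apply: contrapT => nex; case/eqP: h; rewrite big1_seq // => p /andP[_ pl].
  by apply/eqP; apply: contraT => pn; case: nex; exists p.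
have [[e1 e2]|] := nz _ _ pl pn; last by right.
by left; rewrite (cnt_splits pl) -e1 -e2.
Qed.

Lemma boundD (m1 m2 : 'I_n -> nat) i j : bound (fun k => m1 k + m2 k)%N i j = (bound m1 i j + bound m2 i j)%N :> nat.
Proof. by rewrite /bound big_split. Qed.

Lemma eq_bound (m1 m2 : 'I_n -> nat) i j : m1 =1 m2 -> @bound n m1 i j = bound m2 i j.
Proof. by move=> e; apply: eq_bigr => k _; rewrite e. Qed.

Lemma triv_lin (U : lmodType K) : linear (fun _ : U => 0 : {ffun unit -> K^o}).
Proof. by move=> k u w; rewrite scaler0 addr0. Qed.

Lemma triv_bracket (x y : sp) (u : {ffun unit -> K^o}) : 0 = 0 - 0 :> {ffun unit -> K^o}.
Proof. by rewrite subr0. Qed.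

Definition triv_sp : sp_module n {ffun unit -> K^o} :=
  @SpModule n K _ (fun _ _ => 0) (fun _ => @triv_lin _) (fun _ => @triv_lin _) triv_bracket.

Lemma model_zero (m : 'I_n -> nat) : (forall i, m i = 0%N) ->
  model m triv_sp [ffun => 1].
Proof.
move=> m0; have b0 i j : bound m i j = 0%N by rewrite /bound big1.
split=> //.
- by move=> i; rewrite b0 oppr0 scale0r.
- by move=> a b u u'; rewrite /= hdot0l hdotC hdot0l conjC0 mulr0.
move=> s sm; have s0 c : s c = 0%N.
  have := sm [:: c] 0%N (col_of c) isT isT; rewrite b0 big_seq1 leqn0 => H.
  by apply/eqP; apply: H; rewrite /= leqnn.
exists (fun u : {ffun unit -> K^o} => u tt); split; first by move=> k u u'; rewrite !ffunE.
  have -> : word_of s = [::].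
    by apply/eqP; rewrite -size_eq0 size_word_of /edeg big1.
  by rewrite ffunE oner_eq0.
case=> [|c l]; last by rewrite /= ffunE eqxx.
by move=> _; left; apply/ffunP => c; rewrite ffunE s0.
Qed.

(** One fundamental weight is split off. A lattice point is its strip, covered by [vac_essential],
    plus a lattice point for the remaining weight, by [strip_chain_bounded]. *)
Lemma model_step (m m' : 'I_n -> nat) (k : 'I_n) (J : finType)
    (rho : sp_module n {ffun J -> K^o}) w :
  (forall k' : 'I_n, (k' < k)%N -> m k' = 0%N) -> (0 < m k)%N ->
  m' =1 (fun i : 'I_n => m i - (i == k))%N ->
  model m' rho w -> model m (tens_sp rho (fock_sp n K)) (tens w (vac K k)).
Proof.
move=> mlow mk mE [up ca r1 r2 hm es].
have mD i j : bound m i j = (bound m' i j + bound (bk k) i j)%N.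
  rewrite -boundD; apply: eq_bound => i'; rewrite mE /bk.
  by case: eqP => [->|_] /=; lia.
split.
- by move=> a b ab; rewrite tens_spE up // vac_upper // tens0l tens0r addr0.
- move=> i; rewrite tens_spE ca vac_cartan tensZl tensZr -scalerDl -opprD -natrD.
  by rewrite -mD.
- move=> i; have := tens_nilp (r1 i) (vac_rel1 K k i).
  by rewrite addnS addSn /= -mD.
- move=> i j j' ij jj; have := tens_nilp (r2 i j j' ij jj) (vac_rel2 K k ij jj).
  by rewrite addnS addSn /= -mD.
- move=> a b u u'; have h1 x u1 u2 : hdot (act1 rho x u1) u2 =
      \sum_j hdot (rho x (slice1 u1 j)) (slice1 u2 j).
    rewrite /hdot exchange_big pair_bigA; apply: eq_bigr => -[i j] _ /=.
    by rewrite !ffunE.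
  have h2 x u1 u2 : hdot (act2 (fock_sp n K) x u1) u2 =
      \sum_i hdot (fock_sp n K x (slice2 u1 i)) (slice2 u2 i).
    by rewrite /hdot pair_bigA; apply: eq_bigr => -[i j] _ /=; rewrite !ffunE.
  have D x u1 u2 : hdot (tens_sp rho (fock_sp n K) x u1) u2 =
      hdot (act1 rho x u1) u2 + hdot (act2 (fock_sp n K) x u1) u2.
    rewrite -[X in X + _]mul1r -[X in X * _]conjC1 -hdotDl scale1r; congr (hdot _ _).
  rewrite [in RHS]hdotC !D !h1 !h2 rmorphD !rmorph_sum /= mulrDr !mulr_sumr.
  congr (_ + _); apply: eq_bigr => i _; rewrite -hdotC; [exact: hm|exact: hdot_fock].
move=> s sm; pose A := strip s k.
have sA c : A c -> (0 < s c)%N by case/andP => /andP[].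
have -> : s = [ffun c => [ffun c => s c - A c]%N c + [ffun c => A c : nat] c]%N.
  by apply/ffunP => c; rewrite !ffunE; case: (A c) (sA c) => [/(_ isT)|_]; lia.
apply: essential_tens.
- by apply: stab_cartan => // i; eexists; apply: ca.
- apply: stab_cartan => [a b|i]; first exact: vac_upper.
  by eexists; apply: vac_cartan.
- apply: es => C i j uC sC aC.
  have := strip_chain_bounded sm mk mlow uC sC aC; rewrite -(eq_bound i j mE).
  by under [in X in _ -> X]eq_bigr do rewrite ffunE.
apply: vac_essential => [c Ac|c d Ac Ad]; last exact: strip_anti Ac Ad.
rewrite (strip_cl sm mk mlow Ac) andbT.
by case/andP: Ac => /andP[].
Qed.

Lemma model_exists (m : 'I_n -> nat) :
  exists (J : finType) (rho : sp_module n {ffun J -> K^o}) w, model m rho w.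
Proof.
move Es: (\sum_i m i)%N => N; elim: N m Es => [|N IH] m Es.
  exists unit, triv_sp, [ffun => 1]; apply: model_zero => i.
  by apply/eqP; rewrite -leqn0 -Es (bigD1 i) //= leq_addr.
have [k0 mk0] : exists k0, (0 < m k0)%N.
  apply: contrapT => nex; move: Es; rewrite big1 // => i _.
  by apply/eqP; rewrite -leqn0 leqNgt; apply/negP => mi; apply: nex; exists i.
have [k mk kmin] := @arg_minnP _ k0 (fun k => 0 < m k)%N (fun k => k : nat) mk0.
have mlow (k' : 'I_n) : (k' < k)%N -> m k' = 0%N.
  move=> lt; apply/eqP; rewrite -leqn0 leqNgt; apply/negP => /kmin; lia.
pose m' (i : 'I_n) := (m i - (i == k))%N.
have [|J [rho [w md]]] := IH m'.
  apply: succn_inj; rewrite -Es (bigD1 k) //= [RHS](bigD1 k) //= /m' eqxx.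
  rewrite (eq_bigr m) => [|i /negPf ->]; last by rewrite subn0.
  by case: (m k) mk => // p _; rewrite subn1 addSn.
exists (J * {set idx})%type, (tens_sp rho (fock_sp n K)), (tens w (vac K k)).
exact: (model_step mlow mk (m' := m')).
Qed.

End Model.

(** * Irreducible modules and their models *)

Section Height.
Variables (n : nat) (K : numClosedFieldType) (V : lmodType K) (rho : sp_module n V) (v : V).
Local Notation idx := 'I_(n + n).
Local Notation sp := (sp n K).
Local Notation root := (pos_root n).
Implicit Types (l : seq root) (u : V).

Hypothesis cartanv : forall i : 'I_n, exists k, rho (X K (lshift n i) (rshift n i)) v = k *: v.

Definition lowspan : {pred V} := lspan [set u | exists l, l != [::] /\ u = rword rho l v].

HB.instance Definition _ := GRing.SubmodClosed.on lowspan.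

Definition depth (c : root) : nat := (pos (rootA c) + pos (rootB c) - n.*2.-1).*2.

Lemma depth_gt0 c : (0 < depth c)%N.
Proof. by rewrite /depth; have := root_lower c; have := pos_lt (rootA c); lia. Qed.

(** The sum of the positive coroots. Its eigenvalue on the lowering vector of a root is minus twice
    the height of the root, which is [depth]. *)
Definition heightel : sp := \sum_(i < n) (n.*2.-1 - i.*2)%:R *: hx K (lshift n i).

Lemma wt_heightel (a : idx) : wt a heightel = (n.*2.-1)%:R - (pos a).*2%:R.
Proof.
have wtS (F : 'I_n -> sp) : wt a (\sum_i F i) = \sum_i wt a (F i).
  by apply: big_morph => [x y|]; rewrite /wt mxE.
rewrite wtS; have wtE (i : 'I_n) : wt a ((n.*2.-1 - i.*2)%:R *: hx K (lshift n i)) =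
    (n.*2.-1 - i.*2)%:R * ((a == lshift n i)%:R - (a == rshift n i)%:R).
  by rewrite -[rshift n i]bar_l -wt_hx /wt mxE.
rewrite (eq_bigr _ (fun i _ => wtE i)).
case: (split_ordP a) => i ->.
  rewrite (bigD1 i) //= big1 => [|j /negPf ji].
    rewrite eqxx eq_lrshift subr0 mulr1 addr0 pos_l natrB //.
    by have := ltn_ord i; lia.
  by rewrite eq_lshift eq_lrshift eq_sym ji subr0 mulr0.
rewrite (bigD1 i) //= big1 => [|j /negPf ji].
  rewrite eqxx eq_rlshift sub0r mulrN1 addr0 pos_r -[RHS]opprB -natrB.
    by congr (- _%:R); have := ltn_ord i; lia.
  by have := ltn_ord i; lia.
by rewrite eq_rlshift eq_rshift eq_sym ji subr0 mulr0.
Qed.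

Lemma cartan_heightel : cartan heightel.
Proof.
apply/is_diag_mxP => a b ab.
rewrite (big_morph (fun x : sp => submod_val x a b) (id1 := 0) (op1 := +%R)); last first.
- by rewrite mxE.
- by move=> x y; rewrite mxE.
rewrite big1 // => i _; rewrite [LHS]mxE.
by have /is_diag_mxP -> := cartan_hx K (lshift n i); rewrite ?mulr0.
Qed.

Lemma heightel_Xr c : sp_bracket heightel (Xr K c) = - (depth c)%:R *: Xr K c.
Proof.
rewrite cartan_X ?wt_heightel; last exact: cartan_heightel.
congr (_ *: _); rewrite addrACA -opprD -!natrD -opprB; congr (- _).
by rewrite -natrB; [congr (_%:R); rewrite /depth|]; have := root_lower c; lia.
Qed.

Lemma heightel_v : exists mu, rho heightel v = mu *: v.
Proof.
rewrite actl_sum; elim/big_rec: _ => [|i y _ [mu ->]]; first by exists 0; rewrite scale0r.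
have [k kE] := cartanv i; rewrite /hx !actlZ bar_l kE !scalerA -scalerDl.
by eexists.
Qed.

Definition depths l : nat := \sum_(c <- l) depth c.

Lemma heightel_rword mu l : rho heightel v = mu *: v ->
  rho heightel (rword rho l v) = (mu - (depths l)%:R) *: rword rho l v.
Proof.
move=> Hv; elim: l => [|c l IH]; first by rewrite /depths big_nil subr0.
have -> : rword rho (c :: l) v = rho (Xr K c) (rword rho l v) by [].
rewrite act_swap IH heightel_Xr actZ actlZ -scalerDl /depths big_cons natrD.
by congr (_ *: _); ring.
Qed.

(* The product of the operators [heightel - (mu - j)], [0 < j <= B], separates [v]
   from the vectors of lower height. *)
Fixpoint sieve mu B u : V :=
  if B is B'.+1 then rho heightel (sieve mu B' u) - (mu - B%:R) *: sieve mu B' u else u.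

Lemma sieve_lin mu B : linear (sieve mu B).
Proof.
elim: B => [//|B IH] k u w; rewrite /= IH actD actZ scalerDr opprD addrACA.
by rewrite scalerBr !scalerA [k * _]mulrC.
Qed.

Lemma sieve_eigen mu B e u : rho heightel u = (mu - e%:R) *: u ->
  sieve mu B u = (\prod_(j < B) (j.+1%:R - e%:R)) *: u.
Proof.
move=> Hu; elim: B => [|B IH]; first by rewrite big_ord0 scale1r.
rewrite /= IH actZ Hu big_ord_recr /= !scalerA -scalerBl; congr (_ *: _).
by ring.
Qed.

(** A sieve of length B kills all nonempty words of depth at most B but multiplies v by B!, which is
    nonzero. This separates v from lower vectors without weight spaces of V. *)
Lemma top_lowspan k : v != 0 -> k *: v \in lowspan -> k = 0.
Proof.
have [mu Hv] := heightel_v => v0 kv.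
have [B sB] : exists B, forall B', (B <= B')%N -> sieve mu B' (k *: v) = 0.
  have s0 B : sieve mu B 0 = 0 by have := sieve_lin mu B (-1) 0 0; rewrite !scaleN1r !addNr.
  move: kv => /asboolP[N [c [a [aP ->]]]].
  elim/big_rec: _ => [|i y _ [B yB]]; first by exists 0%N => B' _; rewrite s0.
  have [l [l0 ->]] := aP i; exists (B + depths l)%N => B' BB.
  rewrite sieve_lin yB ?addr0; last by lia.
  have h0 : (0 < depths l)%N.
    by case: l l0 {BB} => // c' l _; rewrite /depths big_cons addn_gt0 depth_gt0.
  rewrite (sieve_eigen _ (heightel_rword l Hv)).
  have lt : ((depths l).-1 < B')%N by lia.
  by rewrite (bigD1 (Ordinal lt)) //= prednK // subrr mul0r scale0r scaler0.
have := sB B (leqnn B); rewrite (@sieve_eigen mu B 0%N); last first.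
  by rewrite actZ Hv subr0 !scalerA mulrC.
move/eqP; rewrite !scaler_eq0 (negPf v0) orbF => /orP[|/eqP//].
by rewrite prodf_seq_eq0 => /hasP[j _]; rewrite /= subr0 pnatr_eq0.
Qed.

End Height.

(** * Comparison of V with its model *)

Section Transfer.
Variables (n : nat) (K : numClosedFieldType) (V : lmodType K) (rho : sp_module n V) (v : V).
Local Notation idx := 'I_(n + n).
Local Notation sp := (sp n K).
Local Notation root := (pos_root n).
Variables (m : 'I_n -> nat) (J : finType).
Local Notation T := {ffun J -> K^o}.
Variables (sig : sp_module n T) (w : T).
Hypothesis md : model m sig w.
Hypothesis irr : irreducible rho.
Hypothesis v0 : v != 0.
Hypothesis up : forall a b : idx, (pos a + pos b < n.*2.-1)%N -> rho (X K a b) v = 0.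
Hypothesis ca : forall i : 'I_n,
  rho (X K (lshift n i) (rshift n i)) v = - (bound m i n)%:R *: v.

Definition prod_act (x : sp) (p : V * T) : V * T := (rho x p.1, sig x p.2).

Lemma prod_linl p : linear (prod_act^~ p).
Proof. by move=> k x y; rewrite /prod_act !actlD !actlZ. Qed.

Lemma prod_linr x : linear (prod_act x).
Proof. by move=> k p q; rewrite /prod_act !actD !actZ. Qed.

Lemma prod_bracket x y p : prod_act (sp_bracket x y) p =
  prod_act x (prod_act y p) - prod_act y (prod_act x p).
Proof. by rewrite /prod_act /= !sp_act_bracket. Qed.

Definition prod_sp : sp_module n (V * T)%type := SpModule prod_linl prod_linr prod_bracket.

Lemma word_prod l p : word prod_sp l p = (word rho l p.1, word sig l p.2).
Proof. by elim: l => [|x l /= ->] //=; case: p. Qed.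

Definition graph : {pred V * T} := lspan [set p | exists l, p = word prod_sp l (v, w)].

HB.instance Definition _ := GRing.SubmodClosed.on graph.

Lemma graph_word l p : p \in graph -> word prod_sp l p \in graph.
Proof.
apply: lspan_map; first exact: word_lin.
by move=> _ [l' ->]; apply: lspan_gen; exists (l ++ l'); rewrite word_cat.
Qed.

Lemma stab_prod (a b : idx) : (pos a + pos b <= n.*2.-1)%N -> stab prod_sp (v, w) (X K a b).
Proof.
apply: stab_cartan => [a' b' ab|i].
  by rewrite /= /prod_act /= up // (model_upper md).
by exists (- (bound m i n)%:R); rewrite /= /prod_act /= ca (model_cartan md).
Qed.

(** Words applied to the pair reduce to root words applied to the pair, and the empty word
    contributes the same multiple to both coordinates. *)
Lemma graphP p : p \in graph -> exists k x y,
  [/\ p = (k *: v + x, k *: w + y), x \in lowspan rho v & y \in lowspan sig w].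
Proof.
move=> /asboolP[N [c [a [aP ->]]]]; elim/big_rec: _ => [|i q _ [k [x [y [-> xl yl]]]]].
  by exists 0, 0, 0; rewrite !scale0r !addr0 !rpred0.
suff [k' [x' [y' [-> xl' yl']]]] : exists k x y,
    [/\ a i = (k *: v + x, k *: w + y), x \in lowspan rho v & y \in lowspan sig w].
  exists (c i * k' + k), (c i *: x' + x), (c i *: y' + y); split; rewrite ?rpredD ?rpredZ //.
  by congr (_, _); rewrite /= scalerDr scalerA scalerDl addrACA.
have [l ->] := aP i.
have /(pbw_lt_root_span stab_prod) := word_pbw_lt prod_sp (v, w) (ltnSn (size l)).
move=> /asboolP[N' [c' [a' [aP' ->]]]]; elim/big_rec: _ => [|j q' _ [k' [x' [y' [-> xl' yl']]]]].
  by exists 0, 0, 0; rewrite !scale0r !addr0 !rpred0.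
have [l' [_ ->]] := aP' j; rewrite /rword word_prod /=.
case: (eqVneq l' [::]) => [->|l0] /=.
  exists (c' j + k'), x', y'; split=> //.
  by congr (_, _); rewrite /= scalerDl addrA.
exists k', (c' j *: rword rho l' v + x'), (c' j *: rword sig l' w + y'); split.
- by congr (_, _); rewrite /= addrCA.
- by rewrite rpredD // rpredZ //; apply: lspan_gen; exists l'.
- by rewrite rpredD // rpredZ //; apply: lspan_gen; exists l'.
Qed.

(** The adjoint of the leading letter is a raising element, which kills [w]. *)
Lemma hdot_low y : y \in lowspan sig w -> hdot w y = 0.
Proof.
move=> /asboolP[N [c [a [aP ->]]]]; elim/big_rec: _ => [|i q _ hq].
  by rewrite hdotC hdot0l conjC0.
rewrite hdotDr hq addr0; have [l [l0 ->]] := aP i.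
case: l l0 => // d l _; have -> : rword sig (d :: l) w = sig (Xr K d) (rword sig l w) by [].
rewrite hdotC (model_hdot md) (model_upper md).
  by rewrite hdotC hdot0l conjC0 mulr0 conjC0 mulr0.
by rewrite !pos_bar; have := root_lower d; have := pos_lt (rootA d); have := pos_lt (rootB d); lia.
Qed.

Lemma hdot_adj l : exists k l', forall u u',
  hdot (rword sig l u) u' = k * hdot u (word sig l' u').
Proof.
elim: l => [|d l [k [l' IH]]]; first by exists 1, [::] => u u'; rewrite mul1r.
exists (- (sg K (rootA d) * sg K (rootB d)) * k), (rcons l' (X K (bar (rootA d)) (bar (rootB d)))) => u u'.
have -> : rword sig (d :: l) u = sig (Xr K d) (rword sig l u) by [].
by rewrite (model_hdot md) IH mulrA -cats1 word_cat.
Qed.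

Lemma hdot_eq0 (u : T) : hdot u u = 0 -> u = 0.
Proof.
move=> h; apply/ffunP => j; rewrite ffunE; apply/eqP.
have : (u j)^* * u j == 0.
  have := @psumr_eq0P K J predT (fun i => (u i)^* * u i) _ h j isT.
  by move=> -> // i _; rewrite mulrC mul_conjC_ge0.
by rewrite mulrC mul_conjC_eq0.
Qed.

Lemma model_neq0 : w != 0.
Proof.
have s0 : chain_bounded m [ffun c : root => 0%N].
  by move=> C i j _ _ _; rewrite big1 // => c _; rewrite ffunE.
have [xi [xl x0 _]] := model_ess md s0.
apply: contraNneq x0 => ->; rewrite /rword word0.
by apply/eqP; have := xl (-1) 0 0; rewrite !scaleN1r !addNr.
Qed.

(** By positivity a nonzero [b] pairs nontrivially with some word applied to [w], since such words
    span it. Moving that word across the form gives (0, b') in the graph with [b'] not orthogonal to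
    [w]; but the first coordinate 0 makes the leading coefficient vanish, so [b'] is orthogonal to
    [w]. *)
Lemma graph_snd (b : T) : (0, b) \in graph -> b = 0.
Proof.
move=> g0b; apply: hdot_eq0; apply/eqP; apply: contraT => nz.
have [l nl] : exists l, hdot (rword sig l w) b != 0.
  apply: contrapT => nex; case/eqP: nz.
  have zero y : y \in lowspan sig w -> hdot y b = 0.
    move=> /asboolP[N [c [a [aP ->]]]]; elim/big_rec: _ => [|i q _ hq]; first exact: hdot0l.
    rewrite hdotDl hq addr0; have [l [_ ->]] := aP i.
    by apply/eqP; apply: contraT; rewrite mulf_eq0 negb_or => /andP[_ h]; case: nex; exists l.
  have [k [x [y [[_ bE] _ yl]]]] := graphP g0b.
  rewrite {1}bE hdotDl (zero y yl) addr0.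
  by apply/eqP; apply: contraT; rewrite mulf_eq0 negb_or => /andP[_ h]; case: nex; exists [::].
have [k [l' adj]] := hdot_adj l; rewrite adj mulf_eq0 negb_or in nl.
have /andP[_] := nl; have := graph_word l' g0b; rewrite word_prod /= word0.
set b' := word sig l' b => g0b'; have [k' [x [y [[vE bE] xl yl]]]] := graphP g0b'.
have k0 : k' = 0.
  apply: (@top_lowspan _ _ _ rho v _ k' v0); first by move=> i; eexists; apply: ca.
  by move: vE => /esym/eqP; rewrite addr_eq0 => /eqP ->; rewrite rpredN.
by rewrite bE k0 scale0r add0r hdot_low ?eqxx.
Qed.

(** The vectors u with (u, 0) in the graph form a submodule of V, hence zero or everything. In the
    second case (v, 0) places [w] in its own lower span, which is orthogonal to [w]. *)
Lemma graph_fst (a : V) : (a, 0) \in graph -> a = 0.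
Proof.
pose W := lspan [set u : V | (u, 0 : T) \in graph].
have WE u : u \in W -> (u, 0) \in graph.
  apply: (@lspan_map _ V (V * T)%type _ graph (fun u => (u, 0))) => //.
  by move=> k u1 u2; congr (_, _); rewrite /= scaler0 addr0.
have Wst x u : u \in W -> rho x u \in W.
  move=> /WE uW; apply: lspan_gen; have := graph_word [:: x] uW.
  by rewrite word_prod /= act0.
have [_ /(_ W Wst) [W0|W1]] := irr.
  by move=> ag; apply: W0; apply: lspan_gen.
move=> _; exfalso; have [k [x [y [[vE wE] xl yl]]]] := graphP (WE v (W1 v)).
have k1 : 1 - k = 0.
  apply: (@top_lowspan _ _ _ rho v _ (1 - k) v0); first by move=> i; eexists; apply: ca.
  by rewrite scalerBl scale1r {1}vE addrAC subrr add0r.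
move/eqP: k1; rewrite subr_eq0 => /eqP k1; rewrite -k1 scale1r in wE.
have := model_neq0; rewrite -(inj_eq (@addIr _ y)) -wE add0r.
have yw : y = - w by apply/eqP; rewrite -addr_eq0 addrC -wE.
have : hdot w y = 0 by apply: hdot_low.
rewrite yw -scaleN1r hdotZr mulN1r => /eqP; rewrite oppr_eq0 => /eqP /hdot_eq0 ->.
by rewrite scaler0 eqxx.
Qed.

Lemma transfer (I : Type) (r : seq I) (c : I -> K) (l : I -> seq sp) :
  \sum_(i <- r) c i *: word rho (l i) v = 0 <->
  \sum_(i <- r) c i *: word sig (l i) w = 0.
Proof.
have g : (\sum_(i <- r) c i *: word rho (l i) v,
          \sum_(i <- r) c i *: word sig (l i) w) \in graph.
  elim/big_rec2: _ => [|i y x _ IH]; first exact: rpred0.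
  have : c i *: word prod_sp (l i) (v, w) \in graph.
    by rewrite rpredZ //; apply: lspan_gen; exists (l i).
  by move/rpredD => /(_ _ IH); rewrite word_prod.
by split=> E; rewrite E in g; [exact: graph_snd g|exact: graph_fst g].
Qed.

End Transfer.

(** * Bases of the associated graded module *)

Section GradedClasses.
Variables (K : pzRingType) (V : lmodType K) (F : nat -> submodClosed V).
Implicit Types (d e : nat).

Lemma dsum_single_same (Q : nat -> lmodType K) e (q : Q e) : dsum_single q e = q.
Proof.
rewrite /= /dsum_single_val; case: eqP => // ed.
by rewrite (eq_irrelevance ed erefl).
Qed.

Lemma dsum_single_other (Q : nat -> lmodType K) e d (q : Q e) : e != d -> dsum_single q d = 0.
Proof. by rewrite /= /dsum_single_val; case: eqP. Qed.

Lemma dsum_sum (Q : nat -> lmodType K) (I : Type) (r : seq I) (P : pred I)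
    (G : I -> dsum Q) d : (\sum_(i <- r | P i) G i) d = \sum_(i <- r | P i) G i d.
Proof. by apply: (big_morph (fun g : dsum Q => g d)). Qed.

Lemma gr_shift_class (g : V -> V) (gF : forall d u, u \in F d -> g u \in F d.+1)
    (gl : linear g) d u (uF : u \in F d) :
  gr_shift gF gl (gr_class uF) = gr_class (gF d u uF).
Proof.
apply: dsumP => -[|e].
  by rewrite /gr_class dsum_single_other.
have -> : gr_shift gF gl (gr_class uF) e.+1 = gr_shift_piece gF (gr_class uF e) by [].
have [<-|ne] := eqVneq d e.
  by rewrite !dsum_single_same (gr_shift_pieceE gF gl (Submod uF)); congr (qclass _ _); apply: submod_inj.
by rewrite !dsum_single_other // gr_shift_piece0.
Qed.

Lemma qclassZ (S : submodClosed V) k (y : V) : k *: qclass S y = qclass S (k *: y).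
Proof. exact: qscale_class. Qed.

End GradedClasses.

(** In [is_basis] a coefficient is a function of the point, so the coefficients of a repeated point
    have to be added up. *)
Lemma lspan_basis (K : pzRingType) (W : lmodType K) (I : eqType) (S : set I) (e : I -> W) (w : W) :
  w \in lspan [set u | exists s, S s /\ u = e s] ->
  exists (l : seq I) (c : I -> K), (forall s, s \in l -> S s) /\ w = \sum_(s <- l) c s *: e s.
Proof.
move=> /asboolP[N [k [a [aP ->]]]]; have [t tP] := choice aP.
exists (undup [seq t i | i <- enum 'I_N]), (fun s => \sum_(i < N | t i == s) k i); split.
  by move=> s; rewrite mem_undup => /mapP[i _ ->]; have [] := tP i.
under [RHS]eq_bigr do rewrite scaler_suml.
rewrite (exchange_big_dep predT) //=; apply: eq_bigr => i _.
rewrite (eq_bigl (pred1 (t i))) => [|s]; last by rewrite /= eq_sym.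
have [_ ->] := tP i.
rewrite -big_filter (_ : filter _ _ = [:: t i]) ?big_seq1 //.
apply: perm_small_eq => //; apply: uniq_perm => // [|s].
  by rewrite filter_uniq // undup_uniq.
rewrite mem_filter mem_undup inE /=; case: eqP => // ->; rewrite andTb.
by apply/mapP; exists i => //; rewrite mem_enum.
Qed.

(** * The basis of gr V *)

Section Assembly.
Variables (n : nat) (K : numClosedFieldType) (V : lmodType K) (rho : sp_module n V) (v : V).
Local Notation idx := 'I_(n + n).
Local Notation sp := (sp n K).
Local Notation root := (pos_root n).
Local Notation expo := {ffun pos_root n -> nat}.
Variable (m : 'I_n -> nat).
Implicit Types (s t : expo) (u : V) (l : seq root).

Hypothesis irr : irreducible rho.
Hypothesis hw : highest_weight_vector rho (dominant_weight m) v.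

Lemma hw_upper (a b : idx) : (pos a + pos b < n.*2.-1)%N -> rho (X K a b) v = 0.
Proof. by move=> ab; have [_ h _] := hw; apply: h; apply: X_nplus. Qed.

Lemma hw_cartan (i : 'I_n) :
  rho (X K (lshift n i) (rshift n i)) v = - (bound m i n)%:R *: v.
Proof.
have XE : X K (lshift n i) (rshift n i) = - hx K (lshift n i).
  by rewrite /hx bar_l /sg split_l scaleN1r opprK.
have cX : cartan (X K (lshift n i) (rshift n i)).
  apply/is_diag_mxP => a b ab; rewrite XE [LHS]mxE.
  by have /is_diag_mxP -> := cartan_hx K (lshift n i); rewrite ?oppr0.
have [_ _ /(_ _ cX) ->] := hw; congr (_ *: _).
rewrite (@fund_wtE n K m i); last first.
  move=> k; rewrite /eps XE [LHS]mxE -/(wt (lshift n k) (hx K (lshift n i))) wt_hx bar_l.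
  by rewrite eq_lshift eq_lrshift subr0.
congr (- _%:R); apply: eq_bigl => k; have := ltn_ord k; lia.
Qed.

Lemma hw_neq0 : v != 0. Proof. by have [] := hw. Qed.

Lemma hw_stab (a b : idx) : (pos a + pos b <= n.*2.-1)%N -> stab rho v (X K a b).
Proof. by apply: (stab_cartan hw_upper) => i; eexists; apply: hw_cartan. Qed.

Lemma hw_transfer (J : finType) (sig : sp_module n {ffun J -> K^o}) w (md : model m sig w)
    (I : Type) (r : seq I) (c : I -> K) (l : I -> seq sp) :
  \sum_(i <- r) c i *: word rho (l i) v = 0 <->
  \sum_(i <- r) c i *: word sig (l i) w = 0.
Proof. exact: (transfer md irr hw_neq0 hw_upper hw_cartan). Qed.

Lemma hw_transfer0 (J : finType) (sig : sp_module n {ffun J -> K^o}) w (md : model m sig w) (l : seq sp) :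
  word sig l w = 0 -> word rho l v = 0.
Proof.
have := hw_transfer md [:: tt] (fun=> 1) (fun=> l).
by rewrite !big_seq1 !scale1r => -[_]; apply.
Qed.

Local Notation mon := (xmono rho v).

Lemma hw_basis_span d u : u \in pbw_lt rho v d.+1 -> u \in basis_span rho v m d.
Proof.
have [J [sig [w md]]] := model_exists K m.
apply: (pbw_lt_basis_span hw_upper hw_stab) => [i|i j j' ij jj].
  exact: (hw_transfer0 md (model_rel1 md i)).
exact: (hw_transfer0 md (model_rel2 md ij jj)).
Qed.

Definition basis_lt_span d : {pred V} :=
  lspan [set u | exists t, [/\ chain_bounded m t, (edeg t < d)%N & u = mon t]].

HB.instance Definition _ d := GRing.SubmodClosed.on (basis_lt_span d).

(** Among the points of degree [d] with nonzero coefficient take one of smallest [Phi]. Its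
    functional sees neither terms of lower degree nor terms of degree [d] with larger or equal
    [Phi], so it isolates one coefficient. *)
Lemma independent (l : seq expo) (c : expo -> K) d : uniq l ->
  (forall s, s \in l -> chain_bounded m s) ->
  \sum_(s <- l | edeg s == d) c s *: mon s \in basis_lt_span d ->
  forall s, s \in l -> edeg s = d -> c s = 0.
Proof.
move=> ul lS /asboolP[N [k [a [aP E]]]] s0 s0l ws0.
apply/eqP; apply: contraT => cs0.
have [t tP] := choice aP.
pose B := [seq s <- l | (edeg s == d) && (c s != 0)].
have s0B : s0 \in B by rewrite mem_filter ws0 eqxx cs0.
have [s sB smin] : exists2 s, s \in B & forall s', s' \in B -> (Phi s <= Phi s')%N.
  have [p pB] : exists p, p \in map (@Phi n) B by exists (Phi s0); apply: map_f.
  have ex : exists p, p \in map (@Phi n) B by exists p.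
  have /mapP[s sB sE] : ex_minn ex \in map (@Phi n) B by case: ex_minnP.
  exists s => // s' s'B; rewrite -sE; case: ex_minnP => q _; apply; exact: map_f.
have /[!mem_filter]/andP[/andP[/eqP ws cs] sl] := sB.
have [J [sig [w md]]] := model_exists K m.
have [xi [xl x0 xv]] := model_ess md (lS _ sl).
(* Both sides of the relation go into one list, because the transfer to the model concerns a single
   vanishing sum. *)
pose r : seq (K * expo) := [seq (c s, s) | s <- l & edeg s == d] ++
  [seq (- k i, t i) | i <- index_enum 'I_N].
have rV : \sum_(p <- r) p.1 *: word rho (map (@Xr n K) (word_of p.2)) v = 0.
rewrite big_cat /= !big_map big_filter /= E -big_split big1 // => i _ /=.
  by have [_ _ ->] := tP i; rewrite scaleNr subrr.
have xi0 : xi 0 = 0 by have := xl (-1) 0 0; rewrite !scaleN1r !addNr.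
have := (hw_transfer md r (fun p => p.1) (fun p => map (@Xr n K) (word_of p.2))).1 rV.
move/(congr1 xi); rewrite xi0.
have xiS (I : Type) (q : seq I) (P : pred I) (G : I -> {ffun J -> K^o}) :
    xi (\sum_(i <- q | P i) G i) = \sum_(i <- q | P i) xi (G i).
  apply: big_morph => // u1 u2; by have := xl 1 u1 u2; rewrite !scale1r.
have xiZ b z : xi (b *: z) = b * xi z.
  by have := xl b z 0; rewrite !addr0 xi0 addr0.
rewrite xiS big_cat /= !big_map big_filter /= [X in _ + X]big1 => [|i _]; last first.
  rewrite xiZ; apply/eqP; apply: contraT; rewrite mulf_eq0 negb_or => /andP[_ /xv].
  have [_ wt _] := tP i; rewrite word_ofK => -[ts|].
    by rewrite ts ws ltnn in wt.
  by rewrite /expo_lt ws; lia.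
rewrite addr0 big_mkcond (bigD1_seq s) //= ws eqxx [X in _ + X]big1_seq => [|s' /andP[ss' s'l]].
  by rewrite addr0 xiZ => /eqP; rewrite mulf_eq0 (negPf cs) (negPf x0).
case: eqP => // ws'; rewrite xiZ; apply/eqP; apply: contraT.
rewrite mulf_eq0 negb_or => /andP[cs' /xv]; rewrite word_ofK => -[E'|].
  by rewrite E' eqxx in ss'.
rewrite /expo_lt ws ws' ltnn eqxx /= => lt.
have : s' \in B by rewrite mem_filter ws' eqxx cs' s'l.
by move/smin; rewrite leqNgt lt.
Qed.

Variable f : root -> submod (@nminus n K).
Hypothesis f_neq0 : forall a, f a != 0.
Hypothesis f_root : forall a, root_space (fun h => - root_wt a h) (submod_val (f a)).

Lemma f_scale : exists cf : root -> K, forall a : root,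
  cf a != 0 /\ submod_val (f a) = cf a *: Xr K a.
Proof.
have ex a : exists k, submod_val (f a) = k *: Xr K a by apply: root_vector; apply: f_root.
have [cf cfP] := choice ex; exists cf => a; split=> //.
apply: contraNneq (f_neq0 a) => c0; apply/eqP; apply: submod_inj.
by rewrite cfP c0 scale0r.
Qed.

Definition fmon s : V :=
  foldr (fun a u => iter (s a) (rho (submod_val (f a))) u) v (enum {: root}).

Lemma fmonE : exists g : expo -> K, forall s, g s != 0 /\ fmon s = g s *: mon s.
Proof.
have [cf cfP] := f_scale.
exists (fun s => \prod_(a <- enum {: root}) cf a ^+ s a) => s; split.
  by rewrite prodf_seq_neq0; apply/allP => a _ /=; rewrite expf_neq0 //; have [] := cfP a.
rewrite /fmon /xmono /rword /word_of; elim: (enum _) => [|a l IH].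
  by rewrite big_nil scale1r.
rewrite /= map_cat word_cat big_cons -scalerA IH; set W := word rho (map _ (flatten _)) v.
set p := \prod_(j <- l) _; rewrite -(wordZ rho (map _ (nseq _ _)) p W); set u := p *: W.
have [_ ->] := cfP a; rewrite map_nseq; elim: (s a) => [|k IHk].
  by rewrite expr0 scale1r.
by rewrite iterS IHk /= actlZ actZ scalerA exprS.
Qed.

Definition is_class d u (W : gr_module rho v) : Prop :=
  exists uF : u \in pbw rho v d, W = gr_class uF.

Lemma is_class_act d u W (x : submod (@nminus n K)) :
  is_class d u W -> is_class d.+1 (rho (submod_val x) u) (gr_act x W).
Proof. by move=> [uF ->]; exists (pbw_act x uF); exact: gr_shift_class. Qed.

Lemma gr_monomial_class s : is_class (edeg s) (fmon s) (gr_monomial rho v f s).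
Proof.
have -> : edeg s = (\sum_(a <- enum {: root}) s a)%N by rewrite big_enum.
rewrite /gr_monomial /fmon; elim: (enum _) => [|a l IH].
  by rewrite big_nil; exists (pbw_generator rho v).
rewrite big_cons /=; elim: (s a) => [//|k IHk].
by rewrite !iterS addSn; apply: is_class_act.
Qed.

Lemma gr_monomial_piece s d : exists2 y : submod (pbw rho v d),
  gr_monomial rho v f s d = qclass _ y &
  submod_val y = if edeg s == d then fmon s else 0.
Proof.
have [uF ->] := gr_monomial_class s; case: eqP => [E|/eqP ne].
  subst d; exists (Submod uF) => //.
  by rewrite /gr_class dsum_single_same.
by exists 0; rewrite /gr_class ?dsum_single_other // qclass0.
Qed.

Lemma pbw_basis_span d u : u \in pbw rho v d -> u \in basis_span rho v m d.
Proof.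
apply: lspan_sub => _ [xs [sx ->]]; apply: hw_basis_span.
have -> : foldr (fun (x : submod (@nminus n K)) w => rho (submod_val x) w) v xs =
    word rho (map (@submod_val _ _ _) xs) v by elim: xs {sx} => //= x xs ->.
by apply: word_pbw_lt; rewrite size_map ltnS.
Qed.

(** The letters of [pbw] are taken in n^-, so membership is read off the proportional vector
    [fmon s]. *)
Lemma xmono_pbw s d : (edeg s <= d)%N -> mon s \in pbw rho v d.
Proof.
move=> sd; have [g gP] := fmonE; have [g0 gE] := gP s.
have [uF _] := gr_monomial_class s.
have -> : mon s = (g s)^-1 *: fmon s by rewrite gE scalerK.
rewrite rpredZ //; apply: lspan_sub uF => _ [xs [sx ->]]; apply: lspan_gen.
by exists xs; split=> //; apply: leq_trans sd.
Qed.

Lemma fil_pred_basis_lt_span d u : u \in fil_pred (pbw rho v) d -> u \in basis_lt_span d.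
Proof.
case: d => [|d]; first by apply: lspan_sub.
move=> /pbw_basis_span; apply: lspan_sub => _ [t [tS td ->]]; apply: lspan_gen.
by exists t.
Qed.

Lemma xmono_fil_pred s d : (edeg s < d)%N -> mon s \in fil_pred (pbw rho v) d.
Proof. by case: d => // d sd; apply: xmono_pbw. Qed.

Lemma gr_sum_piece (I : Type) (r : seq I) (c : I -> K) (e : I -> expo) d
    (y : I -> submod (pbw rho v d)) :
  (forall i, gr_monomial rho v f (e i) d = qclass _ (y i)) ->
  (\sum_(i <- r) c i *: gr_monomial rho v f (e i)) d = qclass _ (\sum_(i <- r) c i *: y i).
Proof.
move=> yE; rewrite dsum_sum; elim/big_rec2: _ => [|i q1 q2 _ ->]; first by rewrite qclass0.
by rewrite qclassD -qclassZ -yE.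
Qed.

Lemma submod_val_sum (S : submodClosed V) (I : Type) (r : seq I) (c : I -> K)
    (y : I -> submod S) :
  submod_val (\sum_(i <- r) c i *: y i) = \sum_(i <- r) c i *: submod_val (y i).
Proof. by elim/big_rec2: _ => [//|i q1 q2 _ <-]. Qed.

Lemma piece_choice (I : Type) (e : I -> expo) d : exists y : I -> submod (pbw rho v d),
  forall i, gr_monomial rho v f (e i) d = qclass _ (y i) /\
    submod_val (y i) = if edeg (e i) == d then fmon (e i) else 0.
Proof.
have ex i : exists y : submod (pbw rho v d), gr_monomial rho v f (e i) d = qclass _ y /\
    submod_val y = if edeg (e i) == d then fmon (e i) else 0.
  by have [y yE yV] := gr_monomial_piece (e i) d; exists y.
by have [y yP] := choice ex; exists y.
Qed.

(** The component of degree [edeg s] is a relation in V modulo the preceding step of the filtration,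
    to which [independent] applies. *)
Lemma gr_independent (l : seq expo) (c : expo -> K) : uniq l ->
  (forall s, s \in l -> chain_bounded m s) ->
  \sum_(s <- l) c s *: gr_monomial rho v f s = 0 -> forall s, s \in l -> c s = 0.
Proof.
move=> ul lS E s sl; have [g gP] := fmonE.
have [y yP] := piece_choice id (edeg s).
have := congr1 (fun W : gr_module rho v => W (edeg s)) E.
rewrite (gr_sum_piece _ _ (fun i => (yP i).1)) -[(0 : gr_module rho v) _]/0.
rewrite -(qclass0 (@fil_lower _ _ (pbw rho v) (edeg s))) => /qclass_eq.
rewrite subr0 unfold_in /= submod_val_sum => /fil_pred_basis_lt_span.
have -> : \sum_(t <- l) c t *: submod_val (y t) =
    \sum_(t <- l | edeg t == edeg s) (c t * g t) *: mon t.
  rewrite [RHS]big_mkcond; apply: eq_bigr => t _; have [_ ->] := yP t.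
  by case: eqP => _; rewrite ?scaler0 //; have [_ ->] := gP t; rewrite scalerA.
move=> /(independent ul lS)/(_ s sl erefl)/eqP; rewrite mulf_eq0.
by have [/negPf -> _] := gP s; rewrite orbF => /eqP.
Qed.

Lemma gr_spanning (W : gr_module rho v) :
  W \in lspan [set w | exists s, chain_bounded m s /\ w = gr_monomial rho v f s].
Proof.
have [g gP] := fmonE; have [N WN] := dsum_fin W.
have -> : W = \sum_(d < N) dsum_single (W d).
  apply: dsumP => d; rewrite dsum_sum; have [dN|Nd] := ltnP d N.
    rewrite (bigD1 (Ordinal dN)) // [X in _ = X + _](dsum_single_same (W d)).
    by rewrite big1 ?addr0 // => e ed; apply: dsum_single_other.
  by rewrite WN // big1 // => e _; apply: dsum_single_other; have := ltn_ord e; lia.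
apply: rpred_sum => d _; move: (W d) => q.
have := valP (generic_quotient.repr q); rewrite /= => /pbw_basis_span/asboolP[M [k [a [aP E]]]].
have [t tP] := choice aP.
have -> : dsum_single q = \sum_(i <- index_enum 'I_M | edeg (t i) == d)
    (k i * (g (t i))^-1) *: gr_monomial rho v f (t i).
  (* Points of degree less than [d] die in the quotient and receive coefficient 0; the inverse of
     [g] undoes the normalisation of the root vectors [f]. *)
  pose k' i := if edeg (t i) == d then k i * (g (t i))^-1 else 0.
  transitivity (\sum_(i <- index_enum 'I_M) k' i *: gr_monomial rho v f (t i)); last first.
    rewrite [RHS]big_mkcond; apply: eq_bigr => i _; rewrite /k'.
    by case: ifP => // _; rewrite scale0r.
  apply: dsumP => e; have [y yP] := piece_choice t e.
  rewrite (gr_sum_piece _ _ (fun i => (yP i).1)).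
  have [ed|ne] := eqVneq (d : nat) e; last first.
    rewrite dsum_single_other // -(qclass0 (@fil_lower _ _ (pbw rho v) e)); apply/qclass_eq.
    rewrite sub0r unfold_in /= submod_val_sum -scaleN1r rpredZ //.
    rewrite big1 ?rpred0 // => i _; rewrite /k'; case: eqP => [ti|]; last by rewrite scale0r.
    by have [_ ->] := yP i; rewrite ti (negPf ne) scaler0.
  subst e; rewrite dsum_single_same -[q in LHS]qclassK; apply/qclass_eq.
  rewrite unfold_in /= submod_val_sum E.
  rewrite -sumrB; apply: rpred_sum => i _; have [_ td ->] := tP i; have [_ ->] := yP i.
  rewrite /k'; case: eqP => [ti|/eqP nt].
    by have [g0 ->] := gP (t i); rewrite scalerA mulfVK // subrr rpred0.
  by rewrite scale0r subr0 rpredZ // xmono_fil_pred // ltn_neqAle nt.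
apply: rpred_sum => i _; apply: rpredZ; apply: lspan_gen; exists (t i); split=> //.
by have [] := tP i.
Qed.

End Assembly.

Theorem theoremB (R : realType) (n : nat) (n_gt0 : (0 < n)%N) (m : 'I_n -> nat)
    (V : lmodType R[i]) (rho : sp_module n V) (v : V)
    (V_irr : irreducible rho)
    (v_hw : highest_weight_vector rho (dominant_weight m) v)
    (f : pos_root n -> submod (@nminus n R[i]))
    (f_neq0 : forall a, f a != 0)
    (f_root : forall a, root_space (fun h => - root_wt a h) (submod_val (f a))) :
  is_basis (polytope_points R m) (gr_monomial rho v f).
Proof.
split=> [l c ul lS E|w].
  apply: (gr_independent V_irr v_hw f_neq0 f_root ul _ E) => s /lS.
  exact: (polytopeP R m s).1.
apply: lspan_basis.
have := gr_spanning V_irr v_hw f_neq0 f_root w.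
apply: lspan_sub => _ [s [sS ->]]; apply: lspan_gen; exists s; split=> //.
exact: (polytopeP R m s).2.
Qed.
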